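(* Let $A$ be a C*-algebra, $G$ be a finitely generated, residually finite group, $\alpha:G\to \mathrm{Aut}(A)$ be an action of $G$ on $A$, and $d\geq 0$ an integer. Then $\dim_{\mathrm{Rok}}(\alpha)\leq d$ if and only if, for each separable, $\alpha$-invariant C*-subalgebra $D\subset A$, there exist $(d+1)$ $G$-equivariant, order zero, contractive completely positive maps $$\varphi_0,\varphi_1,\ldots,\varphi_d:(C(\overline{G}),\sigma)\to (F(D,A),\widetilde{\alpha}_\infty)$$ such that $\sum_{\ell=0}^d\varphi_\ell(1_{C(\overline{G})})=1_{F(D,A)}$.
   Context: All groups are countable and discrete. Elements $a,b$ of a C*-algebra are orthogonal, $a\perp b$, if $ab=ba=a^*b=b^*a=0$. A contractive completely positive (c.c.p.) map has order zero if it sends orthogonal elements to orthogonal elements. Central sequence algebra: $A_\infty:=\ell^\infty(\mathbb{N},A)/c_0(\mathbb{N},A)$, with $A$ embedded as constant sequences. For a C*-subalgebra $D\subset A$, $A_\infty\cap D'=\{x\in A_\infty: xd=dx\ \forall d\in D\}$, $\mathrm{Ann}(D,A_\infty)=\{x\in A_\infty: xd=dx=0\ \forall d\in D\}$, and $F(D,A):=(A_\infty\cap D')/\mathrm{Ann}(D,A_\infty)$, which is unital if $D$ is $\sigma$-unital. If $D$ is $\alpha$-invariant, $\widetilde{\alpha}_\infty$ denotes the induced action of $G$ on $F(D,A)$. Rokhlin dimension: for a subgroup $H\leq G$ of finite index, $\sigma^H$ is the action of $G$ on $C(G/H)$ given by $\sigma^H_t(f)(gH)=f(t^{-1}gH)$.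 $\dim_{\mathrm{Rok}}(\alpha,H)$ is the least integer $d\ge 0$ such that for every separable $\alpha$-invariant C*-subalgebra $D\subset A$ there exist $(d+1)$ $G$-equivariant c.c.p. order zero maps $\varphi_0,\ldots,\varphi_d:(C(G/H),\sigma^H)\to(F(D,A),\widetilde{\alpha}_\infty)$ with $\sum_{\ell=0}^d\varphi_\ell(1_{C(G/H)})=1_{F(D,A)}$ (and $+\infty$ if no such $d$ exists). $\dim_{\mathrm{Rok}}(\alpha)=\sup\{\dim_{\mathrm{Rok}}(\alpha,H): H \text{ a finite index subgroup of } G\}$. Profinite completion: let $\mathcal{I}_G$ be the set of normal subgroups of finite index in $G$. $\overline{G}=\{(g_HH)_{H\in\mathcal{I}_G}: g_KH=g_HH \text{ for all } H,K\in\mathcal{I}_G \text{ with } K\subset H\}\subset\prod_{H\in\mathcal{I}_G}G/H$, with the subspace topology (each $G/H$ finite and discrete). $G$ acts on $\overline{G}$ by $\beta_t((g_HH)_H)=(tg_HH)_H$, and $\sigma:G\to\mathrm{Aut}(C(\overline{G}))$ is the induced action $\sigma_t(f)(x)=f(\beta_{t^{-1}}(x))$. *)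

(* Defs.v *)
From HB Require Import structures.
From mathcomp Require Import all_boot all_order all_algebra.
From mathcomp Require Import complex.
From mathcomp Require Import all_classical reals ereal topology normedtype sequences.
Set Implicit Arguments.
Unset Strict Implicit.
Unset Printing Implicit Defensive.
Import Order.TTheory GRing.Theory Num.Theory.
Import numFieldNormedType.Exports.
Local Open Scope classical_set_scope.
Local Open Scope ring_scope.

(* Complex algebras need not be unital, so the product `x ** y` is not a ring
   multiplication of the library.  Normed *-algebras are not assumed complete
   nor to satisfy the C*-identity: they form a class that is closed, by
   elementary arguments, under bounded families, *-subalgebras and quotients by
   closed *-ideals. *)
HB.mixin Record NormedModule_isStarAlgebra (R : realType) A
    & NormedModule R[i] A := {
  smul : A -> A -> A;
  star : A -> A;
  smulA : associative smul;
  smulDl : left_distributive smul +%R;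
  smulDr : right_distributive smul +%R;
  smulZl : forall (a : R[i]) (x y : A), smul (a *: x) y = a *: smul x y;
  smulZr : forall (a : R[i]) (x y : A), smul x (a *: y) = a *: smul x y;
  starD : {morph star : x y / x + y};
  starZ : forall (a : R[i]) (x : A), star (a *: x) = a^* *: star x;
  starM : forall x y : A, star (smul x y) = smul (star y) (star x);
  starK : involutive star;
  norm_smul : forall x y : A, `|smul x y| <= `|x| * `|y|;
  norm_star : forall x : A, `|star x| = `|x|
}.
#[short(type="normedStarAlgType")]
HB.structure Definition NormedStarAlgebra (R : realType) :=
  {A of NormedModule R[i] A & NormedModule_isStarAlgebra R A}.
Notation "x ** y" := (smul x y) (at level 40, left associativity) : ring_scope.

(* C*-algebras: the completeness axiom is that of the library. *)
HB.mixin Record NormedStarAlgebra_isCstar (R : realType) A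
    & NormedStarAlgebra R A := {
  norm_star_mul : forall x : A, `|star x ** x| = `|x| ^+ 2
}.
#[short(type="cstarAlgType")]
HB.structure Definition CstarAlgebra (R : realType) :=
  {A of NormedStarAlgebra R A & Complete A & NormedStarAlgebra_isCstar R A}.

Section regular.
Variable R : realType.
Fact regular_norm_mul (x y : R[i]^o) : `|x * y| <= `|x| * `|y|.
Proof. by rewrite normrM. Qed.
Fact regular_conjM (x y : R[i]^o) : (x * y)^* = y^* * x^*.
Proof. by rewrite rmorphM mulrC. Qed.
HB.instance Definition _ := NormedModule_isStarAlgebra.Build R (R[i]^o)
  (@mulrA R[i]) (@mulrDl R[i]) (@mulrDr R[i])
  (fun a x y => esym (mulrA a x y)) (fun a x y => mulrCA x a y)
  (rmorphD (@Num.conj R[i])) (fun a x => rmorphM (@Num.conj R[i]) a x)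
  regular_conjM (@conjCK R[i]) regular_norm_mul (@norm_conjC R[i]).
End regular.

Section rnorm.
Context {R : realType}.
(* The norm of a normed R[i]-module is R[i]-valued in the library; rnorm is the
   same number, as an element of R. *)
Definition rnorm (V : normedModType R[i]) (x : V) : R := complex.Re `|x|.

Section normedMod.
Variable V : normedModType R[i].
Implicit Types x y : V.

Lemma rnormE x : `|x| = ((rnorm x)%:C)%C.
Proof. by rewrite RRe_real// ger0_real. Qed.

Lemma rnorm_le x y : (rnorm x <= rnorm y) = (`|x| <= `|y|).
Proof. by rewrite !rnormE lecR. Qed.

Lemma rnorm_ge0 x : 0 <= rnorm x.
Proof. by rewrite -lecR -rnormE normr_ge0. Qed.

Lemma rnormD x y : rnorm (x + y) <= rnorm x + rnorm y.
Proof. by rewrite -lecR rmorphD/= -!rnormE ler_normD. Qed.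

Lemma rnormZ (a : R[i]) x : rnorm (a *: x) = complex.Re `|a| * rnorm x.
Proof.
apply: complexI; rewrite -rnormE normrZ rnormE rmorphM/=.
by rewrite RRe_real// ger0_real.
Qed.

Lemma rnormN x : rnorm (- x) = rnorm x.
Proof. by rewrite /rnorm normrN. Qed.

Lemma rnorm0 : rnorm (0 : V) = 0.
Proof. by rewrite /rnorm normr0. Qed.

Lemma rnorm0_eq0 x : rnorm x = 0 -> x = 0.
Proof. by move=> x0; apply/normr0_eq0; rewrite rnormE x0. Qed.

End normedMod.

Lemma rnormM (A : normedStarAlgType R) (x y : A) :
  rnorm (x ** y) <= rnorm x * rnorm y.
Proof. by rewrite -lecR rmorphM/= -!rnormE norm_smul. Qed.

Lemma rnorm_star (A : normedStarAlgType R) (x : A) : rnorm (star x) = rnorm x.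
Proof. by rewrite /rnorm norm_star. Qed.

End rnorm.

Section smul_theory.
Variables (R : realType) (A : normedStarAlgType R).
Implicit Types x y : A.
Lemma smul0r x : 0 ** x = 0.
Proof. by have := smulZl 0 0 x; rewrite !scale0r. Qed.
Lemma smulr0 x : x ** 0 = 0.
Proof. by have := smulZr 0 x 0; rewrite !scale0r. Qed.
Lemma smulNr x y : (- x) ** y = - (x ** y).
Proof. by rewrite -scaleN1r smulZl scaleN1r. Qed.
Lemma smulrN x y : x ** (- y) = - (x ** y).
Proof. by rewrite -scaleN1r smulZr scaleN1r. Qed.
Lemma smulBl x y z : (x - y) ** z = x ** z - y ** z.
Proof. by rewrite smulDl smulNr. Qed.
Lemma smulBr x y z : x ** (y - z) = x ** y - x ** z.
Proof. by rewrite smulDr smulrN. Qed.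
Lemma star0 : star (0 : A) = 0.
Proof. by have := starZ 0 (0 : A); rewrite rmorph0 !scale0r. Qed.
Lemma starN x : star (- x) = - star x.
Proof. by rewrite -scaleN1r starZ rmorphN rmorph1 scaleN1r. Qed.
End smul_theory.

Section lmod_isRnormed.
Variables (R : realType) (V : lmodType R[i]) (N : V -> R).
Hypothesis ND : forall x y, N (x + y) <= N x + N y.
Hypothesis NZ : forall (a : R[i]) x, N (a *: x) <= complex.Re `|a| * N x.
Hypothesis N0 : forall x, N x = 0 -> x = 0.

Lemma cnormD (x y : V) :
  ((N (x + y))%:C <= (N x)%:C + (N y)%:C)%C.
Proof. by rewrite -rmorphD lecR. Qed.

Lemma cnormZ (a : R[i]) (x : V) : (((N (a *: x))%:C)%C = `|a| * (N x)%:C)%C.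
Proof.
have aE : `|a| = ((complex.Re `|a|)%:C)%C by rewrite RRe_real// ger0_real.
rewrite [in RHS]aE -rmorphM; congr (_%:C)%C; apply/eqP; rewrite eq_le NZ andTb.
have [->|a0] := eqVneq a 0.
  rewrite normr0 mul0r scale0r.
  by have := ND 0 0; rewrite addr0 lerDl.
have := NZ a^-1 (a *: x); rewrite scalerA mulVf// scale1r normfV.
have a_gt0 : 0 < complex.Re `|a| by rewrite -ltcR -aE normr_gt0.
have -> : complex.Re `|a|^-1 = (complex.Re `|a|)^-1.
  by rewrite [in LHS]aE -fmorphV.
by rewrite ler_pdivlMl.
Qed.

Lemma cnorm0_eq0 (x : V) : ((N x)%:C)%C = 0 -> x = 0.
Proof. by move=> /(@complexI R (N x) 0); exact: N0. Qed.

End lmod_isRnormed.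

(* l^oo(I, B), with pointwise operations and the supremum norm. *)
Section linf.
Variables (R : realType) (I : Type) (B : normedStarAlgType R).

Definition bounded_family : {pred I -> B} :=
  [pred f | `[< exists M : R, forall i, rnorm (f i) <= M >] ].

Record linf := Linf { linf_val :> I -> B; _ : linf_val \in bounded_family }.
HB.instance Definition _ := [isSub of linf for linf_val].
HB.instance Definition _ := [Choice of linf by <:].

Lemma bounded_familyP (f : I -> B) :
  reflect (exists M : R, forall i, rnorm (f i) <= M) (f \in bounded_family).
Proof. exact: asboolP. Qed.

Fact bounded_submod : submod_closed bounded_family.
Proof.
split; first by apply/bounded_familyP; exists 0 => i; rewrite rnorm0.
move=> a f g /bounded_familyP[M fM] /bounded_familyP[N gN].
apply/bounded_familyP; exists (complex.Re `|a| * M + N) => i.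
rewrite (le_trans (rnormD _ _))// lerD// rnormZ ler_wpM2l//.
exact: (rnorm_ge0 (a : R[i]^o)).
Qed.
HB.instance Definition _ :=
  GRing.isSubmodClosed.Build R[i] (I -> B) bounded_family bounded_submod.
HB.instance Definition _ := [SubChoice_isSubLmodule of linf by <:].

Definition linf_norm (f : linf) : R := sup (range (fun i => rnorm (f i))).

Lemma linf_norm_ub (f : linf) i : rnorm (f i) <= linf_norm f.
Proof.
apply: ub_le_sup; last by exists i.
have /bounded_familyP[M fM] := valP f.
by exists M => _ [j _ <-]; exact: fM.
Qed.

Lemma linf_norm_le (f : linf) M :
  0 <= M -> (forall i, rnorm (f i) <= M) -> linf_norm f <= M.
Proof.
move=> M0 fM; rewrite /linf_norm; have [->|/set0P ne] := eqVneq (range (fun i => rnorm (f i))) set0.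
  by rewrite sup0.
by apply: ge_sup => // _ [i _ <-]; exact: fM.
Qed.

Lemma linf_norm_ge0 f : 0 <= linf_norm f.
Proof.
rewrite /linf_norm.
have [->|/set0P[_ [i _ _]]] := eqVneq (range (fun i => rnorm (f i))) set0.
  by rewrite sup0.
exact: le_trans (rnorm_ge0 _) (linf_norm_ub f i).
Qed.

Fact linf_normD (f g : linf) : linf_norm (f + g) <= linf_norm f + linf_norm g.
Proof.
apply: linf_norm_le => [|i]; first by rewrite addr_ge0 ?linf_norm_ge0.
by rewrite (le_trans (rnormD _ _))// lerD ?linf_norm_ub.
Qed.

Fact linf_normZ (a : R[i]) (f : linf) :
  linf_norm (a *: f) <= complex.Re `|a| * linf_norm f.
Proof.
have a0 : 0 <= complex.Re `|a| by exact: (rnorm_ge0 (a : R[i]^o)).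
apply: linf_norm_le => [|i]; first by rewrite mulr_ge0 ?linf_norm_ge0.
by rewrite rnormZ ler_wpM2l// linf_norm_ub.
Qed.

Fact linf_norm0 (f : linf) : linf_norm f = 0 -> f = 0.
Proof.
move=> f0; apply/val_inj/funext => i; apply: rnorm0_eq0; apply/eqP.
by rewrite eq_le rnorm_ge0 andbT -f0 linf_norm_ub.
Qed.

HB.instance Definition _ := @Lmodule_isNormed.Build R[i] linf
  (fun f => ((linf_norm f)%:C)%C) (cnormD linf_normD)
  (cnormZ linf_normD linf_normZ) (cnorm0_eq0 linf_norm0).

Lemma rnorm_linf (f : linf) : rnorm f = linf_norm f. Proof. by []. Qed.

Fact mul_bounded (f g : linf) : (fun i => f i ** g i) \in bounded_family.
Proof.
apply/bounded_familyP; exists (linf_norm f * linf_norm g) => i.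
by rewrite (le_trans (rnormM _ _))// ler_pM ?rnorm_ge0 ?linf_norm_ub.
Qed.

Fact star_bounded (f : linf) : (fun i => star (f i)) \in bounded_family.
Proof.
by apply/bounded_familyP; exists (linf_norm f) => i; rewrite rnorm_star linf_norm_ub.
Qed.

Definition linf_mul (f g : linf) : linf := Linf (mul_bounded f g).
Definition linf_star (f : linf) : linf := Linf (star_bounded f).

Program Definition linf_starAlgebra := @NormedModule_isStarAlgebra.Build R linf
  linf_mul linf_star _ _ _ _ _ _ _ _ _ _ _.
Next Obligation. by move=> f g h; apply/val_inj/funext => i /=; rewrite smulA. Qed.
Next Obligation. by move=> f g h; apply/val_inj/funext => i /=; exact: smulDl. Qed.
Next Obligation. by move=> f g h; apply/val_inj/funext => i /=; exact: smulDr. Qed.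
Next Obligation. by move=> a f g; apply/val_inj/funext => i /=; exact: smulZl. Qed.
Next Obligation. by move=> a f g; apply/val_inj/funext => i /=; exact: smulZr. Qed.
Next Obligation. by move=> f g; apply/val_inj/funext => i /=; exact: starD. Qed.
Next Obligation. by move=> a f; apply/val_inj/funext => i /=; exact: starZ. Qed.
Next Obligation. by move=> f g; apply/val_inj/funext => i /=; exact: starM. Qed.
Next Obligation. by move=> f; apply/val_inj/funext => i /=; exact: starK. Qed.
Next Obligation.
move=> f g; rewrite !rnormE -rmorphM lecR; apply: linf_norm_le => [|i].
  by rewrite mulr_ge0 ?linf_norm_ge0.
by rewrite (le_trans (rnormM _ _))// ler_pM ?rnorm_ge0 ?linf_norm_ub.
Qed.
Next Obligation.
move=> f; rewrite !rnormE; congr (_%:C)%C; rewrite !rnorm_linf /linf_norm.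
by under eq_fun do rewrite /= rnorm_star.
Qed.
HB.instance Definition _ := linf_starAlgebra.
End linf.

Section subalg.
Variables (R : realType) (B : normedStarAlgType R).

Record starSubalg := StarSubalg {
  sa_set :> set B;
  sa0 : sa_set 0;
  saD : forall x y, sa_set x -> sa_set y -> sa_set (x + y);
  saZ : forall (a : R[i]) x, sa_set x -> sa_set (a *: x);
  saM : forall x y, sa_set x -> sa_set y -> sa_set (x ** y);
  saS : forall x, sa_set x -> sa_set (star x)
}.

Variable S : starSubalg.

Definition sa_pred : {pred B} := [pred x | `[< sa_set S x >]].

Record subalg := Subalg { subalg_val :> B; _ : subalg_val \in sa_pred }.
HB.instance Definition _ := [isSub of subalg for subalg_val].
HB.instance Definition _ := [Choice of subalg by <:].

Fact sa_submod : submod_closed sa_pred.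
Proof.
split=> [|a x y /asboolP Sx /asboolP Sy]; apply/asboolP; first exact: sa0.
by apply: saD => //; exact: saZ.
Qed.
HB.instance Definition _ := GRing.isSubmodClosed.Build R[i] B sa_pred sa_submod.
HB.instance Definition _ := [SubChoice_isSubLmodule of subalg by <:].

Lemma subalgP (x : subalg) : sa_set S (subalg_val x).
Proof. by case: x => x /= /asboolP. Qed.

Definition mk_subalg (x : B) (Sx : sa_set S x) : subalg := Subalg (introT (asboolP _) Sx).

Fact subalg_normD (x y : subalg) :
  `|subalg_val (x + y)| <= `|subalg_val x| + `|subalg_val y|.
Proof. exact: ler_normD. Qed.
Fact subalg_normZ (a : R[i]) (x : subalg) :
  `|subalg_val (a *: x)| = `|a| * `|subalg_val x|.
Proof. exact: normrZ. Qed.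
Fact subalg_norm0 (x : subalg) : `|subalg_val x| = 0 -> x = 0.
Proof. by move/normr0_eq0 => x0; exact/val_inj. Qed.
HB.instance Definition _ := @Lmodule_isNormed.Build R[i] subalg
  (fun x => `|subalg_val x|) subalg_normD subalg_normZ subalg_norm0.

Definition subalg_mul (x y : subalg) : subalg :=
  mk_subalg (saM (subalgP x) (subalgP y)).
Definition subalg_star (x : subalg) : subalg := mk_subalg (saS (subalgP x)).

Program Definition subalg_starAlgebra :=
  @NormedModule_isStarAlgebra.Build R subalg
  subalg_mul subalg_star _ _ _ _ _ _ _ _ _ _ _.
Next Obligation. by move=> x y z; apply/val_inj/smulA. Qed.
Next Obligation. by move=> x y z; apply/val_inj/smulDl. Qed.
Next Obligation. by move=> x y z; apply/val_inj/smulDr. Qed.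
Next Obligation. by move=> a x y; apply/val_inj/smulZl. Qed.
Next Obligation. by move=> a x y; apply/val_inj/smulZr. Qed.
Next Obligation. by move=> x y; apply/val_inj/starD. Qed.
Next Obligation. by move=> a x; apply/val_inj/starZ. Qed.
Next Obligation. by move=> x y; apply/val_inj/starM. Qed.
Next Obligation. by move=> x; apply/val_inj/starK. Qed.
Next Obligation. by move=> x y; exact: norm_smul. Qed.
Next Obligation. by move=> x; exact: norm_star. Qed.
HB.instance Definition _ := subalg_starAlgebra.
End subalg.

Section quotalg.
Variables (R : realType) (B : normedStarAlgType R).

Record starIdeal := StarIdeal {
  si_set :> set B;
  si0 : si_set 0;
  siD : forall x y, si_set x -> si_set y -> si_set (x + y);
  siZ : forall (a : R[i]) x, si_set x -> si_set (a *: x);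
  siMl : forall x y, si_set y -> si_set (x ** y);
  siMr : forall x y, si_set x -> si_set (x ** y);
  siS : forall x, si_set x -> si_set (star x);
  si_closed : closed si_set
}.

Variable J : starIdeal.

Definition si_pred : {pred B} := [pred x | `[< si_set J x >]].

Fact si_submod : submod_closed si_pred.
Proof.
split=> [|a x y /asboolP Sx /asboolP Sy]; apply/asboolP; first exact: si0.
by apply: siD => //; exact: siZ.
Qed.
HB.instance Definition _ := GRing.isSubmodClosed.Build R[i] B si_pred si_submod.

Definition quotalg : Type := {ideal_quot si_pred}.
HB.instance Definition _ := GRing.Zmodule.on quotalg.

(* The quotient map and a (choice-dependent) section of it. *)
Definition qpi : B -> quotalg := \pi_({ideal_quot si_pred})%qT.
Definition qrepr : quotalg -> B := @repr _ {ideal_quot si_pred}.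

Lemma qreprK : cancel qrepr qpi. Proof. exact: reprK. Qed.

Lemma qpiP x y : qpi x = qpi y <-> si_set J (x - y).
Proof.
split=> [/eqP|Jxy]; first by rewrite -Quotient.idealrBE => /asboolP.
by apply/eqP; rewrite -Quotient.idealrBE; exact/asboolP.
Qed.

Lemma qpiK x : si_set J (qrepr (qpi x) - x).
Proof. by apply/qpiP; rewrite qreprK. Qed.

Lemma qpiD : {morph qpi : x y / x + y}. Proof. by move=> x y; exact: (raddfD \pi_({ideal_quot si_pred})%qT). Qed.

Lemma qpiB : {morph qpi : x y / x - y}.
Proof. by move=> x y; exact: (raddfB \pi_({ideal_quot si_pred})%qT). Qed.

Fact qpi_ind (P : quotalg -> Prop) : (forall x, P (qpi x)) -> forall q, P q.
Proof. by move=> Px q; rewrite -(qreprK q). Qed.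

Definition quot_scale (a : R[i]) (q : quotalg) : quotalg := qpi (a *: qrepr q).
Definition quot_mul (p q : quotalg) : quotalg := qpi (qrepr p ** qrepr q).
Definition quot_star (q : quotalg) : quotalg := qpi (star (qrepr q)).

Fact qpi_scale a x : qpi (a *: x) = quot_scale a (qpi x).
Proof. by apply/esym/qpiP; rewrite -scalerBr; exact/siZ/qpiK. Qed.
Fact qpi_mul x y : qpi (x ** y) = quot_mul (qpi x) (qpi y).
Proof.
apply/esym/qpiP; set x' := qrepr _; set y' := qrepr _.
rewrite (_ : _ - _ = (x' - x) ** y' + x ** (y' - y)).
  by apply: siD; [apply: siMr|apply: siMl]; exact: qpiK.
by rewrite smulBl smulBr addrA subrK.
Qed.
Fact qpi_star x : qpi (star x) = quot_star (qpi x).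
Proof. by apply/esym/qpiP; rewrite -starN -starD; exact/siS/qpiK. Qed.

Program Definition quot_lmodule := @GRing.Zmodule_isLmodule.Build R[i] quotalg
  quot_scale _ _ _ _.
Next Obligation.
by move=> a b; elim/qpi_ind => x; rewrite -!qpi_scale scalerA.
Qed.
Next Obligation. by elim/qpi_ind => v; rewrite -qpi_scale scale1r. Qed.
Next Obligation.
move=> a p q; elim/qpi_ind: p => x; elim/qpi_ind: q => y.
by rewrite -qpiD -!qpi_scale -qpiD scalerDr.
Qed.
Next Obligation.
elim/qpi_ind => x a b.
by rewrite -!qpi_scale -qpiD scalerDl.
Qed.
HB.instance Definition _ := quot_lmodule.

(* The quotient norm: the infimum of the norms of the lifts. *)
Definition quot_norm (q : quotalg) : R :=
  inf [set rnorm x | x in [set x | qpi x = q]].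

Lemma quot_norm_le x : quot_norm (qpi x) <= rnorm x.
Proof. by apply: ge_inf; [exists 0 => _ [y _ <-]; exact: rnorm_ge0|exists x]. Qed.

Lemma quot_norm_ge0 q : 0 <= quot_norm q.
Proof.
apply: lb_le_inf; first by exists (rnorm (qrepr q)), (qrepr q) => //; exact: qreprK.
by move=> _ [y _ <-]; exact: rnorm_ge0.
Qed.

Lemma le_quot_norm (q : quotalg) (a c : R) : 0 <= a ->
  (forall x, qpi x = q -> c <= a * rnorm x) -> c <= a * quot_norm q.
Proof.
rewrite le_eqVlt => /predU1P[<-|a0] h.
  by have := h _ (qreprK q); rewrite !mul0r.
rewrite -ler_pdivrMl//; apply: lb_le_inf.
  by exists (rnorm (qrepr q)), (qrepr q) => //; exact: qreprK.
by move=> _ [x xq <-]; rewrite ler_pdivrMl//; exact: h.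
Qed.

Fact quot_normD (p q : quotalg) : quot_norm (p + q) <= quot_norm p + quot_norm q.
Proof.
rewrite -lerBlDl -[leRHS]mul1r; apply: le_quot_norm => // y yq; rewrite mul1r.
rewrite lerBlDl -lerBlDr -[leRHS]mul1r; apply: le_quot_norm => // x xp.
rewrite mul1r lerBlDr -xp -yq -qpiD.
by rewrite (le_trans (quot_norm_le _))// rnormD.
Qed.

Fact quot_normZ (a : R[i]) (q : quotalg) :
  quot_norm (a *: q) <= complex.Re `|a| * quot_norm q.
Proof.
apply: le_quot_norm => [|x <-]; first exact: (rnorm_ge0 (a : R[i]^o)).
by rewrite -rnormZ [_ *: _](_ : _ = qpi (a *: x)) ?quot_norm_le// qpi_scale.
Qed.

Fact quot_norm0 (q : quotalg) : quot_norm q = 0 -> q = 0.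
Proof.
elim/qpi_ind: q => x q0; rewrite -[0](raddf0 \pi_({ideal_quot si_pred})%qT).
apply/qpiP; rewrite subr0; apply: (@si_closed J) => U /nbhs_ballP[e e0 xU].
have er : e = ((complex.Re e)%:C)%C by rewrite RRe_real// gtr0_real.
have re0 : 0 < complex.Re e by rewrite -ltcR -er.
move: re0; rewrite -q0 => /inf_lt[|_ [y yx <-] ye]; first by exists (rnorm x), x.
exists (x - y); split; first exact/qpiP.
by apply: xU; rewrite -ball_normE/= opprB addrC subrK rnormE er ltcR.
Qed.

HB.instance Definition _ := @Lmodule_isNormed.Build R[i] quotalg
  (fun f => ((quot_norm f)%:C)%C) (cnormD quot_normD)
  (cnormZ quot_normD quot_normZ) (cnorm0_eq0 quot_norm0).

Lemma rnorm_quot (q : quotalg) : rnorm q = quot_norm q. Proof. by []. Qed.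

Fact quot_norm_star_le (q : quotalg) : quot_norm (quot_star q) <= quot_norm q.
Proof.
rewrite -[leRHS]mul1r; apply: le_quot_norm => // x <-; rewrite mul1r.
by rewrite -qpi_star (le_trans (quot_norm_le _))// rnorm_star.
Qed.

Program Definition quot_starAlgebra :=
  @NormedModule_isStarAlgebra.Build R quotalg
  quot_mul quot_star _ _ _ _ _ _ _ _ _ _ _.
Next Obligation.
elim/qpi_ind => x; elim/qpi_ind => y; elim/qpi_ind => z.
by rewrite -!qpi_mul smulA.
Qed.
Next Obligation.
elim/qpi_ind => x; elim/qpi_ind => y; elim/qpi_ind => z.
by rewrite -qpiD -!qpi_mul -qpiD smulDl.
Qed.
Next Obligation.
elim/qpi_ind => x; elim/qpi_ind => y; elim/qpi_ind => z.
by rewrite -qpiD -!qpi_mul -qpiD smulDr.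
Qed.
Next Obligation.
move=> a; elim/qpi_ind => x; elim/qpi_ind => y; rewrite /GRing.scale/=.
by rewrite -qpi_scale -!qpi_mul -qpi_scale smulZl.
Qed.
Next Obligation.
move=> a; elim/qpi_ind => x; elim/qpi_ind => y; rewrite /GRing.scale/=.
by rewrite -qpi_scale -!qpi_mul -qpi_scale smulZr.
Qed.
Next Obligation.
by elim/qpi_ind => x; elim/qpi_ind => y; rewrite -qpiD -!qpi_star -qpiD starD.
Qed.
Next Obligation.
move=> a; elim/qpi_ind => x; rewrite /GRing.scale/=.
by rewrite -qpi_scale -!qpi_star -qpi_scale starZ.
Qed.
Next Obligation.
elim/qpi_ind => x; elim/qpi_ind => y.
by rewrite -qpi_mul -!qpi_star -qpi_mul starM.
Qed.
Next Obligation. by elim/qpi_ind => x; rewrite -!qpi_star starK. Qed.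
Next Obligation.
move=> p q; rewrite !rnormE -rmorphM lecR !rnorm_quot.
apply: le_quot_norm => [|y <-]; first exact: quot_norm_ge0.
rewrite mulrC; apply: le_quot_norm => [|x <-]; first exact: rnorm_ge0.
by rewrite -qpi_mul (le_trans (quot_norm_le _))// mulrC rnormM.
Qed.
Next Obligation.
move=> q; rewrite !rnormE; congr (_%:C)%C; rewrite !rnorm_quot.
apply/eqP; rewrite eq_le quot_norm_star_le/=.
rewrite -[leLHS](_ : quot_norm (quot_star (quot_star q)) = _); last first.
  by elim/qpi_ind: q => x; rewrite -!qpi_star starK.
exact: quot_norm_star_le.
Qed.
HB.instance Definition _ := quot_starAlgebra.

Lemma qpiZ (a : R[i]) x : qpi (a *: x) = a *: qpi x.
Proof. exact: qpi_scale. Qed.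
Lemma qpiM x y : qpi (x ** y) = qpi x ** qpi y.
Proof. exact: qpi_mul. Qed.
Lemma qpiS x : qpi (star x) = star (qpi x).
Proof. exact: qpi_star. Qed.
End quotalg.

Section limits.
Variables (R : realType).

Lemma cvg_rnorm (V : normedModType R[i]) (T : Type) (F : set_system T)
    (FF : Filter F) (f : T -> V) (l : V) :
  f x @[x --> F] --> l <-> rnorm (f x - l) @[x --> F] --> (0 : R).
Proof.
split=> [/cvgrPdist_lt fl|/cvgrPdist_lt fl]; apply/cvgrPdist_lt => e e0.
  have ec0 : 0 < ((e%:C)%C : R[i]) by rewrite ltcR.
  have := fl _ ec0; apply: filterS => x.
  rewrite distrC rnormE ltcR sub0r normrN ger0_norm//; exact: rnorm_ge0.
have er : e = ((complex.Re e)%:C)%C by rewrite RRe_real// gtr0_real.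
have re0 : 0 < complex.Re e by rewrite -ltcR -er.
have := fl _ re0; apply: filterS => x.
by rewrite sub0r normrN ger0_norm ?rnorm_ge0// distrC rnormE er ltcR.
Qed.

Variable A : normedStarAlgType R.

Lemma cvg_smul (T : Type) (F : set_system T) (FF : Filter F) (f g : T -> A)
    (l m : A) : f x @[x --> F] --> l -> g x @[x --> F] --> m ->
  f x ** g x @[x --> F] --> l ** m.
Proof.
move=> /cvg_rnorm fl /cvg_rnorm gm; apply/cvg_rnorm.
pose h x := rnorm (f x - l) * (rnorm (g x - m) + rnorm m) + rnorm l * rnorm (g x - m).
apply: (@squeeze_cvgr _ _ _ _ (fun=> 0) h).
- apply: nearW => x; rewrite rnorm_ge0/=.
  rewrite (_ : _ - _ = (f x - l) ** g x + l ** (g x - m)); last first.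
    by rewrite smulBl smulBr addrA subrK.
  rewrite (le_trans (rnormD _ _))// lerD// ?rnormM//.
  rewrite (le_trans (rnormM _ _))// ler_wpM2l ?rnorm_ge0//.
  by rewrite -[X in rnorm X <= _](subrK m) rnormD.
- exact: cvg_cst.
- rewrite /h -[X in _ --> X](_ : 0 * (0 + rnorm m) + rnorm l * 0 = 0); last first.
    by rewrite mul0r mulr0 addr0.
  apply: cvgD; apply: cvgM => //; last exact: cvg_cst.
  by apply: cvgD => //; exact: cvg_cst.
Qed.

Lemma cvg_star (T : Type) (F : set_system T) (FF : Filter F) (f : T -> A)
    (l : A) : f x @[x --> F] --> l -> star (f x) @[x --> F] --> star l.
Proof.
move=> /cvg_rnorm fl; apply/cvg_rnorm.
by under eq_fun do rewrite -starN -starD rnorm_star.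
Qed.
End limits.

Section contractive.
Variable R : realType.

(* c = (1 - a^2)^(1/2) - 1, obtained as a fixed point, so that no unit of A is
   needed. *)
Lemma star_sqrt (A : cstarAlgType R) (a : A) : star a = a -> rnorm a < 1 ->
  exists c, [/\ star c = c, c ** a = a ** c & c + c = - (a ** a + c ** c)].
Proof.
move=> sa; set q := rnorm a => q1.
have q0 : 0 <= q := rnorm_ge0 a.
pose hf : R[i] := 2^-1.
have hf2 (x : A) : hf *: x + hf *: x = x 
    by rewrite -scalerDl (_ : hf + hf = 1) ?scale1r// [RHS]splitr mul1r.
have hfn (x : A) : rnorm (hf *: x) = 2^-1 * rnorm x.
  rewrite rnormZ; congr (_ * _).
  have -> : hf = ((2^-1 : R)%:C)%C by rewrite fmorphV rmorph_nat.
  by rewrite ger0_norm// lecR invr_ge0.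
pose T (c : A) := - (hf *: (a ** a + c ** c)).
pose c n := iter n T 0.
have cT n : c n.+1 = T (c n) by [].
have cq n : rnorm (c n) <= q.
  elim: n => [|n ih]; first by rewrite rnorm0.
  rewrite cT rnormN hfn (le_trans (ler_wpM2l _ (rnormD _ _)))//.
  have h1 : rnorm (a ** a) <= q by rewrite (le_trans (rnormM _ _))// ler_piMl// ltW.
  have h2 : rnorm (c n ** c n) <= q.
    rewrite (le_trans (rnormM _ _))// (le_trans (ler_pM _ _ ih ih)) ?rnorm_ge0//.
    by rewrite ler_piMl// ltW.
  by rewrite ler_pdivrMl// mulrDl mul1r lerD.
have cd n : rnorm (c n.+1 - c n) <= q ^+ n.
  elim: n => [|n ih]; first by rewrite subr0 expr0 (le_trans (cq 1%N))// ltW.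
  rewrite cT [in X in _ - X]cT /T opprK addrC -scalerBr hfn.
  rewrite opprD addrACA subrr add0r.
  have -> : c n ** c n - c n.+1 ** c n.+1
    = - ((c n.+1 - c n) ** c n.+1 + c n ** (c n.+1 - c n)).
    by rewrite smulBl smulBr addrA subrK opprB.
  rewrite rnormN ler_pdivrMl// (le_trans (rnormD _ _))//.
  rewrite mulrDl mul1r exprS lerD// (le_trans (rnormM _ _))//.
    by rewrite mulrC; apply: ler_pM; rewrite ?rnorm_ge0 ?exprn_ge0 ?cq ?ih.
  by apply: ler_pM; rewrite ?rnorm_ge0 ?cq ?ih.
have cs n : star (c n) = c n.
  elim: n => [|n ih]; first exact: star0.
  rewrite cT /T starN starZ starD !starM ih sa.
  by congr (- (_ *: _)); rewrite /hf fmorphV rmorph_nat.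
have ca n : c n ** a = a ** c n.
  elim: n => [|n ih]; first by rewrite smul0r smulr0.
  rewrite cT /T smulNr smulrN smulZl smulZr; congr (- (_ *: _)).
  rewrite smulDl smulDr smulA; congr (_ + _).
  by rewrite -smulA ih smulA ih smulA.
have : cvg (c n @[n --> \oo]).
  apply: cauchy_cvg.
  pose u n := c n.+1 - c n.
  have -> : c = series u.
    apply/funext => n; rewrite /series/= telescope_sumr// subr0//.
  apply/cauchy_seriesP => e e0.
  have er : e = ((complex.Re e)%:C)%C by rewrite RRe_real// gtr0_real.
  have re0 : 0 < complex.Re e by rewrite -ltcR -er.
  have /cvg_cauchy/cauchy_seriesP/(_ _ re0) : cvg (series (geometric 1 q) @ \oo).
    by apply: is_cvg_geometric_series; rewrite ger0_norm.
  apply: filterS => -[m n]/= mne; rewrite rnormE er ltcR.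
  apply: le_lt_trans mne; apply: le_trans (ler_norm _).
  elim/big_ind2: _ => [|x x' y y' xx' yy'|k _]; first by rewrite rnorm0.
    by rewrite (le_trans (rnormD _ _))// lerD.
  by rewrite mul1r cd.
move=> /cvg_ex[l cl]; exists l.
have uniq (f g : nat -> A) (x y : A) : f =1 g -> f n @[n --> \oo] --> x ->
    g n @[n --> \oo] --> y -> x = y.
  by move=> /funext-> gx gy; exact: (cvg_unique _ gx gy).
split.
- exact: (uniq _ _ _ _ cs (cvg_star _ cl) cl).
- by apply: (uniq _ _ _ _ ca); apply: cvg_smul => //; exact: cvg_cst.
- have cTl : T (c n) @[n --> \oo] --> T l.
    apply: cvgN; apply: cvgZr; apply: cvgD; first exact: cvg_cst.
    exact: cvg_smul.
  have {1 2}-> : l = T l by apply: (uniq _ _ _ _ cT) => //; rewrite cvg_shiftS.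
  by rewrite -opprD hf2.
Qed.

(* A *-homomorphism of C*-algebras is contractive; hence an action on A acts on
   bounded sequences. *)
Lemma star_hom_rnorm (A B : cstarAlgType R) (f : {linear A -> B})
    (fM : forall x y, f (x ** y) = f x ** f y)
    (fS : forall x, f (star x) = star (f x)) (x : A) : rnorm (f x) <= rnorm x.
Proof.
have C (D : cstarAlgType R) (y : D) : rnorm (star y ** y) = rnorm y ^+ 2.
  by apply: complexI; rewrite -rnormE norm_star_mul rnormE rmorphXn.
have step1 a : star a = a -> rnorm a < 1 -> rnorm (f a) <= 1.
  move=> sa a1; have [c [sc ca cE]] := star_sqrt sa a1.
  set b := f a; set e := f c.
  have sb : star b = b by rewrite -fS sa.
  have se : star e = e by rewrite -fS sc.
  have be : e ** b = b ** e by rewrite -!fM ca.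
  have eE : e + e = - (b ** b + e ** e) by rewrite -linearD cE linearN linearD !fM.
  have isom (s : R[i]) z : s^* = - s -> s * s = -1 ->
      rnorm (b ** z + s *: (z + e ** z)) = rnorm z.
    move=> sJ ss; apply/eqP; rewrite -(@eqrXn2 _ 2) ?rnorm_ge0// -!C; apply/eqP.
    congr rnorm.
    rewrite starD starZ starD !starM sb se sJ.
    rewrite smulDl !smulDr !smulZl !smulZr scalerA mulNr ss opprK scale1r.
    rewrite addrACA scaleNr.
    have -> : (star z + star z ** e) ** (b ** z) = (star z ** b) ** (z + e ** z).
      rewrite smulDl smulDr !smulA; congr (_ + _).
      by rewrite -(smulA (star z) e b) be !smulA.
    rewrite addrA subrK.
    have -> : star z ** b ** (b ** z) = star z ** ((b ** b) ** z).
      by rewrite !smulA.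
    have -> : (star z + star z ** e) ** (z + e ** z) =
        star z ** z + star z ** ((e + e + e ** e) ** z).
      by rewrite !(smulDl, smulDr) !smulA -!addrA.
    rewrite addrCA -smulDr -smulDl eE opprD subrK subrr.
    by rewrite smul0r smulr0 addr0.
  have half (z : B) : rnorm (b ** z) <= rnorm z.
    have ii : 'i * 'i = -1 :> R[i] by rewrite -expr2 sqrCi.
    have h1 := isom 'i z (conjCi _) ii.
    have h2 : rnorm (b ** z - 'i *: (z + e ** z)) = rnorm z.
      by rewrite -scaleNr; apply: isom; rewrite ?rmorphN/= ?conjCi// mulrNN.
    have : rnorm (b ** z + b ** z) <= rnorm z + rnorm z.
      rewrite -{1}h1 -{1}h2 (le_trans _ (rnormD _ _))//.
      by rewrite addrACA subrr addr0.
    rewrite -!mulr2n -scaler_nat rnormZ -[leRHS]mulr_natl.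
    have -> : complex.Re `|2%:R : R[i]| = 2%:R.
      by rewrite ger0_norm ?ler0n// -(rmorph_nat (real_complex R)).
    by rewrite ler_pM2l.
  have := half b; rewrite -{1}sb C expr2.
  have [->//|b0] := eqVneq (rnorm b) 0.
  have bgt0 : 0 < rnorm b by rewrite lt_def b0 rnorm_ge0.
  by rewrite -[leRHS]mul1r ler_pM2r.
have step2 a : star a = a -> rnorm (f a) <= rnorm a.
  move=> sa; apply/ler_addgt0Pr => e e0; set t := rnorm a + e.
  have t0 : 0 < t by rewrite ltr_wpDl ?rnorm_ge0.
  have tn (D : cstarAlgType R) (y : D) :
      rnorm (((t^-1)%:C)%C *: y) = t^-1 * rnorm y.
    by rewrite rnormZ ger0_norm// lecR invr_ge0 ltW.
  have := step1 (((t^-1)%:C)%C *: a); rewrite linearZ/= !tn.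
  rewrite starZ sa ler_pdivrMl// mulr1; apply.
    by congr (_ *: _); rewrite conj_Creal// complex_real.
  by rewrite ltr_pdivrMl// mulr1 ltrDl.
rewrite -(@ler_pXn2r _ 2) ?nnegrE ?rnorm_ge0// -!C -fS -fM.
by apply: step2; rewrite starM starK.
Qed.

End contractive.

Section quot_map.
Variables (R : realType) (B B' : normedStarAlgType R).
Variables (J : starIdeal B) (J' : starIdeal B').

(* f is applied to a representative; the result does not depend on it as soon
   as f is additive and maps J into J', see quot_mapE. *)
Definition quot_map (f : B -> B') (q : quotalg J) : quotalg J' :=
  qpi J' (f (qrepr q)).

Lemma quot_mapE (f : B -> B') : {morph f : x y / x - y} ->
  (forall x, si_set J x -> si_set J' (f x)) ->
  forall x, quot_map f (qpi J x) = qpi J' (f x).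
Proof. by move=> fB fJ x; apply/qpiP; rewrite -fB; exact/fJ/qpiK. Qed.
End quot_map.

Definition sub_map (R : realType) (B B' : normedStarAlgType R)
    (S : starSubalg B) (S' : starSubalg B') (f : B -> B')
    (fS : forall x, sa_set S x -> sa_set S' (f x)) (x : subalg S) : subalg S' :=
  mk_subalg (fS _ (subalgP x)).

(* An action of G on A by *-automorphisms; bijectivity follows from cact1 and
   cactMg. *)
Record cstar_action (R : realType) (G : groupType) (A : cstarAlgType R) :=
  CstarAction {
  cact :> G -> {linear A -> A};
  cactM : forall g x y, cact g (x ** y) = cact g x ** cact g y;
  cactS : forall g x, cact g (star x) = star (cact g x);
  cact1 : forall x, cact 1%g x = x;
  cactMg : forall g h x, cact (g * h)%g x = cact g (cact h x)
}.

Section central_sequences.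
Variables (R : realType) (A : cstarAlgType R).

Definition c0_set : set (linf nat A) :=
  [set x | (x : nat -> A) n @[n --> \oo] --> (0 : A)].

Fact c0_0 : c0_set 0. Proof. exact: cvg_cst. Qed.
Fact c0_D x y : c0_set x -> c0_set y -> c0_set (x + y).
Proof. by move=> x0 y0; rewrite /c0_set/= -[0]addr0; exact: cvgD. Qed.
Fact c0_Z (a : R[i]) x : c0_set x -> c0_set (a *: x).
Proof. by move=> x0; rewrite /c0_set/= -(scaler0 _ a); exact: cvgZr. Qed.
Fact c0_bound (x y : linf nat A) (M : R) : 
  (forall n, rnorm (x n) <= M * rnorm (y n)) -> c0_set y -> c0_set x.
Proof.
move=> xy /cvg_rnorm y0; apply/cvg_rnorm.
apply: (@squeeze_cvgr _ _ _ _ (fun=> 0) (fun n => M * rnorm (y n - 0))).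
- by apply: nearW => n; rewrite rnorm_ge0 !subr0 xy.
- exact: cvg_cst.
- by rewrite -(mulr0 M); apply: cvgM => //; exact: cvg_cst.
Qed.
Fact c0_Ml x y : c0_set y -> c0_set (x ** y).
Proof.
apply: (c0_bound (M := linf_norm x)) => n.
by rewrite (le_trans (rnormM _ _))// ler_wpM2r ?rnorm_ge0 ?linf_norm_ub.
Qed.
Fact c0_Mr x y : c0_set x -> c0_set (x ** y).
Proof.
apply: (c0_bound (M := linf_norm y)) => n.
by rewrite mulrC (le_trans (rnormM _ _))// ler_wpM2l ?rnorm_ge0 ?linf_norm_ub.
Qed.
Fact c0_S x : c0_set x -> c0_set (star x).
Proof. by apply: (c0_bound (M := 1)) => n; rewrite mul1r rnorm_star. Qed.
Fact c0_closed : closed c0_set.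
Proof.
move=> x cx; apply/cvgrPdist_lt => e e0.
have e20 : 0 < e / 2 by rewrite divr_gt0.
have [y [/cvgrPdist_lt/(_ _ e20) y0]] := cx _ (nbhsx_ballx x _ e20).
rewrite -ball_normE/= => xy.
move: y0; apply: filterS => n; rewrite !sub0r !normrN => yn.
rewrite -[x n](subrK (y n)) (le_lt_trans (ler_normD _ _))// [e]splitr ltrD//.
apply: le_lt_trans xy; rewrite !rnormE lecR; exact: (linf_norm_ub (x - y)).
Qed.

Definition c0_ideal : starIdeal (linf nat A) :=
  StarIdeal c0_0 c0_D c0_Z c0_Ml c0_Mr c0_S c0_closed.

(* A_oo = l^oo(N, A) / c_0(N, A). *)
Definition Ainf := quotalg c0_ideal.
HB.instance Definition _ := NormedStarAlgebra.on Ainf.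

Fact const_bounded (a : A) : (fun _ : nat => a) \in @bounded_family R nat A.
Proof. by apply/bounded_familyP; exists (rnorm a). Qed.
Definition const_seq (a : A) : linf nat A := Linf (const_bounded a).
Definition const_Ainf (a : A) : Ainf := qpi c0_ideal (const_seq a).

Variable D : starSubalg A.

(* A_oo cap D'. *)
Definition commutant_set : set Ainf :=
  [set x | forall d, sa_set D d -> x ** const_Ainf d = const_Ainf d ** x].

Lemma const_Ainf_star a : const_Ainf (star a) = star (const_Ainf a).
Proof. by rewrite /const_Ainf -qpiS; congr qpi; exact/val_inj. Qed.
Fact cs_0 : commutant_set 0.
Proof. by move=> d _; rewrite smul0r smulr0. Qed.
Fact cs_D x y : commutant_set x -> commutant_set y -> commutant_set (x + y).
Proof. by move=> xD yD d Dd; rewrite smulDl smulDr xD// yD. Qed.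
Fact cs_Z (a : R[i]) x : commutant_set x -> commutant_set (a *: x).
Proof. by move=> xD d Dd; rewrite smulZl smulZr xD. Qed.
Fact cs_M x y : commutant_set x -> commutant_set y -> commutant_set (x ** y).
Proof. by move=> xD yD d Dd; rewrite -smulA yD// smulA xD// smulA. Qed.
Fact cs_S x : commutant_set x -> commutant_set (star x).
Proof.
move=> xD d Dd; rewrite -[const_Ainf d]starK -starM -const_Ainf_star -xD ?starM//.
exact: saS.
Qed.

Definition commutant : starSubalg Ainf := StarSubalg cs_0 cs_D cs_Z cs_M cs_S.

(* Ann(D, A_oo), which is contained in A_oo cap D'. *)
Definition Ann_set : set Ainf :=
  [set x | forall d, sa_set D d -> x ** const_Ainf d = 0 /\ const_Ainf d ** x = 0].

Definition Ann_in : set (subalg commutant) :=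
  [set x | Ann_set (subalg_val x)].

Fact an_0 : Ann_in 0.
Proof. by move=> d _; rewrite smul0r smulr0. Qed.
Fact an_D x y : Ann_in x -> Ann_in y -> Ann_in (x + y).
Proof.
move=> xD yD d Dd; have [x1 x2] := xD d Dd; have [y1 y2] := yD d Dd.
by rewrite /= smulDl smulDr x1 x2 y1 y2 addr0.
Qed.
Fact an_Z (a : R[i]) x : Ann_in x -> Ann_in (a *: x).
Proof.
by move=> xD d /xD[x1 x2]; rewrite /= smulZl smulZr x1 x2 scaler0.
Qed.
Fact an_Ml x y : Ann_in y -> Ann_in (x ** y).
Proof.
move=> yD d Dd; have [y1 y2] := yD d Dd; rewrite /= -smulA y1 smulr0; split=> //.
by rewrite smulA -(subalgP x)// -smulA y2 smulr0.
Qed.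
Fact an_Mr x y : Ann_in x -> Ann_in (x ** y).
Proof.
move=> xD d Dd; have [x1 x2] := xD d Dd; rewrite /= smulA x2 smul0r; split=> //.
by rewrite -smulA (subalgP y)// smulA x1 smul0r.
Qed.
Fact an_S x : Ann_in x -> Ann_in (star x).
Proof.
move=> xD d Dd; have [x1 x2] := xD _ (saS Dd).
by rewrite /= -[const_Ainf d]starK -!starM -const_Ainf_star x1 x2 star0.
Qed.
Fact an_closed : closed Ann_in.
Proof.
have small (z : Ainf) : (forall e : R, 0 < e -> rnorm z <= e) -> z = 0.
  move=> ze; apply: rnorm0_eq0; apply/eqP; rewrite eq_le rnorm_ge0 andbT.
  by apply/ler_addgt0Pr => e e0; rewrite add0r ze.
move=> x cx d Dd.
have key (e : R) : 0 < e -> exists2 y, Ann_set y &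
    rnorm (subalg_val x - y) * rnorm (const_Ainf d) <= e.
  move=> e0; pose k := rnorm (const_Ainf d) + 1.
  have k0 : 0 < k by rewrite ltr_wpDl ?rnorm_ge0.
  have ek0 : 0 < (((e / k)%:C)%C : R[i]) by rewrite ltcR divr_gt0.
  have [y [yA]] := cx _ (nbhsx_ballx x _ ek0).
  rewrite -ball_normE/= rnormE ltcR => xy; exists (subalg_val y) => //.
  rewrite (@le_trans _ _ (e / k * k))//; last by rewrite divfK// gt_eqF.
  by rewrite ler_pM ?rnorm_ge0 ?(ltW xy)// lerDl.
by split; apply: small => e /key[y /(_ _ Dd)[y1 y2]]; apply: le_trans;
  [rewrite -[_ ** _]subr0 -y1 -smulBl rnormM
  |rewrite -[_ ** _]subr0 -y2 -smulBr mulrC rnormM].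
Qed.

Definition Ann : starIdeal (subalg commutant) :=
  StarIdeal an_0 an_D an_Z an_Ml an_Mr an_S an_closed.

(* F(D, A) = (A_oo cap D') / Ann(D, A_oo). *)
Definition Fcs := quotalg Ann.
HB.instance Definition _ := NormedStarAlgebra.on Fcs.
End central_sequences.

Section induced_action.
Variables (R : realType) (G : groupType) (A : cstarAlgType R).
Variable alpha : cstar_action G A.

Fact act_bounded g (x : linf nat A) :
  (fun n => alpha g (x n)) \in @bounded_family R nat A.
Proof.
apply/bounded_familyP; exists (linf_norm x) => n.
by rewrite (le_trans (star_hom_rnorm (cactM alpha g) (cactS alpha g) _))// linf_norm_ub.
Qed.
Definition linf_act g (x : linf nat A) : linf nat A := Linf (act_bounded g x).

Definition Ainf_act g : Ainf A -> Ainf A :=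
  @quot_map R _ _ (c0_ideal A) (c0_ideal A) (linf_act g).

Lemma Ainf_actE g x :
  Ainf_act g (qpi (c0_ideal A) x) = qpi (c0_ideal A) (linf_act g x).
Proof.
apply: quot_mapE => [{}x y|{}x /cvg_rnorm x0].
  by apply/val_inj/funext => n; exact: linearB.
apply/cvg_rnorm; apply: squeeze_cvgr x0; last exact: cvg_cst.
apply: nearW => n; rewrite rnorm_ge0 !subr0/=.
exact: star_hom_rnorm (cactM alpha g) (cactS alpha g) _.
Qed.

Lemma Ainf_actM g x y : Ainf_act g (x ** y) = Ainf_act g x ** Ainf_act g y.
Proof.
rewrite -(qreprK x) -(qreprK y) -qpiM !Ainf_actE -qpiM; congr qpi.
by apply/val_inj/funext => n /=; exact: cactM.
Qed.

Lemma Ainf_act_const g a : Ainf_act g (const_Ainf a) = const_Ainf (alpha g a).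
Proof. by rewrite Ainf_actE; congr qpi; exact/val_inj. Qed.

Definition act_invariant (D : starSubalg A) :=
  forall g x, sa_set D x -> sa_set D (alpha g x).

Variables (D : starSubalg A) (Dinv : act_invariant D).

Lemma Ainf_act_commutant g x :
  sa_set (commutant D) x -> sa_set (commutant D) (Ainf_act g x).
Proof.
move=> xD d Dd; have Dd' : sa_set D (alpha g^-1%g d) by exact: Dinv.
have -> : d = alpha g (alpha g^-1%g d) by rewrite -cactMg mulgV cact1.
by rewrite -Ainf_act_const -!Ainf_actM xD.
Qed.

(* The action induced on F(D, A). *)
Definition Fcs_act g : Fcs D -> Fcs D :=
  @quot_map R _ _ (Ann D) (Ann D)
    (@sub_map R _ _ (commutant D) (commutant D) _ (@Ainf_act_commutant g)).

Lemma Ainf_actB g x y : Ainf_act g (x - y) = Ainf_act g x - Ainf_act g y.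
Proof.
rewrite -(qreprK x) -(qreprK y).
have -> : qpi (c0_ideal A) (qrepr x) - qpi (c0_ideal A) (qrepr y) =
    qpi (c0_ideal A) (qrepr x - qrepr y) :> Ainf A by rewrite qpiB.
rewrite !Ainf_actE.
have -> : linf_act g (qrepr x - qrepr y) =
    linf_act g (qrepr x) - linf_act g (qrepr y).
  by apply/val_inj/funext => n; exact: linearB.
by rewrite qpiB.
Qed.

Lemma Fcs_actE g x :
  Fcs_act g (qpi (Ann D) x) = qpi (Ann D) (sub_map (@Ainf_act_commutant g) x).
Proof.
have act0 : Ainf_act g 0 = 0 by have := Ainf_actB g 0 0; rewrite !subrr.
apply: quot_mapE => [y z|y yD d Dd]; first exact/val_inj/Ainf_actB.
have Dd' : sa_set D (alpha g^-1%g d) by exact: Dinv.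
have [y1 y2] := yD _ Dd'.
have -> : d = alpha g (alpha g^-1%g d) by rewrite -cactMg mulgV cact1.
by rewrite /sub_map/= -Ainf_act_const -!Ainf_actM y1 y2 act0.
Qed.

End induced_action.

Section contfun.
Variables (R : realType) (X : topologicalType).

Definition contfun_set : set (linf X R[i]^o) :=
  [set f | continuous (f : X -> R[i]^o)].

Fact contfun_0 : contfun_set 0. Proof. by move=> x; exact: cvg_cst. Qed.
Fact contfun_D f g : contfun_set f -> contfun_set g -> contfun_set (f + g).
Proof. by move=> cf cg x; exact: cvgD (cf x) (cg x). Qed.
Fact contfun_Z (a : R[i]) f : contfun_set f -> contfun_set (a *: f).
Proof. by move=> cf x; exact: cvgZr (cf x). Qed.
Fact contfun_M f g : contfun_set f -> contfun_set g -> contfun_set (f ** g).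
Proof. by move=> cf cg x; exact: cvg_smul (cf x) (cg x). Qed.
Fact contfun_S f : contfun_set f -> contfun_set (star f).
Proof. by move=> cf x; exact: cvg_star (cf x). Qed.

Definition contfun_subalg : starSubalg (linf X R[i]^o) :=
  StarSubalg contfun_0 contfun_D contfun_Z contfun_M contfun_S.

(* Bounded continuous functions X -> R[i]; this is C(X) when X is compact, by
   compact_contfun_bounded below. *)
Definition contfun := subalg contfun_subalg.
HB.instance Definition _ := NormedStarAlgebra.on contfun.

Fact contfun_one_bounded : (fun _ : X => 1) \in @bounded_family R X R[i]^o.
Proof. by apply/bounded_familyP; exists (rnorm (1 : R[i]^o)). Qed.
Fact contfun_one_cont : contfun_set (Linf contfun_one_bounded).
Proof. by move=> x; exact: cvg_cst. Qed.
Definition contfun1 : contfun := @mk_subalg _ _ contfun_subalg _ contfun_one_cont.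
Lemma compact_contfun_bounded (f : X -> R[i]^o) :
  compact [set: X] -> continuous f -> f \in @bounded_family R X R[i]^o.
Proof.
move=> Xc fc; apply/bounded_familyP.
have rfc : continuous (fun x => rnorm (f x)).
  move=> x; have /cvg_rnorm fx := fc x; apply/cvgrPdist_le => e e0.
  have /cvgrPdist_le/(_ _ e0) := fx; apply: filterS => y.
  rewrite sub0r normrN ger0_norm ?rnorm_ge0// => ye.
  rewrite (le_trans _ ye)// ler_norml; apply/andP; split.
    rewrite lerNl opprB lerBlDr -[in leLHS](subrK (f x) (f y)).
    exact: rnormD.
  rewrite lerBlDr -[in leLHS](subrK (f y) (f x)) -[in leRHS]rnormN opprB.
  exact: rnormD.
have [M [_ Mf]] := compact_bounded (continuous_compact
  (continuous_subspaceT rfc) Xc).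
exists (M + 1) => x; rewrite (le_trans (ler_norm _))//.
by apply: Mf; [rewrite ltrDl|exists x].
Qed.

End contfun.

Section pullback.
Variables (R : realType) (X Y : topologicalType) (h : Y -> X).
Hypothesis h_cont : continuous h.

Fact pullback_bounded (f : contfun R X) :
  (fun y => subalg_val f (h y)) \in @bounded_family R Y R[i]^o.
Proof.
by apply/bounded_familyP; exists (linf_norm (subalg_val f)) => y; exact: linf_norm_ub.
Qed.
Fact pullback_cont (f : contfun R X) : contfun_set (Linf (pullback_bounded f)).
Proof.
move=> y; apply: (@continuous_comp _ _ _ h (subalg_val f)); first exact: h_cont.
exact: (subalgP f).
Qed.
Definition pullback (f : contfun R X) : contfun R Y :=
  @mk_subalg _ _ (contfun_subalg R Y) _ (@pullback_cont f).
End pullback.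

Lemma initial_cvg (S : choiceType) (T : topologicalType) (f : S -> T)
    (U : Type) (F : set_system U) {FF : Filter F} (g : U -> S) (s : S) :
  f (g x) @[x --> F] --> f s -> g x @[x --> F] --> (s : initial_topology f).
Proof.
move=> fg A /= [_ [[B Bop <-] Bfs BA]].
have BN : nbhs (f s) B by exact: open_nbhs_nbhs.
have FB : F [set x | B (f (g x))] := fg _ BN.
by apply: (filterS _ FB) => x; exact: BA.
Qed.

Lemma prod_cvg (I : Type) (T : I -> topologicalType)
    (U : Type) (F : set_system U) {FF : Filter F}
    (g : U -> prod_topology T) (s : prod_topology T) :
  (forall i, g x i @[x --> F] --> s i) -> g x @[x --> F] --> s.
Proof.
move=> gs; apply/cvg_sup => i.
exact: (@initial_cvg (forall i, T i) (T i) (fun f => f i) _ _ _ g s (gs i)).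
Qed.

Section groups.
Variable G : groupType.

Record subgroup := Subgroup {
  sg_set :> set G;
  sg1 : sg_set 1%g;
  sgM : forall x y, sg_set x -> sg_set y -> sg_set (x * y)%g;
  sgV : forall x, sg_set x -> sg_set (x^-1)%g
}.

Definition finitely_generated := exists s : seq G,
  forall H : subgroup, (forall x, x \in s -> sg_set H x) -> forall x, sg_set H x.

(* The left translate t C. *)
Definition ltrans (t : G) (C : set G) : set G := [set (t * x)%g | x in C].

Definition cosets (H : subgroup) : set (set G) := [set ltrans g H | g in [set: G]].

Definition coset_space (H : subgroup) : Type := discrete_topology (set_type (cosets H)).
HB.instance Definition _ H := DiscreteTopology.on (coset_space H).

Definition finite_index (H : subgroup) := finite_set (cosets H).

Definition is_normal (H : subgroup) :=
  forall g h, sg_set H h -> sg_set H (g * h * g^-1)%g.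

Definition residually_finite := forall g : G, g <> 1%g ->
  exists H : subgroup, [/\ is_normal H, finite_index H & ~ sg_set H g].

Lemma ltrans_coset t H C : cosets H C -> cosets H (ltrans t C).
Proof.
move=> [g _ <-]; exists (t * g)%g => //; rewrite /ltrans image_comp.
by apply: eq_imagel => x _ /=; rewrite mulgA.
Qed.

Definition coset_ltrans t H (c : coset_space H) : coset_space H :=
  exist _ (ltrans t (set_val c)) (mem_set (ltrans_coset t (set_valP c))).

Lemma coset_ltrans_continuous t H : continuous (@coset_ltrans t H).
Proof.
move=> c U /nbhs_singleton Uc.
have cc : nbhs c [set c] := discrete_set1 c.
by apply: (filterS _ cc) => _ ->.
Qed.

(* Normal subgroups of finite index. *)
Record nfi := Nfi {
  nfi_sub :> subgroup;
  nfi_normal : is_normal nfi_sub;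
  nfi_finite : finite_index nfi_sub
}.

HB.instance Definition _ := gen_eqMixin nfi.

(* A point of the product is a family of cosets; if c K = g K and c H = h H with
   K contained in H, then g H = h H. *)
Definition profinite_set : set (prod_topology (fun H : nfi => coset_space H)) :=
  [set c | forall K H : nfi, K `<=` H -> forall g h : G,
     set_val (c K) = ltrans g K -> set_val (c H) = ltrans h H ->
     ltrans g H = ltrans h H].

Definition profinite : Type := set_type profinite_set.
HB.instance Definition _ := Topological.on profinite.

Lemma ltrans_profinite t (c : prod_topology (fun H : nfi => coset_space H)) :
  profinite_set c -> profinite_set (fun H => coset_ltrans t (c H)).
Proof.
have lt_inj : injective (ltrans t).
  move=> C D CD; apply/seteqP; split=> x xC.
    have : ltrans t C (t * x)%g by exists x.
    by rewrite CD => -[y yD /mulgI <-].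
  have : ltrans t D (t * x)%g by exists x.
  by rewrite -CD => -[y yD /mulgI <-].
have ltM g C : ltrans t (ltrans g C) = ltrans (t * g)%g C.
  by rewrite /ltrans image_comp; apply: eq_imagel => x _ /=; rewrite mulgA.
have shift u (H : subgroup) (C : set G) :
    ltrans t C = ltrans u H -> C = ltrans (t^-1 * u)%g H.
  by move=> tC; apply: lt_inj; rewrite ltM mulgA mulgV mul1g.
move=> cP K H KH g h gK hH.
have := cP K H KH _ _ (shift _ _ _ gK) (shift _ _ _ hH).
by move=> /(congr1 (ltrans t)); rewrite !ltM !mulgA !mulgV !mul1g.
Qed.

Definition prof_ltrans (t : G) (c : profinite) : profinite :=
  exist _ (fun H => coset_ltrans t (set_val c H))
    (mem_set (@ltrans_profinite t _ (set_valP c))).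

Lemma prof_ltrans_continuous t : continuous (prof_ltrans t).
Proof.
move=> c.
pose g (x : profinite) : prod_topology (fun H : nfi => coset_space H) :=
  fun H => coset_ltrans t (set_val x H).
have gc : g x @[x --> c] --> g c.
  apply: (@prod_cvg nfi coset_space profinite (nbhs c) _ g (g c)) => H.
  apply: (@continuous_comp profinite (coset_space H) (coset_space H) (fun x => set_val x H)
    (@coset_ltrans t H)); last exact: coset_ltrans_continuous.
  apply: (@continuous_comp profinite (prod_topology (fun H : nfi => coset_space H))
    (coset_space H) set_val (@proj nfi coset_space H)); last exact: proj_continuous.
  exact: initial_continuous.
exact: (@initial_cvg _ _ set_val profinite (nbhs c) _ (prof_ltrans t) (prof_ltrans t c) gc).
Qed.

Lemma closed_profinite_set : closed profinite_set.
Proof.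
move=> c cc K H KH g h gK hH.
have ch (L : nfi) : nbhs c [set c' | c' L = c L].
  exact: (@proj_continuous nfi coset_space L c _ (discrete_set1 (c L))).
have [c' [c'P [cK cH]]] := cc _ (filterI (ch K) (ch H)).
by apply: (c'P K H KH); [rewrite cK|rewrite cH].
Qed.

Lemma coset_compact H : finite_index H -> compact [set: coset_space H].
Proof.
move=> Hfin; apply: finite_compact.
apply: (@sub_finite_set _ _ (@set_val _ (cosets H) @^-1` cosets H)).
  by move=> c _; exact: set_valP.
by apply: finite_preimage => // x y _ _; exact: val_inj.
Qed.

Lemma profinite_compact : compact [set: profinite].
Proof.
have Pc : compact profinite_set.
  apply: (subclosed_compact closed_profinite_set
    (@tychonoff nfi coset_space (fun=> setT) (fun H => coset_compact (nfi_finite H)))).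
  by [].
move=> F FF _.
have [|p [Pp clp]] := Pc ((@set_val _ profinite_set) @ F).
  have sT : setT `<=` @set_val _ profinite_set @^-1` profinite_set.
    by move=> x _; exact: (set_valP x).
  exact: (filterS sT filterT).
exists (exist _ p (mem_set Pp)); split=> // B C FB [_ [[V oV <-] /= Vp VC]].
have [_ [[b Bb <-] Vb]] : set_val @` B `&` V !=set0.
  apply: clp; last exact: open_nbhs_nbhs.
  have sB : B `<=` set_val @^-1` (set_val @` B) by move=> b Bb; exists b.
  exact: (filterS sB FB).
by exists b; split => //; exact: VC.
Qed.

End groups.

Section maps.
Variables (R : realType) (B B' : normedStarAlgType R).

Definition star_orthogonal (C : normedStarAlgType R) (a b : C) : Prop :=
  [/\ a ** b = 0, b ** a = 0, star a ** b = 0 & star b ** a = 0].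

(* X is positive in M_n(C): X = Y' Y for some Y, where the (i, k) entry of the
   adjoint matrix Y' is star (Y k i). *)
Definition mx_positive (C : normedStarAlgType R) n (X : 'M[C]_n) : Prop :=
  exists Y : 'M[C]_n, X = \matrix_(i, j) \sum_k star (Y k i) ** Y k j.

Variable phi : B -> B'.

Definition completely_positive : Prop :=
  forall n (X : 'M[B]_n), mx_positive X -> mx_positive (map_mx phi X).

Definition contractive : Prop := forall a, `|phi a| <= `|a|.

Definition order_zero : Prop :=
  forall a b, star_orthogonal a b -> star_orthogonal (phi a) (phi b).
End maps.

(* e = 1_B. F(D, A) carries no distinguished unit: that it is unital for
   sigma-unital D is a theorem. *)
Definition is_identity (R : realType) (B : normedStarAlgType R) (e : B) : Prop :=
  forall x, e ** x = x /\ x ** e = x.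

Section rokhlin.
Variables (R : realType) (G : groupType).

(* (sigma_t f)(x) = f(t^-1 x). *)
Definition sigma_coset (H : subgroup G) (t : G) :
    contfun R (coset_space H) -> contfun R (coset_space H) :=
  pullback (@coset_ltrans_continuous G t^-1%g H).

Definition sigma_prof (t : G) :
    contfun R (profinite G) -> contfun R (profinite G) :=
  pullback (@prof_ltrans_continuous G t^-1%g).

Variables (A : cstarAlgType R) (alpha : cstar_action G A).

Definition separable_set (S : set A) : Prop :=
  exists2 E : set A, countable E & E `<=` S /\ S `<=` closure E.

Record sepInvSubalg := SepInvSubalg {
  sis_alg :> starSubalg A;
  sis_closed : closed sis_alg;
  sis_separable : separable_set sis_alg;
  sis_invariant : act_invariant alpha sis_alg
}.

Definition equivariant_ccp_order_zero (B : normedStarAlgType R)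
    (sigma : G -> B -> B) (D : sepInvSubalg) (phi : B -> Fcs D) : Prop :=
  [/\ completely_positive phi, contractive phi, order_zero phi &
      forall t b, phi (sigma t b) = Fcs_act (@sis_invariant D) t (phi b)].

(* The least such d, and +oo (the infimum of the empty set) if there is none. *)
Definition dimRokH (H : subgroup G) : \bar R :=
  ereal_inf [set (d%:R)%:E | d in
    [set d : nat | forall D : sepInvSubalg,
      exists phi : 'I_d.+1 -> {linear contfun R (coset_space H) -> Fcs D},
        (forall l, equivariant_ccp_order_zero (@sigma_coset H) (phi l)) /\
        is_identity (\sum_l phi l (contfun1 R (coset_space H)))]].

Definition dimRok : \bar R :=
  ereal_sup [set dimRokH H | H in [set H : subgroup G | finite_index H]].

End rokhlin.

(* Main.v *)
(* If dim_Rok(alpha) <= d, choose a cofinal decreasing chain H_n of normal finite index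
   subgroups, which exists because G is finitely generated.  The Rokhlin maps for G/H_n send
   the minimal projections of C(G/H_n) to positive elements of F(D, A); their square roots
   (up to 1/n), cut down by an approximate unit of D and evaluated far out in the sequence
   algebra, are self-adjoint elements x_c of A, c in G/H_n, that are almost orthogonal,
   almost central for D, almost permuted by G, and whose squares almost sum up to 1.  For f
   in C(Gbar) with values f_c at representatives of the cosets c, put
   psi(f) = [sum_c f_c x_c]_n and phi(f) = [sum_c f_c x_c^2]_n.  Then
   psi(f)^* psi(g) = phi(f^* g), which makes phi completely positive at once; that phi is
   equivariant in the limit follows from the uniform continuity of f, and that it is bounded
   and contractive from the C*-identity for almost orthogonal sums.  Positivity in A is
   handled in the unitization, where x >= 0 is expressed as |1 - x| <= 1.  Conversely, one
   composes with C(G/H) -> C(Gbar), given by Gbar -> G/H_n -> G/H for H_n inside H. *)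
Require Import Defs.
From HB Require Import structures.
From mathcomp Require Import all_boot all_order all_algebra.
From mathcomp Require Import fingroup perm.
From mathcomp Require Import complex.
From mathcomp Require Import all_classical reals ereal topology normedtype sequences.
From mathcomp Require Import ring lra.
Set Implicit Arguments.
Unset Strict Implicit.
Unset Printing Implicit Defensive.
Import Order.TTheory GRing.Theory Num.Theory.
Import numFieldNormedType.Exports.
Local Open Scope classical_set_scope.
Local Open Scope ring_scope.

(** * The unitization of a C*-algebra *)

Section real_scalars.
Variable R : realType.

(** F(D, A) enters only as a normed *-algebra, without completeness or the C*-identity, so square
    roots cannot be taken in it. They are replaced by explicit polynomials without constant term.
    Such polynomials commute with homomorphisms, hence with the action, and preserve orthogonality
    exactly; their error bound, proved once in A, passes to bounded sequences, subalgebras and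
    quotients. That bound rests on the positivity of [star z ** z] in A, which has to come from norm
    estimates alone, with no spectral theory: the decisive statement is |1 - z^* z| <= 1 for every
    contraction z.

    A second obstacle is that complete positivity asks for an exact factorization X = Y^* Y over
    F(D, A), which a limit of positive matrices would not supply. This is why psi is carried along
    with phi: applied to the entries of a factor of the given matrix, it yields a factor of the
    image. *)

Definition rscal (V : lmodType R[i]) (r : R) (x : V) : V := (r%:C)%C *: x.

Lemma Re_normC (r : R) : complex.Re `|(r%:C)%C| = `|r|.
Proof.
have [r0|r0] := leP 0 r; first by rewrite ger0_norm ?lecR// ger0_norm.
by rewrite ltr0_norm ?ltcR// ltr0_norm.
Qed.

Lemma Re_norm_ge0 (a : R[i]) : 0 <= complex.Re `|a|.
Proof. exact: (rnorm_ge0 (a : R[i]^o)). Qed.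

Lemma conjC_real (r : R) : ((r%:C)%C)^* = (r%:C)%C.
Proof. by rewrite conj_Creal// complex_real. Qed.

End real_scalars.
Notation "r *r x" := (rscal r x) (at level 40) : ring_scope.

Section unitization.
Variables (R : realType) (A : cstarAlgType R).

Definition unitz : Type := (R[i]^o * A)%type.
HB.instance Definition _ := GRing.Lmodule.on unitz.

Definition umul (S T : unitz) : unitz :=
  (S.1 * T.1, S.1 *: T.2 + T.1 *: S.2 + S.2 ** T.2).
Definition uone : unitz := (1, 0).

Program Definition unitz_ring := @GRing.Zmodule_isNzRing.Build unitz uone umul _ _ _ _ _ _.
Next Obligation.
move=> [a x] [b y] [c z]; congr pair => /=; first exact: mulrA.
rewrite !scalerDr !smulDl !smulDr !smulZl !smulZr !scalerA smulA.
rewrite (mulrC c a) (mulrC c b).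
by rewrite !addrA [LHS](ACl (1*2*4*6*3*5*7)).
Qed.
Next Obligation.
by move=> [a x]; rewrite /umul/= mul1r scale1r scaler0 smul0r !addr0.
Qed.
Next Obligation.
by move=> [a x]; rewrite /umul/= mulr1 scale1r scaler0 smulr0 add0r addr0.
Qed.
Next Obligation.
move=> [a x] [b y] [c z]; congr pair => /=; first exact: mulrDl.
by rewrite scalerDl scalerDr smulDl !addrA [LHS](ACl (1*3*5*2*4*6)).
Qed.
Next Obligation.
move=> [a x] [b y] [c z]; congr pair => /=; first exact: mulrDr.
by rewrite scalerDl scalerDr smulDr !addrA [LHS](ACl (1*3*5*2*4*6)).
Qed.
Next Obligation. by apply/eqP => -[]/eqP; rewrite oner_eq0. Qed.
HB.instance Definition _ := unitz_ring.

Fact unitz_scalerAl (a : R[i]) (S T : unitz) : a *: (S * T) = a *: S * T.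
Proof.
congr pair => /=; first exact: scalerAl.
by rewrite !scalerDr !scalerA smulZl (mulrC a T.1).
Qed.
HB.instance Definition _ := GRing.Lmodule_isLalgebra.Build R[i] unitz unitz_scalerAl.
Fact unitz_scalerAr (a : R[i]) (S T : unitz) : a *: (S * T) = S * (a *: T).
Proof.
congr pair => /=; first exact: scalerAr.
by rewrite !scalerDr !scalerA smulZr (mulrC a S.1).
Qed.
HB.instance Definition _ := GRing.Lalgebra_isAlgebra.Build R[i] unitz unitz_scalerAr.

Definition uin (x : A) : unitz := (0, x).
Definition ustar (T : unitz) : unitz := (T.1^*, star T.2).
Definition uact (T : unitz) (y : A) : A := T.1 *: y + T.2 ** y.

Lemma uactM S T y : uact (S * T) y = uact S (uact T y).
Proof.
rewrite /uact/= !scalerDr !smulDl !smulDr !smulZl !smulZr !scalerA smulA.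
by rewrite !addrA; congr (_ + _); rewrite -!addrA; congr (_ + _).
Qed.
Lemma uact1 y : uact 1 y = y.
Proof. by rewrite /uact/= scale1r smul0r addr0. Qed.
Lemma uactDl S T y : uact (S + T) y = uact S y + uact T y.
Proof. by rewrite /uact/= scalerDl smulDl addrACA. Qed.
Lemma uactZl a T y : uact (a *: T) y = a *: uact T y.
Proof. by rewrite /uact/= scalerDr scalerA smulZl. Qed.
Lemma uactNl T y : uact (- T) y = - uact T y.
Proof. by rewrite -scaleN1r uactZl scaleN1r. Qed.
Lemma uact_in x y : uact (uin x) y = x ** y.
Proof. by rewrite /uact/= scale0r add0r. Qed.

Lemma uinD x y : uin (x + y) = uin x + uin y.
Proof. by congr pair; rewrite /= addr0. Qed.
Lemma uinZ a x : uin (a *: x) = a *: uin x.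
Proof. by congr pair; rewrite /= scaler0. Qed.
Lemma uinN x : uin (- x) = - uin x.
Proof. by rewrite -scaleN1r uinZ scaleN1r. Qed.
Lemma uinM x y : uin (x ** y) = uin x * uin y.
Proof. by congr pair; rewrite /= ?mul0r// !scale0r !add0r. Qed.
Lemma ustar_in x : ustar (uin x) = uin (star x).
Proof. by rewrite /ustar/= rmorph0. Qed.
Lemma uin_inj : injective uin.
Proof. by move=> x y []. Qed.

Lemma ustarD S T : ustar (S + T) = ustar S + ustar T.
Proof. by congr pair; rewrite /= ?rmorphD// starD. Qed.
Lemma ustarZ a T : ustar (a *: T) = a^* *: ustar T.
Proof. by congr pair; rewrite /= ?rmorphM// starZ. Qed.
Lemma ustarN T : ustar (- T) = - ustar T.
Proof. by rewrite -scaleN1r ustarZ rmorphN rmorph1 scaleN1r. Qed.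
Lemma ustarB S T : ustar (S - T) = ustar S - ustar T.
Proof. by rewrite ustarD ustarN. Qed.
Lemma ustarM S T : ustar (S * T) = ustar T * ustar S.
Proof.
congr pair; rewrite /= ?rmorphM/=; first exact: mulrC.
rewrite !starD !starZ starM; congr (_ + _); exact: addrC.
Qed.
Lemma ustarK : involutive ustar.
Proof. by move=> [a x]; rewrite /ustar/= conjCK starK. Qed.
Lemma ustar1 : ustar 1 = 1.
Proof. by congr pair; rewrite /= ?rmorph1 ?star0. Qed.
Lemma ustar0 : ustar 0 = 0.
Proof. by have := ustarZ 0 0; rewrite rmorph0 !scale0r. Qed.
Lemma ustarX T n : ustar (T ^+ n) = ustar T ^+ n.
Proof. by elim: n => [|n ih]; rewrite ?ustar1// exprS exprSr ustarM ih. Qed.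

(** The adjoint relation for the A-valued inner product [star x ** y]; it lets norms of [uact T y]
    be computed from [ustar T * T]. *)
Lemma uact_star T x y : star (uact T x) ** y = star x ** uact (ustar T) y.
Proof.
by rewrite /uact starD starZ starM smulDl smulDr smulZl smulZr smulA.
Qed.

Lemma rnorm_star_smul (B : cstarAlgType R) (x : B) : rnorm (star x ** x) = rnorm x ^+ 2.
Proof. by apply: complexI; rewrite -rnormE norm_star_mul rnormE rmorphXn. Qed.

Lemma rnorm_smul_star (B : cstarAlgType R) (x : B) : rnorm (x ** star x) = rnorm x ^+ 2.
Proof. by rewrite -{1}[x]starK rnorm_star_smul rnorm_star. Qed.

(* The norm of C (+) L(A): the second condition alone only gives a seminorm when A is unital. *)
Definition bd (T : unitz) (M : R) : Prop :=
  rnorm T.1 <= M /\ forall y, rnorm (uact T y) <= M * rnorm y.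

Lemma bd_ge0 T M : bd T M -> 0 <= M.
Proof. by move=> [+ _]; exact: le_trans (rnorm_ge0 _). Qed.

Lemma bdW T M N : M <= N -> bd T M -> bd T N.
Proof.
move=> MN [T1 T2]; split=> [|y]; first exact: le_trans MN.
by rewrite (le_trans (T2 y))// ler_wpM2r ?rnorm_ge0.
Qed.

Lemma bd_eq S T M N : bd S M -> S = T -> M = N -> bd T N.
Proof. by move=> ? <- <-. Qed.

Lemma bd1 : bd 1 1.
Proof.
split=> [|y]; last by rewrite uact1 mul1r.
have -> : rnorm (1 : unitz).1 = complex.Re `|1 : R[i]| by [].
by rewrite normr1.
Qed.

Lemma bdD S T M N : bd S M -> bd T N -> bd (S + T) (M + N).
Proof.
move=> [S1 S2] [T1 T2]; split=> [|y]; first by rewrite (le_trans (rnormD _ _))// lerD.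
by rewrite uactDl mulrDl (le_trans (rnormD _ _))// lerD.
Qed.

Lemma bdM S T M N : bd S M -> bd T N -> bd (S * T) (M * N).
Proof.
move=> Sb Tb; have [M0 N0] := (bd_ge0 Sb, bd_ge0 Tb).
move: Sb Tb => [S1 S2] [T1 T2]; split=> [|y].
  by rewrite (le_trans (rnormM (A := R[i]^o) _ _))// ler_pM ?rnorm_ge0.
by rewrite uactM (le_trans (S2 _))// -mulrA ler_wpM2l.
Qed.

Lemma bdZ a T M : bd T M -> bd (a *: T) (complex.Re `|a| * M).
Proof.
move=> [T1 T2]; split=> [|y]; first by rewrite rnormZ ler_wpM2l ?Re_norm_ge0.
by rewrite uactZl rnormZ -mulrA ler_wpM2l ?Re_norm_ge0.
Qed.

Lemma bdr (r : R) T M : 0 <= r -> bd T M -> bd (r *r T) (r * M).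
Proof. by move=> r0 /(bdZ ((r%:C)%C)); rewrite Re_normC ger0_norm. Qed.

Lemma bdN T M : bd T M -> bd (- T) M.
Proof.
move/(bdZ (-1)); rewrite scaleN1r normrN normr1.
by rewrite (_ : complex.Re 1 = 1)// mul1r.
Qed.

Lemma bdB S T M N : bd S M -> bd T N -> bd (S - T) (M + N).
Proof. by move=> Sb /bdN; exact: bdD. Qed.

Lemma bdX T n : bd T 1 -> bd (T ^+ n) 1.
Proof.
move=> Tb; elim: n => [|n ih]; first exact: bd1.
by rewrite exprS -[X in bd _ X]mulr1; exact: bdM.
Qed.

Lemma bd_0 : bd 0 0.
Proof.
split=> [|y]; first by rewrite rnorm0.
by rewrite /uact scale0r smul0r addr0 rnorm0 mul0r.
Qed.

Lemma bd_in x : bd (uin x) (rnorm x).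
Proof. by split=> [|y]; rewrite ?rnorm0 ?rnorm_ge0// uact_in rnormM. Qed.

Lemma bd_norms T : bd T (rnorm T.1 + rnorm T.2).
Proof.
apply: (bd_eq (bdD (bdZ T.1 bd1) (bd_in T.2))); last by rewrite mulr1.
rewrite [T in RHS]surjective_pairing; congr pair => /=.
  by rewrite addr0 /GRing.scale/= mulr1.
by rewrite scaler0 add0r.
Qed.

(** Left multiplication by x is tested on [star x]: the C*-identity makes the regular representation
    isometric. *)
Lemma rnorm_bd x M : bd (uin x) M -> rnorm x <= M.
Proof.
move=> xb; have M0 := bd_ge0 xb; move: xb => [_ /(_ (star x))].
rewrite uact_in rnorm_smul_star rnorm_star expr2.
have [->//|x0] := eqVneq (rnorm x) 0.
by rewrite ler_pM2r// lt_def x0 rnorm_ge0.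
Qed.

(** The useful half of the C*-identity, from |T y|^2 = |(T y)^* T y| = |y^* (T^* T y)|. *)
Lemma bd_C T M : 0 <= M -> bd (ustar T * T) (M * M) -> bd T M.
Proof.
move=> M0 [T1 T2]; split=> [|y].
  move: T1; have -> : rnorm (ustar T * T).1 = complex.Re `|T.1^* * T.1 : R[i]| by [].
  have -> : rnorm T.1 = complex.Re `|T.1 : R[i]| by [].
  rewrite mulrC -normCK => h; rewrite -(@ler_pXn2r _ 2) ?nnegrE ?Re_norm_ge0//.
  rewrite (expr2 M) (le_trans _ h)//.
  have aE : `|T.1 : R[i]| = ((complex.Re `|T.1 : R[i]|)%:C)%C by exact: (rnormE (T.1 : R[i]^o)).
  by rewrite normrX normr_id [in leRHS]aE -rmorphXn.
rewrite -(@ler_pXn2r _ 2) ?nnegrE ?mulr_ge0 ?rnorm_ge0//.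
rewrite -rnorm_star_smul uact_star -uactM (le_trans (rnormM _ _))// rnorm_star.
rewrite (le_trans (ler_wpM2l (rnorm_ge0 _) (T2 _)))//.
by rewrite exprMn !expr2 mulrCA.
Qed.

(** From |T^* y|^2 = |y^* T T^* y| <= |y| M |T^* y| one factor |T^* y| cancels. *)
Lemma bd_star T M : bd T M -> bd (ustar T) M.
Proof.
move=> Tb; have M0 := bd_ge0 Tb; move: Tb => [T1 T2]; split=> [|y].
  by have := norm_conjC (T.1 : R[i]) => E; rewrite /rnorm (_ : `|_| = `|T.1|).
have := rnorm_star_smul (uact (ustar T) y); rewrite uact_star ustarK => E.
have [->|y0] := eqVneq (rnorm (uact (ustar T) y)) 0; first by rewrite mulr_ge0 ?rnorm_ge0.
rewrite -(@ler_pM2r _ (rnorm (uact (ustar T) y))); last by rewrite lt_def y0 rnorm_ge0.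
rewrite -expr2 -E (le_trans (rnormM _ _))// rnorm_star mulrAC [leRHS]mulrC.
by rewrite ler_wpM2l ?rnorm_ge0 ?T2.
Qed.

Lemma bd_small T : (forall e, 0 < e -> bd T e) -> T = 0.
Proof.
move=> Te.
have small (V : normedModType R[i]) (z : V) : (forall e : R, 0 < e -> rnorm z <= e) -> z = 0.
  move=> ze; apply: rnorm0_eq0; apply/eqP; rewrite eq_le rnorm_ge0 andbT.
  by apply/ler_addgt0Pr => e e0; rewrite add0r ze.
have T1 : T.1 = 0 by apply: (small R[i]^o) => e /Te[].
rewrite [T]surjective_pairing T1; congr pair; apply: small => e /Te.
by rewrite [T]surjective_pairing T1; exact: rnorm_bd.
Qed.

Lemma bd_lim T M : (forall e, 0 < e -> bd T (M + e)) -> bd T M.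
Proof.
move=> Te; split=> [|y].
  by apply/ler_addgt0Pr => e /Te[].
apply/ler_addgt0Pr => e e0; set c := rnorm y + 1.
have c0 : 0 < c by rewrite ltr_wpDl ?rnorm_ge0.
have [_ /(_ y) h] := Te _ (divr_gt0 e0 c0); rewrite (le_trans h)//.
rewrite mulrDl lerD2l -mulrA ler_piMr ?(ltW e0)// ler_pdivrMl// mulr1.
by rewrite lerDl.
Qed.

End unitization.

(** * Limits with an explicit rate of convergence *)

Section limits_of_sequences.
Variable R : realType.

Lemma rate_limit (V : completeNormedModType R[i]) (a : nat -> V) (e : nat -> R) :
  e n @[n --> \oo] --> (0 : R) ->
  (forall k m, (k <= m)%N -> rnorm (a m - a k) <= e k) ->
  exists l, forall k, rnorm (l - a k) <= e k.
Proof.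
move=> e0 ae.
have small (d : R) : 0 < d -> exists k, e k < d.
  move=> d0; have /cvgrPdist_lt/(_ _ d0)[k _ /(_ k (leqnn k))] := e0.
  by rewrite sub0r normrN => /(le_lt_trans (ler_norm _)) ek; exists k.
have /cvg_ex[l al] : cvg (a n @[n --> \oo]).
  apply: cauchy_cvg; apply: cauchy_exP => d d0.
  have dr : d = ((complex.Re d)%:C)%C by rewrite RRe_real// gtr0_real.
  have rd0 : 0 < complex.Re d by rewrite -ltcR -dr.
  have [k ek] := small _ rd0; exists (a k); exists k => // m /= km.
  rewrite -ball_normE/= distrC rnormE dr ltcR; exact: le_lt_trans (ae _ _ km) ek.
exists l => k; apply/ler_addgt0Pr => d d0.
have /cvgrPdist_lt/(_ ((d%:C)%C)) := al; rewrite ltcR => /(_ d0)[m _ h].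
have := h (maxn m k) (leq_maxl _ _); rewrite rnormE ltcR => /ltW lm.
rewrite -(subrK (a (maxn m k)) l) -addrA (le_trans (rnormD _ _))// [leRHS]addrC lerD//.
by rewrite ae// leq_maxr.
Qed.

Lemma rate_limit_R (a e : nat -> R) : e n @[n --> \oo] --> (0 : R) ->
  (forall k m, (k <= m)%N -> `|a m - a k| <= e k) ->
  exists l, forall k, `|l - a k| <= e k.
Proof.
move=> e0 ae.
have small (d : R) : 0 < d -> exists k, e k < d.
  move=> d0; have /cvgrPdist_lt/(_ _ d0)[k _ /(_ k (leqnn k))] := e0.
  by rewrite sub0r normrN => /(le_lt_trans (ler_norm _)) ek; exists k.
have /cvg_ex[l al] : cvg (a n @[n --> \oo]).
  apply: cauchy_cvg; apply: cauchy_exP => d d0.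
  have [k ek] := small _ d0; exists (a k); exists k => // m /= km.
  by rewrite -ball_normE/= distrC; exact: le_lt_trans (ae _ _ km) ek.
exists l => k; apply/ler_addgt0Pr => d d0.
have /cvgrPdist_lt/(_ _ d0)[m _ h] := al.
have /ltW lm := h (maxn m k) (leq_maxl _ _).
rewrite -(subrK (a (maxn m k)) l) -addrA (le_trans (ler_normD _ _))// [leRHS]addrC lerD//.
by rewrite ae// leq_maxr.
Qed.

(** Real and imaginary parts converge separately, which doubles the rate; the loss is harmless, as
    [ucomplete] removes constant factors. *)
Lemma rate_limit_C (a : nat -> R[i]) (e : nat -> R) :
  e n @[n --> \oo] --> (0 : R) ->
  (forall k m, (k <= m)%N -> complex.Re `|a m - a k| <= e k) ->
  exists l, forall k, complex.Re `|l - a k| <= e k + e k.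
Proof.
have ReN (z : R[i]) : `|complex.Re z| <= complex.Re `|z|.
  by case: z => x y /=; rewrite -sqrtr_sqr ler_wsqrtr// lerDl sqr_ge0.
have ImN (z : R[i]) : `|complex.Im z| <= complex.Re `|z|.
  by case: z => x y /=; rewrite -sqrtr_sqr ler_wsqrtr// lerDr sqr_ge0.
have NReIm (z : R[i]) : complex.Re `|z| <= `|complex.Re z| + `|complex.Im z|.
  case: z => x y /=; rewrite -[leRHS]ger0_norm ?addr_ge0// -sqrtr_sqr ler_wsqrtr//.
  rewrite sqrrD !real_normK ?num_real// addrAC lerDl.
  by rewrite mulrn_wge0// mulr_ge0.
move=> e0 ae.
have [|x xl] := @rate_limit_R (fun n => complex.Re (a n)) e e0.
  by move=> k m km; have := ae k m km; apply: le_trans; rewrite -raddfB ReN.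
have [|y yl] := @rate_limit_R (fun n => complex.Im (a n)) e e0.
  by move=> k m km; have := ae k m km; apply: le_trans; rewrite -raddfB ImN.
exists (Complex x y) => k; rewrite (le_trans (NReIm _))// lerD//.
  by rewrite raddfB xl.
by rewrite raddfB yl.
Qed.

End limits_of_sequences.

Section unitization_complete.
Variables (R : realType) (A : cstarAlgType R).
Implicit Types (T u : unitz A).

(** Scalar part and A-part are completed separately, the latter being [T - T.1 *: 1]; each
    contributes twice the rate. *)
Lemma ucomplete (p : nat -> unitz A) (e : nat -> R) :
  e n @[n --> \oo] --> (0 : R) ->
  (forall k m, (k <= m)%N -> bd (p m - p k) (e k)) ->
  exists P, forall k, bd (P - p k) (e k).
Proof.
move=> e0 pe.
have [|l ll] := @rate_limit_C R (fun n => (p n).1) e e0.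
  by move=> k m /pe[].
have e20 : e n + e n @[n --> \oo] --> (0 : R) by rewrite -[0]addr0; exact: cvgD.
have uinE T : uin T.2 = T - T.1 *: 1.
  rewrite [T in RHS]surjective_pairing; congr pair => /=.
    by rewrite /GRing.scale/= mulr1 subrr.
  by rewrite scaler0 subr0.
have [|a al] := @rate_limit R A (fun n => (p n).2) (fun n => e n + e n) e20.
  move=> k m /pe pb; apply: rnorm_bd; rewrite (uinE (p m - p k)); apply: bdB => //.
  case: (pb) => pb1 _; apply: (bdW pb1).
  by rewrite -[rnorm (p m - p k).1]mulr1; apply: bdZ; exact: bd1.
pose P : unitz A := (l, a).
have P4 k : bd (P - p k) (4 * e k).
  have := bdD (bdZ (l - (p k).1) (@bd1 _ A)) (bdW (al k) (bd_in (a - (p k).2))).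
  rewrite mulr1 (_ : _ + uin _ = P - p k); last first.
    by congr pair; rewrite /= ?addr0 ?scaler0 ?add0r// /GRing.scale/= mulr1.
  apply: bdW; rewrite (le_trans (lerD (ll k) (lexx _)))//.
  by rewrite le_eqVlt; apply/orP; left; apply/eqP; ring.
exists P => k; apply: bd_lim => d d0.
have d40 : 0 < d / 4 by rewrite divr_gt0.
have /cvgrPdist_lt/(_ _ d40)[m _ h] := e0.
have := h (maxn m k) (leq_maxl _ _); rewrite sub0r normrN.
move=> /(le_lt_trans (ler_norm _))/ltW em.
(* The factor 4 is spent at a late index only, where it costs at most d; from there back to k the
   hypothesis gives exactly [e k]. *)
have := bdD (P4 (maxn m k)) (pe k (maxn m k) (leq_maxr _ _)).
rewrite addrA subrK; apply: bdW; rewrite addrC lerD2l.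
by rewrite mulrC -ler_pdivlMr.
Qed.

End unitization_complete.

(** * Square roots and positivity *)

Section sqrt_iteration.
Variable R : realType.

(** The iteration [useq] below evaluated at the scalar 1. Its polynomials have nonnegative
    coefficients, so [tau] majorizes them at every contraction. *)
Fixpoint tau (k : nat) : R := if k is k'.+1 then 2^-1 * (1 + tau k' ^+ 2) else 0.

Lemma tau_bounds k : 0 <= tau k <= 1.
Proof.
elim: k => [|k /andP[h0 h1]] /=; first by rewrite lexx ler01.
have : tau k ^+ 2 <= 1 by rewrite expr_le1.
have := sqr_ge0 (tau k); lra.
Qed.

Lemma tauS_sub k : tau k.+1 - tau k = 2^-1 * (1 - tau k) ^+ 2.
Proof. by rewrite /=; field. Qed.

(** The defect x = 1 - tau obeys x' = x - x^2 / 2, a discrete form of dx/dt = - x^2 / 2, whose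
    solution 2 / t suggests the rate. *)
Lemma tau_rate k : 1 - tau k <= 2 / k.+1%:R.
Proof.
elim: k => [|k ih]; first by rewrite /= divr1; lra.
have /andP[h0 h1] := tau_bounds k.
have -> : 1 - tau k.+1 = (1 - tau k) - (1 - tau k) ^+ 2 / 2 by rewrite /=; field.
set x := 1 - tau k in ih *; have [x0 x1] : 0 <= x /\ x <= 1 by rewrite /x; split; lra.
have k1 : 0 < k.+1%:R :> R by rewrite ltr0n.
have k2 : 0 < k.+2%:R :> R by rewrite ltr0n.
rewrite ler_pdivlMr// -[k.+2]addn1 natrD; move: ih; rewrite ler_pdivlMr//.
set n : R := k.+1%:R in k1 k2 *; move=> xn.
have n1 : 1 <= n by rewrite /n ler1n.
nra.
Qed.

Lemma tau_cvg : (1 - tau k) @[k --> \oo] --> (0 : R).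
Proof.
apply: (@squeeze_cvgr _ _ _ _ (fun=> 0) (fun k => 2 * harmonic k)).
- by apply: nearW => k; rewrite tau_rate andbT subr_ge0; case/andP: (tau_bounds k).
- exact: cvg_cst.
- by rewrite -(mulr0 2); apply: cvgM; [exact: cvg_cst|exact: cvg_harmonic].
Qed.

Section unital.
Variable A : cstarAlgType R.
Implicit Types (T u V : unitz A).

Lemma rscalDr (V : lmodType R[i]) (r : R) (x y : V) : r *r (x + y) = r *r x + r *r y.
Proof. exact: scalerDr. Qed.
Lemma rscalA (V : lmodType R[i]) (r s : R) (x : V) : r *r (s *r x) = (r * s) *r x.
Proof. by rewrite /rscal scalerA -rmorphM. Qed.
Lemma rscal1 (V : lmodType R[i]) (x : V) : 1 *r x = x.
Proof. exact: scale1r. Qed.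
Lemma rscalDl (V : lmodType R[i]) (r s : R) (x : V) : (r + s) *r x = r *r x + s *r x.
Proof. by rewrite /rscal rmorphD scalerDl. Qed.
Lemma rscalN (V : lmodType R[i]) (r : R) (x : V) : r *r (- x) = - (r *r x).
Proof. exact: scalerN. Qed.
Lemma rscalBr (V : lmodType R[i]) (r : R) (x y : V) : r *r (x - y) = r *r x - r *r y.
Proof. exact: scalerBr. Qed.
Lemma half_double (V : lmodType R[i]) (x : V) : 2^-1 *r (x + x) = x.
Proof. by rewrite rscalDr -rscalDl -[RHS]rscal1; congr (_ *r _); field. Qed.

Lemma rscalMl (r : R) S T : (r *r S) * T = r *r (S * T) :> unitz A.
Proof. by rewrite /rscal scalerAl. Qed.
Lemma rscalMr (r : R) S T : S * (r *r T) = r *r (S * T) :> unitz A.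
Proof. by rewrite /rscal scalerAr. Qed.
Lemma ustar_r (r : R) T : ustar (r *r T) = r *r ustar T.
Proof. by rewrite /rscal ustarZ conjC_real. Qed.

(* With [u = 1 - T] the limit of this increasing iteration is [1 - sqrt T]. *)
Fixpoint useq u (k : nat) : unitz A :=
  if k is k'.+1 then 2^-1 *r (u + useq u k' * useq u k') else 0.

Section iterates.
Variable u : unitz A.
Hypothesis ub : bd u 1.

Lemma useq_comm V k : V * u = u * V -> V * useq u k = useq u k * V.
Proof.
move=> Vu; elim: k => [|k ih] /=; first by rewrite mulr0 mul0r.
rewrite rscalMr rscalMl mulrDr mulrDl Vu; congr (_ *r (_ + _)).
by rewrite mulrA ih -mulrA ih mulrA.
Qed.

Lemma useq_bd k : bd (useq u k) (tau k).
Proof.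
elim: k => [|k ih] /=.
  exact: bd_0.
by apply: bdr; rewrite ?invr_ge0//; apply: bdD => //; rewrite expr2; exact: bdM.
Qed.

(** Since all iterates commute, p_(k+2) - p_(k+1) = (p_(k+1) - p_k)(p_(k+1) + p_k) / 2, and [tau]
    obeys the same recursion. *)
Lemma useqS_bd k : bd (useq u k.+1 - useq u k) (tau k.+1 - tau k).
Proof.
elim: k => [|k ih].
  by have := useq_bd 1; rewrite /= !subr0.
have -> : useq u k.+2 - useq u k.+1 =
    2^-1 *r ((useq u k.+1 - useq u k) * (useq u k.+1 + useq u k)).
  rewrite [in LHS]/= -/(useq u k.+1) -rscalBr; congr (_ *r _).
  rewrite mulrBl !mulrDr opprD addrACA subrr add0r.
  have -> : useq u k.+1 * useq u k = useq u k * useq u k.+1.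
    by apply: useq_comm; apply/esym; exact: useq_comm.
  by rewrite [in RHS]opprD addrA addrK.
have -> : tau k.+2 - tau k.+1 = 2^-1 * ((tau k.+1 - tau k) * (tau k.+1 + tau k)).
  by rewrite /=; field.
by apply: bdr; rewrite ?invr_ge0//; apply: bdM => //; apply: bdD; exact: useq_bd.
Qed.

Lemma useq_diff_bd k m : (k <= m)%N -> bd (useq u m - useq u k) (tau m - tau k).
Proof.
move=> /subnK <-; elim: (m - k)%N => [|n ih].
  by rewrite !subrr; exact: bd_0.
have := bdD (useqS_bd (n + k)) ih.
by rewrite !addrA !subrK.
Qed.

(** The residual of the approximate root is exactly twice the next increment. *)
Lemma useq_sqr_bd k :
  bd ((1 - useq u k) * (1 - useq u k) - (1 - u)) ((1 - tau k) ^+ 2).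
Proof.
have -> : (1 - useq u k) * (1 - useq u k) - (1 - u) =
    2 *r (useq u k.+1 - useq u k).
  rewrite [useq u k.+1]/= rscalBr rscalA mulfV// rscal1.
  rewrite mulrBl mul1r mulrBr mulr1 opprB opprB.
  have -> : 2 *r useq u k = useq u k + useq u k.
    by rewrite -{2 3}[useq u k]rscal1 -rscalDl.
  move: (useq u k) => p; rewrite opprD !addrA.
  by rewrite [LHS](ACl ((1*6)*(5*3*2*4)))/= subrr add0r.
have -> : (1 - tau k) ^+ 2 = 2 * (tau k.+1 - tau k) by rewrite tauS_sub; field.
by apply: bdr => //; exact: useqS_bd.
Qed.

End iterates.

Lemma useq_star u k : ustar u = u -> ustar (useq u k) = useq u k.
Proof.
move=> su; elim: k => [|k ih] /=.
  exact: ustar0.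
by rewrite ustar_r ustarD su ustarM ih.
Qed.

(** The condition [bd (1 - T) 1] plays the role of positivity. Equality being allowed, the iteration
    need not be a strict contraction, and convergence is inherited from [tau]. The commutation
    clause holds because the root is a limit of polynomials in T. *)
Lemma usqrt T : ustar T = T -> bd (1 - T) 1 -> exists S, [/\ ustar S = S, S * S = T,
  bd (1 - S) 1 & forall V, V * T = T * V -> V * S = S * V].
Proof.
move=> sT; set u := 1 - T => ub.
have [|P Pb] := @ucomplete R A (useq u) (fun k => 1 - tau k) tau_cvg.
  by move=> k m /(useq_diff_bd ub); apply: bdW; rewrite lerB ?lexx//; case/andP: (tau_bounds m).
have eqP_small (X Y : unitz A) (C : R) : 0 <= C ->
    (forall k, bd (X - Y) (C * (1 - tau k))) -> X = Y.
  move=> C0 h; apply/eqP; rewrite -subr_eq0; apply/eqP; apply: bd_small => e e0.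
  have C1 : 0 < C + 1 by rewrite ltr_wpDl.
  have /cvgrPdist_lt/(_ _ (divr_gt0 e0 C1))[k _ /(_ k (leqnn k))] := tau_cvg.
  rewrite sub0r normrN => /(le_lt_trans (ler_norm _))/ltW he.
  apply: bdW (h k); rewrite ler_pdivlMr// in he.
  apply: le_trans he; rewrite mulrC ler_wpM2l ?lerDl//.
  by rewrite subr_ge0; case/andP: (tau_bounds k).
have Pk k : P = useq u k + (P - useq u k) by rewrite addrC subrK.
have tk1 k : 0 <= 1 - tau k <= 1 by have := tau_bounds k; lra.
have P1 : bd P 1.
  by have := Pb 0%N; rewrite /= !subr0.
exists (1 - P); split.
- rewrite ustarB ustar1; congr (_ - _); apply: (eqP_small _ _ 2) => // k.
  rewrite [in X in bd X _](Pk k) ustarD opprD addrACA useq_star ?subrr ?add0r; last first.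
    by rewrite ustarB ustar1 sT.
  by apply: (bd_eq (bdB (bd_star (Pb k)) (Pb k))) => //; ring.
- have Tu : T = 1 - u by rewrite /u opprB addrC subrK.
  rewrite Tu; apply: (eqP_small _ _ 5) => // k.
  have h : bd ((1 - P) * (1 - P) - (1 - useq u k) * (1 - useq u k)) (4 * (1 - tau k)).
    set Q := useq u k.
    have -> : (1 - P) * (1 - P) - (1 - Q) * (1 - Q) =
        - ((1 - P) * (P - Q) + (P - Q) * (1 - Q)).
      have E : P - Q = (1 - Q) - (1 - P) by rewrite opprB [RHS]addrC addrA subrK.
      rewrite E; move: (1 - P) (1 - Q) => a b.
      suff -> : a * (b - a) + (b - a) * b = b * b - a * a by rewrite opprB.
      by rewrite mulrBr mulrBl addrC addrA subrK.
    have b2 (X : unitz A) : bd X 1 -> bd (1 - X) 2 by exact: bdB (@bd1 R A).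
    have Qb : bd Q 1 by apply: bdW (useq_bd ub k); case/andP: (tau_bounds k).
    by apply: (bd_eq (bdN (bdD (bdM (b2 _ P1) (Pb k)) (bdM (Pb k) (b2 _ Qb))))) => //; ring.
  have := bdD h (useq_sqr_bd ub k); rewrite addrA subrK; apply: bdW.
  have := tk1 k; nra.
- by rewrite opprB addrC subrK.
- move=> V VT; rewrite mulrBr mulrBl mulr1 mul1r; congr (_ - _).
  have Vu : V * u = u * V by rewrite mulrBr mulrBl mulr1 mul1r VT.
  pose M := rnorm V.1 + rnorm V.2.
  have Vb : bd V M := bd_norms V.
  apply: (eqP_small _ _ (M + M)) => [|k]; first by rewrite addr_ge0// (bd_ge0 Vb).
  have -> : V * P - P * V = V * (P - useq u k) - (P - useq u k) * V.
    by rewrite mulrBr mulrBl (useq_comm _ Vu) opprB addrA subrK.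
  by apply: (bd_eq (bdB (bdM Vb (Pb k)) (bdM (Pb k) Vb))) => //; ring.
Qed.
End unital.
End sqrt_iteration.

Lemma sqr_polar (T : pzRingType) (x y : T) :
  (x + y) * (x + y) - (x - y) * (x - y) = y * x + x * y + (y * x + x * y).
Proof.
rewrite !(mulrDl, mulrDr, mulrN, mulNr, opprD, opprK, addrA).
by rewrite [LHS](ACl ((1*5)*(4*8)*(3*2*7*6)))/= !subrr !add0r.
Qed.

Section positivity.
Variables (R : realType) (A : cstarAlgType R).
Implicit Types (S T V Q w z g : unitz A).
Local Notation ii := ('i : R[i]).

Let ii2 : ii * ii = -1. Proof. by rewrite -expr2 sqrCi. Qed.

(** For [v = ustar w] these are the real and imaginary parts of w. *)
Lemma re_im_sqr w v (a := 2^-1 *r (w + v)) (b := 2^-1 *r (- ii *: (w - v))) :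
  a * a + a * a + (b * b + b * b) = v * w + w * v.
Proof.
have dbl (X : unitz A) : 2^-1 *r (2^-1 *r X) + 2^-1 *r (2^-1 *r X) = 2^-1 *r X.
  by rewrite -rscalDr -rscalDr half_double.
rewrite /a /b !rscalMl !rscalMr !dbl -!scalerAl -!scalerAr scalerA mulrNN.
rewrite ii2 scaleN1r -rscalDr -[RHS]half_double; congr (_ *r _).
exact: sqr_polar.
Qed.

Lemma ustar_mul_eq0 T : ustar T * T = 0 -> T = 0.
Proof.
move=> TT; apply: bd_small => e e0; apply: bd_C; first exact: ltW.
rewrite TT; apply: (bdW _ (@bd_0 _ A)); by rewrite mulr_ge0// ltW.
Qed.

(** Squares of self-adjoint contractions are positive. With Q a root of 1 - T^2, built as the
    product of roots of 1 - T and 1 + T, the elements T + iQ and T - iQ are isometries; Q is half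
    their difference up to the factor -i, so it is a contraction, and 1 - T^2 = Q^2. *)
Lemma bd_sub_sqr T : ustar T = T -> bd T 1 -> bd (1 - T * T) 1.
Proof.
move=> sT Tb.
have s1 : ustar (1 - T) = 1 - T by rewrite ustarB ustar1 sT.
have s2 : ustar (1 + T) = 1 + T by rewrite ustarD ustar1 sT.
have [|S [sS SS _ Sc]] := usqrt s1.
  by rewrite opprB addrC subrK.
have [|V [sV VV _ Vc]] := usqrt s2.
  by rewrite opprD addrA subrr sub0r; exact: bdN.
have T1 : T * (1 - T) = (1 - T) * T by rewrite mulrBr mulrBl mulr1 mul1r.
have T2 : T * (1 + T) = (1 + T) * T by rewrite mulrDr mulrDl mulr1 mul1r.
have TS := Sc _ T1; have TV := Vc _ T2.
have SV : S * V = V * S.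
  by apply: Vc; rewrite mulrDr mulrDl mulr1 mul1r TS.
set Q := S * V.
have sQ : ustar Q = Q by rewrite ustarM sS sV -SV.
have TQ : T * Q = Q * T by rewrite /Q mulrA TS -mulrA TV mulrA.
have QQ : Q * Q = 1 - T * T.
  rewrite /Q {1}SV mulrA -(mulrA V) SS -mulrA.
  rewrite (_ : (1 - T) * V = V * (1 - T)); last by rewrite mulrBl mulrBr mul1r mulr1 TV.
  by rewrite mulrA VV mulrBr mulr1 mulrDl mul1r opprD addrA addrK.
have uni (s : R[i]) : s^* = - s -> s * s = -1 -> bd (T + s *: Q) 1.
  move=> sJ ss; apply: bd_C => //.
  rewrite ustarD ustarZ sT sQ sJ mulr1 mulrDl !mulrDr -!scalerAl -!scalerAr.
  rewrite scalerA mulNr ss opprK scale1r TQ addrA -(addrA (T * T)) -scalerDl subrr.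
  by rewrite scale0r addr0 QQ addrC subrK; exact: bd1.
have h1 := uni ii (conjCi _) ii2.
have h2 : bd (T + (- ii) *: Q) 1 by apply: uni; rewrite ?rmorphN/= ?conjCi// mulrNN.
have Qb : bd Q 1.
  have : bd (2^-1 *r (- ii *: ((T + ii *: Q) - (T + (- ii) *: Q)))) (2^-1 * (1 * (1 + 1))).
    apply: bdr; rewrite ?invr_ge0//; have := bdZ (- ii) (bdB h1 h2).
    by rewrite normrN normCi.
  move=> h; apply: (bd_eq h); last by field.
  rewrite [(- ii) *: Q]scaleNr opprD opprK addrACA subrr add0r -scalerDr scalerA mulNr ii2 opprK scale1r.
  exact: half_double.
by rewrite -QQ -[X in bd _ X]mulr1; exact: bdM.
Qed.

Lemma bd_root Q c k : 0 <= c -> ustar Q = Q ->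
  bd (Q ^+ (2 ^ k)) (c ^+ (2 ^ k)) -> bd Q c.
Proof.
move=> c0 sQ; elim: k => [|k ih]; first by rewrite expn0 !expr1.
rewrite expnSr !exprM !expr2 => h; apply: ih; apply: bd_C; first exact: exprn_ge0.
by rewrite ustarX sQ.
Qed.

(** With m = 2^n chosen so that m d^2 >= 2 C, Bernoulli gives (1 + d)^m >= 1 + m d, and squaring
    produces the term m^2 d^2 >= 2 m C. *)
Lemma geometric_beats_linear (d C : R) : 0 < d -> 0 <= C ->
  exists k, 1 + (2 ^ k)%:R * C <= (1 + d) ^+ (2 ^ k).
Proof.
move=> d0 C0; set n := Num.truncn (2 * C / d ^+ 2).
exists n.+1; rewrite expnS mulnC exprM.
have d20 : 0 < d ^+ 2 by rewrite exprn_gt0.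
have bern m : 1 + m%:R * d <= (1 + d) ^+ m.
  elim: m => [|m ih]; first by rewrite mul0r addr0 expr0.
  rewrite exprS -natr1; have m0 : 0 <= m%:R :> R by [].
  rewrite (le_trans _ (ler_wpM2l _ ih)) ?addr_ge0 ?(ltW d0)//.
  have := mulr_ge0 m0 (sqr_ge0 d); rewrite expr2; lra.
have m_ge : 2 * C <= (2 ^ n)%:R * d ^+ 2.
  rewrite -ler_pdivrMr// (le_trans (ltW (truncnS_gt _)))// ler_nat.
  exact: ltn_expl.
have := bern (2 ^ n)%N; set m : R := (2 ^ n)%:R in m_ge *; move=> h.
have m0 : 0 <= m by [].
rewrite natrM -/m; set x := (1 + d) ^+ _ in h *.
have : 0 <= 1 + m * d by rewrite addr_ge0// mulr_ge0// ltW.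
nra.
Qed.

(* The powers of [1 + w * ustar w] grow at most linearly, hence by the C*-identity not at all. *)
Lemma bd_add_swap w : bd (1 + ustar w * w) 1 -> bd (1 + w * ustar w) 1.
Proof.
move=> h; set v := ustar w; pose M := rnorm w.1 + rnorm w.2.
have wb : bd w M := bd_norms w.
have vb : bd v M := bd_star wb.
have M0 := bd_ge0 wb.
set Q := 1 + w * v; set P := 1 + v * w.
have sQ : ustar Q = Q by rewrite ustarD ustar1 ustarM /v ustarK.
have Qw : Q * w = w * P by rewrite mulrDl mulrDr mul1r mulr1 mulrA.
have Qnw n : Q ^+ n * w = w * P ^+ n.
  elim: n => [|n ih]; first by rewrite !expr0 mul1r mulr1.
  by rewrite exprS -mulrA ih mulrA Qw -mulrA -exprS.
(* Each further factor Q adds [Q ^+ n * w * v = w * P ^+ n * v], of norm at most M * M because P is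
   a contraction. *)
have Qn n : bd (Q ^+ n) (1 + n%:R * (M * M)).
  elim: n => [|n ih]; first by rewrite expr0 mul0r addr0; exact: bd1.
  rewrite exprSr {2}/Q mulrDr mulr1 mulrA Qnw.
  apply: (bd_eq (bdD ih (bdM (bdM wb (bdX n h)) vb))) => //.
  by rewrite -natr1; ring.
apply: bd_lim => d d0.
have [k hk] := geometric_beats_linear d0 (mulr_ge0 M0 M0).
by apply: (@bd_root _ _ k) => //; [rewrite addr_ge0// ltW|exact: bdW hk (Qn _)].
Qed.

(** S^2 + T^2 factors as (S + iT)^* (S + iT) when S and T commute, so S + iT and its adjoint
    vanish. *)
Lemma sqr_sum_eq0 S T : ustar S = S -> ustar T = T -> S * T = T * S ->
  S * S + T * T = 0 -> T = 0.
Proof.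
move=> sS sT ST h; have : S + ii *: T = 0.
  apply: ustar_mul_eq0; rewrite ustarD ustarZ sS sT conjCi mulrDl !mulrDr.
  rewrite -!scalerAl -!scalerAr scalerA mulNr ii2 opprK scale1r ST addrA.
  by rewrite -(addrA (S * S)) scaleNr subrr addr0.
move=> e1; have : S - ii *: T = 0.
  have := congr1 (@ustar R A) e1; rewrite ustarD ustarZ sS sT conjCi scaleNr => ->.
  exact: ustar0.
move=> e2; have : - ii *: ((S + ii *: T) - (S - ii *: T)) = 0.
  by rewrite e1 e2 subrr scaler0.
rewrite opprD opprK addrACA subrr add0r -scalerDr scalerA mulNr ii2 opprK scale1r.
move=> T2; rewrite -[T](half_double T) T2; exact: scaler0.
Qed.

(** The positive cone is proper: the hypothesis provides a root k of - g^2, so that k^2 + g^2 = 0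
    with k and g commuting. *)
Lemma pos_neg_eq0 g : ustar g = g -> bd (1 + g * g) 1 -> g = 0.
Proof.
move=> sg h.
have [||k [sk kk _ kc]] := @usqrt R A (- (g * g)).
- by rewrite ustarN ustarM sg.
- by rewrite opprK.
apply: (@sqr_sum_eq0 k) => //; last by rewrite kk addNr.
by apply/esym/kc; rewrite mulrN mulNr mulrA.
Qed.

(** Sums of positive elements are positive: dividing by the number of terms stays within the
    normalization |1 - x| <= 1, where convexity of the unit ball applies. *)
Lemma bd_avg n (F : 'I_n.+1 -> unitz A) : (forall i, bd (1 - F i) 1) ->
  bd (1 - (n.+1%:R^-1) *r \sum_i F i) 1.
Proof.
move=> Fb; have -> : 1 - n.+1%:R^-1 *r \sum_i F i = n.+1%:R^-1 *r \sum_i (1 - F i).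
  rewrite sumrB rscalBr; congr (_ - _); rewrite sumr_const card_ord.
  have -> : (1 : unitz A) *+ n.+1 = n.+1%:R *r 1 by rewrite /rscal rmorph_nat scaler_nat.
  by rewrite rscalA mulVf ?rscal1// pnatr_eq0.
have sb m (f : 'I_m -> unitz A) : (forall i, bd (f i) 1) -> bd (\sum_i f i) m%:R.
  elim: m f => [|m ih] f fb.
    by rewrite big_ord0; exact: bd_0.
  by rewrite big_ord_recl -nat1r; apply: bdD => //; exact: ih.
have i0 : 0 <= n.+1%:R^-1 :> R by rewrite invr_ge0.
by apply: (bd_eq (bdr i0 (sb _ _ Fb))); rewrite ?mulVf// pnatr_eq0.
Qed.

(* Kaplansky: for [x = ustar z * z] and [n = |x| - x], the product [w = z * n] has
   [ustar w * w] minus a square, so [w * ustar w] is negative too; but their sum is twice the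
   sum of the squares of the real and imaginary parts of [w], whence [w = 0]. *)
Theorem bd_sub_star_mul z : bd z 1 -> bd (1 - ustar z * z) 1.
Proof.
move=> zb; set x := ustar z * z.
have sx : ustar x = x by rewrite ustarM ustarK.
have xb : bd x 1 by rewrite -[X in bd _ X]mulr1; apply: bdM => //; exact: bd_star.
have [||m [sm mm m1 mc]] := @usqrt R A (x * x).
- by rewrite ustarM sx.
- exact: bd_sub_sqr.
have [r [sr rr r1 rc]] := usqrt sm m1.
have mx : x * m = m * x by apply: mc; rewrite mulrA.
have rx : x * r = r * x by exact: rc.
have rm : m * r = r * m by exact: rc.
pose n := m - x.
have sn : ustar n = n by rewrite ustarB sm sx.
have rn : n * r = r * n by rewrite mulrBl mulrBr rm rx.
have xn : x * n = n * x by rewrite mulrBl mulrBr mx.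
have nx : n * x = - (m * n).
  by rewrite /n mulrBl mulrBr opprB mm.
(* As n is bounded by 2 only, the factor 1/4 keeps g, w and the real and imaginary parts of w in the
   unit ball, where [bd_sub_sqr] applies. *)
pose w := 4^-1 *r (z * n).
pose g := 4^-1 *r (r * n).
have sg : ustar g = g by rewrite ustar_r ustarM sr sn rn.
have ww : ustar w * w = - (g * g).
  rewrite /w /g ustar_r ustarM sn !rscalMl !rscalMr -!rscalN; do 2! congr (_ *r _).
  rewrite mulrA -(mulrA n) -/x nx mulNr; congr (- _).
  by rewrite -rr [RHS]mulrA -(mulrA r n r) rn !mulrA.
have i4 : 0 <= 4^-1 :> R by rewrite invr_ge0.
have i2 : 0 <= 2^-1 :> R by rewrite invr_ge0.
have mb : bd m 1.
  apply: bd_C => //; rewrite sm mm; exact: bdM.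
have rb : bd r 1.
  by apply: bd_C => //; rewrite sr rr mulr1.
have nb : bd n 2 by exact: bdB.
have gb : bd g 1.
  by apply: bdW (bdr i4 (bdM rb nb)); lra.
have wb : bd w 2^-1.
  by apply: bdW (bdr i4 (bdM zb nb)); lra.
have q1 : bd (1 + w * ustar w) 1.
  by apply: bd_add_swap; rewrite ww; exact: bd_sub_sqr.
pose a := 2^-1 *r (w + ustar w).
pose b := 2^-1 *r (- ii *: (w - ustar w)).
have sa : ustar a = a by rewrite ustar_r ustarD ustarK addrC.
have sb : ustar b = b.
  rewrite ustar_r ustarZ ustarB ustarK rmorphN/= conjCi opprK; congr (_ *r _).
  by rewrite scaleNr -scalerN opprB.
have vb := bd_star wb.
have ab : bd a 1.
  by apply: bdW (bdr i2 (bdD wb vb)); lra.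
have bb : bd b 1.
  have := bdr i2 (bdZ (- ii) (bdB wb vb)).
  by rewrite normrN normCi (_ : complex.Re 1 = 1)//; apply: bdW; lra.
have sum0 : g * g + (- (w * ustar w) + (a * a + a * a + (b * b + b * b))) = 0.
  have -> : a * a + a * a + (b * b + b * b) = ustar w * w + w * ustar w.
    exact: re_im_sqr.
  by rewrite ww; move: (g * g) (w * _) => P Q; rewrite (addrC (- P)) addKr subrr.
have g0 : g = 0.
  pose s := [:: - (w * ustar w); a * a; a * a; b * b; b * b].
  (* The five positive terms are padded with zeros to nine, a perfect square, so that their mean is
     minus the square of g / 3. *)
  pose F (i : 'I_9) := nth 0 s i.
  have Fb i : bd (1 - F i) 1.
    rewrite /F; case: i => -[|[|[|[|[|i]]]]] ? /=; rewrite ?opprK//; try exact: bd_sub_sqr.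
    by rewrite nth_nil subr0; exact: bd1.
  have FE : \sum_i F i = - (g * g).
    rewrite 9!big_ord_recl big_ord0 /F/= !addr0.
    by move/eqP: sum0; rewrite addrC addr_eq0 => /eqP <-; rewrite !addrA.
  have h := bd_avg Fb; rewrite FE in h.
  have : 3^-1 *r g = 0.
    apply: pos_neg_eq0; first by rewrite ustar_r sg.
    rewrite rscalMl rscalMr rscalA; apply: (bd_eq h) => //; rewrite rscalN opprK.
    by congr (_ + _ *r _); field.
  by move=> /(congr1 (fun y => 3 *r y)); rewrite rscalA mulfV// rscal1 /rscal scaler0.
have rn0 : r * n = 0.
  by have := congr1 (fun y => 4 *r y) g0; rewrite rscalA mulfV// rscal1 /rscal scaler0.
have mn0 : m * n = 0 by rewrite -rr -mulrA rn0 mulr0.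
have n0 : n = 0.
  apply: ustar_mul_eq0; rewrite sn {1}/n mulrBl mn0 xn nx mn0 oppr0 subrr//.
(* Now x equals m = |x|, and the bound on [1 - m] came with the square root. *)
by move: n0 => /eqP; rewrite subr_eq0 => /eqP <-.
Qed.

End positivity.

(** * Polynomial square roots that pass to F(D, A) *)

Section sqrt_polynomials.
Variable R : realType.

(* The polynomials [1 - p_k(1 - x)] of [useq], stripped of their constant term [1 - tau k]
   so that they make sense without a unit. *)
Fixpoint sqit (B : normedStarAlgType R) (x : B) (k : nat) : B :=
  if k is k'.+1 then 2^-1 *r (x + ((2 * tau R k') *r sqit x k' - sqit x k' ** sqit x k'))
  else 0.

Definition alg_hom (B C : normedStarAlgType R) (f : B -> C) : Prop :=
  [/\ {morph f : x y / x + y}, forall (a : R[i]) x, f (a *: x) = a *: f x &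
      {morph f : x y / x ** y}].

Lemma alg_hom0 (B C : normedStarAlgType R) (f : B -> C) : alg_hom f -> f 0 = 0.
Proof. by move=> [_ fZ _]; have := fZ 0 0; rewrite !scale0r. Qed.

Lemma alg_homN (B C : normedStarAlgType R) (f : B -> C) :
  alg_hom f -> {morph f : x / - x}.
Proof. by move=> [_ fZ _] x; rewrite -scaleN1r fZ scaleN1r. Qed.

Lemma alg_homB (B C : normedStarAlgType R) (f : B -> C) :
  alg_hom f -> {morph f : x y / x - y}.
Proof. by move=> fh x y; have [fD _ _] := fh; rewrite fD (alg_homN fh). Qed.

Lemma alg_hom_sqit (B C : normedStarAlgType R) (f : B -> C) x k : alg_hom f ->
  f (sqit x k) = sqit (f x) k.
Proof.
move=> fh; have [fD fZ fM] := fh.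
elim: k => [|k ih] /=; first exact: alg_hom0.
by rewrite /rscal fZ fD (alg_homB fh) fZ fM ih.
Qed.

Lemma sqit_star (B : normedStarAlgType R) (x : B) k : star x = x ->
  star (sqit x k) = sqit x k.
Proof.
move=> sx; elim: k => [|k ih] /=; first exact: star0.
by rewrite /rscal starZ conjC_real !starD sx starN starZ conjC_real starM ih.
Qed.

Lemma sqit_orthl (B : normedStarAlgType R) (x y : B) k : x ** y = 0 -> sqit x k ** y = 0.
Proof.
move=> xy; elim: k => [|k ih] /=; first exact: smul0r.
rewrite /rscal smulZl !smulDl smulNr smulZl ih xy -smulA ih smulr0 oppr0.
by rewrite !scaler0 !addr0 scaler0.
Qed.

Lemma sqit_orthr (B : normedStarAlgType R) (x y : B) k : x ** y = 0 -> x ** sqit y k = 0.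
Proof.
move=> xy; elim: k => [|k ih] /=; first exact: smulr0.
rewrite /rscal smulZr !smulDr smulrN smulZr ih xy smulA ih smul0r oppr0.
by rewrite !scaler0 !addr0 scaler0.
Qed.

(** Formulated as a property of the algebra, so that it can be carried from A to F(D, A) one
    construction at a time. The strict bound on z allows a lift from a quotient that is still of
    norm less than 1. *)
Definition sqrt_approx (B : normedStarAlgType R) : Prop := forall (z : B) k, rnorm z < 1 ->
  rnorm (sqit (star z ** z) k ** sqit (star z ** z) k - star z ** z) <= 6 * (1 - tau R k).

Lemma uinr (A : cstarAlgType R) (r : R) (x : A) : uin (r *r x) = r *r uin x.
Proof. exact: uinZ. Qed.

Lemma useq_sqit (A : cstarAlgType R) (x : A) k :
  useq (1 - uin x) k = tau R k *r 1 - uin (sqit x k).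
Proof.
elim: k => [|k ih] /=; first by rewrite /rscal scale0r sub0r -uinN oppr0.
rewrite {}ih; move: (sqit x k) => a; set t := tau R k.
rewrite uinr -(rscalA 2^-1 (1 + _)) -rscalBr; congr (_ *r _).
rewrite !(uinD, uinN, uinM, uinr).
rewrite rscalDl rscal1 mulrBl !mulrBr !rscalMl !rscalMr mul1r mulr1 rscalA.
rewrite !opprD !opprK -expr2.
have -> : (2 * t) *r uin a = t *r uin a + t *r uin a.
  by rewrite -rscalDl; congr (_ *r _); ring.
rewrite !opprD !addrA !mul1r; by rewrite [LHS](ACl (1*3*2*4*5*6)).
Qed.

(** With s = 1 - tau and a the polynomial root, a^2 - x = ((s + a)^2 - x) - (s^2 + 2 s a). The three
    terms are at most s^2, s^2 and 4 s, whence the constant 6. *)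
Lemma cstar_sqrt_approx (A : cstarAlgType R) : sqrt_approx A.
Proof.
move=> z k z1; set x := star z ** z.
have zb : bd (uin z) 1 by apply: bdW (bd_in z); exact: ltW.
have ub : bd (1 - uin x) 1 by rewrite /x uinM -ustar_in; exact: bd_sub_star_mul.
have h := useq_sqr_bd ub k; rewrite useq_sqit in h.
have pb := useq_bd ub k; rewrite useq_sqit in pb.
set a := sqit x k in h pb *; set t := tau R k in h pb *.
have tb : 0 <= 1 - t <= 1 by have := tau_bounds R k; rewrite -/t; lra.
have ab : bd (uin a) 2.
  have := bdB (bdr (_ : 0 <= t) (@bd1 _ A)) pb.
  rewrite opprB addrC subrK mulr1 => ab; apply: bdW (ab _); lra.
have e1 : 1 - (t *r 1 - uin a) = (1 - t) *r 1 + uin a.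
  by rewrite rscalDl rscal1 opprB addrA addrAC /rscal rmorphN scaleNr.
have e2 : 1 - (1 - uin x) = uin x by rewrite opprB addrC subrK.
rewrite e1 e2 in h.
apply: rnorm_bd; rewrite uinD uinM uinN.
set s := 1 - t in e1 h tb *; clearbody s.
have -> : uin a * uin a - uin x = (s *r 1 + uin a) * (s *r 1 + uin a) - uin x -
    ((s * s) *r 1 + (2 * s) *r uin a).
  have -> : (2 * s) *r uin a = s *r uin a + s *r uin a.
    by rewrite -rscalDl; congr (_ *r _); ring.
  move: (uin a) => V; rewrite mulrDl !mulrDr !rscalMl !rscalMr !mul1r !mulr1 rscalA.
  by rewrite !opprD !addrA [RHS](ACl ((1*6)*(2*7)*(3*8)*4*5))/= !subrr !add0r.
have := bdB h (bdD (bdr (_ : 0 <= s * s) (@bd1 _ A)) (bdr (_ : 0 <= 2 * s) ab)).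
move=> b; apply: bdW (b _ _); rewrite ?mulr_ge0//; try lra.
by rewrite expr2; nra.
Qed.

Lemma linf_sqrt_approx I (B : normedStarAlgType R) : sqrt_approx B -> sqrt_approx (linf I B).
Proof.
move=> Bs z k z1; rewrite rnorm_linf; apply: linf_norm_le => [|i].
  by have := tau_bounds R k; lra.
pose ev (f : linf I B) := f i.
have evh : alg_hom ev by split.
have E : ev (sqit (star z ** z) k) = sqit (star (z i) ** z i) k by exact: alg_hom_sqit.
rewrite [linf_val _ _](_ : _ = sqit (star (z i) ** z i) k ** sqit (star (z i) ** z i) k
  - star (z i) ** z i); last by rewrite -E.
by apply: Bs; apply: le_lt_trans z1; exact: linf_norm_ub.
Qed.

Lemma subalg_sqrt_approx (B : normedStarAlgType R) (S : starSubalg B) :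
  sqrt_approx B -> sqrt_approx (subalg S).
Proof.
move=> Bs z k z1; pose ev (f : subalg S) := subalg_val f.
have evh : alg_hom ev by split.
have E : ev (sqit (star z ** z) k) = sqit (star (ev z) ** ev z) k by exact: alg_hom_sqit.
by have := Bs (ev z) k z1; rewrite -E.
Qed.

Lemma qpi_hom (B : normedStarAlgType R) (J : starIdeal B) : alg_hom (qpi J).
Proof. by split; [exact: qpiD|exact: qpiZ|exact: qpiM]. Qed.

Lemma quot_lift_lt (B : normedStarAlgType R) (J : starIdeal B) (q : quotalg J) c :
  rnorm q < c -> exists2 x, qpi J x = q & rnorm x < c.
Proof.
rewrite rnorm_quot => /inf_lt[|_ [x xq <-] xc]; last by exists x.
by exists (rnorm (qrepr q)), (qrepr q) => //; exact: qreprK.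
Qed.

Lemma rnorm_qpi (B : normedStarAlgType R) (J : starIdeal B) x : rnorm (qpi J x) <= rnorm x.
Proof. exact: quot_norm_le. Qed.

Lemma quotalg_sqrt_approx (B : normedStarAlgType R) (J : starIdeal B) :
  sqrt_approx B -> sqrt_approx (quotalg J).
Proof.
move=> Bs z k /quot_lift_lt[y <- y1].
rewrite -qpiS -qpiM -(alg_hom_sqit _ _ (qpi_hom J)) -qpiM -qpiB.
exact: le_trans (rnorm_qpi _ _) (Bs _ _ y1).
Qed.

Lemma Fcs_sqrt_approx (A : cstarAlgType R) (D : starSubalg A) : sqrt_approx (Fcs D).
Proof.
apply: quotalg_sqrt_approx; apply: subalg_sqrt_approx; apply: quotalg_sqrt_approx.
by apply: linf_sqrt_approx; exact: cstar_sqrt_approx.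
Qed.

End sqrt_polynomials.

(** * Almost orthogonal sums and approximate units *)

Section orthogonal_sums.
Variable R : realType.

Lemma rnorm_sum (V : normedModType R[i]) (I : Type) (s : seq I) (P : pred I) (F : I -> V) M :
  0 <= M -> (forall c, P c -> rnorm (F c) <= M) ->
  rnorm (\sum_(c <- s | P c) F c) <= (size s)%:R * M.
Proof.
move=> M0 FM; elim: s => [|c s ih]; first by rewrite big_nil rnorm0 mul0r.
rewrite big_cons/= -nat1r mulrDl mul1r; case: ifP => Pc.
  by rewrite (le_trans (rnormD _ _))// lerD// FM.
by rewrite (le_trans ih)// lerDr.
Qed.

Lemma smul_suml (A : normedStarAlgType R) (I : Type) (s : seq I) (P : pred I) (F : I -> A) y :
  (\sum_(c <- s | P c) F c) ** y = \sum_(c <- s | P c) F c ** y.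
Proof. by apply: (big_morph (fun x => x ** y)) => [a b|]; rewrite ?smulDl ?smul0r. Qed.

Lemma smul_sumr (A : normedStarAlgType R) (I : Type) (s : seq I) (P : pred I) (F : I -> A) y :
  y ** (\sum_(c <- s | P c) F c) = \sum_(c <- s | P c) y ** F c.
Proof. by apply: (big_morph (fun x => y ** x)) => [a b|]; rewrite ?smulDr ?smulr0. Qed.

Lemma star_sum (A : normedStarAlgType R) (I : Type) (s : seq I) (P : pred I) (F : I -> A) :
  star (\sum_(c <- s | P c) F c) = \sum_(c <- s | P c) star (F c).
Proof. by apply: (big_morph (@star R A)) => [a b|]; rewrite ?starD ?star0. Qed.

Lemma diag_mul (A : normedStarAlgType R) (C : eqType) (s : seq C) (a b : C -> A) g :
  uniq s -> 0 <= g -> (forall c c', c != c' -> rnorm (a c ** b c') <= g) ->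
  rnorm ((\sum_(c <- s) a c) ** (\sum_(c <- s) b c) - \sum_(c <- s) a c ** b c)
    <= (size s)%:R * ((size s)%:R * g).
Proof.
move=> us g0 ab; rewrite smul_suml -sumrB.
pose D c := \sum_(c' <- s | c' != c) a c ** b c'.
have -> : \sum_(c <- s) (a c ** (\sum_(c' <- s) b c') - a c ** b c) = \sum_(c <- s) D c.
  apply: eq_big_seq => c cs; rewrite smul_sumr (bigD1_seq c)//=.
  by rewrite addrAC subrr add0r.
apply: rnorm_sum => [|c _]; first by rewrite mulr_ge0.
by apply: rnorm_sum => // c' cc'; rewrite ab// eq_sym.
Qed.

(** The bound r improves to sqrt r, and sqrt r - 1 <= (r - 1) / 2, so the excess over 1 halves at
    each step. The tolerance g must be uniform in the family and the coefficients, since the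
    induction hypothesis is applied to the y_c^2 with coefficients |f_c|^2. *)
Lemma orthogonal_sum_step (N : nat) : (0 < N)%N ->
  forall k : nat, exists rk : R, [/\ 1 <= rk, rk <= 1 + (N%:R - 1) / (2 ^ k)%:R &
  forall e : R, 0 < e -> exists2 g : R, 0 < g &
    forall (A : cstarAlgType R) (C : eqType) (s : seq C) (y : C -> A),
      uniq s -> (size s <= N)%N -> (forall c, star (y c) = y c) ->
      (forall c, rnorm (y c) <= 1 + g) ->
      (forall c c', c != c' -> rnorm (y c ** y c') <= g) ->
      forall f : C -> R[i], (forall c, complex.Re `|f c| <= 1) ->
      rnorm (\sum_(c <- s) f c *: y c) <= rk + e].
Proof.
move=> N0; have N1 : 1 <= N%:R :> R by rewrite ler1n.
elim=> [|k [rk [rk1 rkN IH]]].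
  exists N%:R; split; [exact: N1|by rewrite expn0 divr1 addrC subrK|move=> e e0].
  exists (e / N%:R) => [|A C s y us sN sy y1 yy f f1].
    by rewrite divr_gt0// ltr0n.
  have NN : N%:R != 0 :> R by rewrite pnatr_eq0 -lt0n.
  have g0 : 0 <= 1 + e / N%:R by rewrite addr_ge0// divr_ge0// ltW.
  rewrite (le_trans (rnorm_sum s (M := 1 + e / N%:R) _ _))// => [c _|].
    rewrite rnormZ -[leRHS]mul1r ler_pM ?Re_norm_ge0 ?rnorm_ge0//.
  rewrite (le_trans (ler_wpM2r g0 (_ : (size s)%:R <= N%:R)))// ?ler_nat//.
  have -> : N%:R * (1 + e / N%:R) = N%:R + e by field.
  exact: lexx.
exists (Num.sqrt rk); have rk0 : 0 <= rk by apply: le_trans rk1.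
have sq1 : 1 <= Num.sqrt rk by rewrite -sqrtr1 ler_wsqrtr.
split=> //.
  have h : Num.sqrt rk ^+ 2 = rk by exact: sqr_sqrtr.
  have : Num.sqrt rk - 1 <= 2^-1 * (rk - 1).
    by rewrite -{2}h; have := sqr_ge0 (Num.sqrt rk - 1); rewrite !expr2; lra.
  have : 2^-1 * (rk - 1) <= 2^-1 * ((N%:R - 1) / (2 ^ k)%:R) by rewrite ler_pM2l// lerBlDl.
  rewrite expnS natrM invfM mulrCA; lra.
move=> e e0; have e20 : 0 < e ^+ 2 / 2 by rewrite divr_gt0// exprn_gt0.
have [g' g'0 h] := IH _ e20.
have NN0 : 0 < N%:R * N%:R :> R by rewrite mulr_gt0// ltr0n.
(* The first two terms make the squares y_c^2 satisfy the hypotheses with tolerance g'; the third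
   bounds the at most N^2 off-diagonal terms of T^* T by e^2 / 2. *)
pose g := Num.min 1 (Num.min (g' / 4) (e ^+ 2 / 2 / (N%:R * N%:R))).
have g1 : g <= 1 by rewrite ge_min lexx.
have gg' : g <= g' / 4 by rewrite !ge_min lexx orbT.
have ge : g <= e ^+ 2 / 2 / (N%:R * N%:R) by rewrite !ge_min lexx !orbT.
have g0 : 0 < g by rewrite !lt_min ltr01 (divr_gt0 g'0)// (divr_gt0 e20 NN0).
exists g => // A C s y us sN sy y1 yy f f1; set T := \sum_(c <- s) _.
have y2 c : rnorm (y c ** y c) <= 1 + g'.
  rewrite (le_trans (rnormM _ _))// (le_trans (ler_pM _ _ (y1 c) (y1 c))) ?rnorm_ge0//.
  nra.
have yy2 c c' : c != c' -> rnorm (y c ** y c ** (y c' ** y c')) <= g'.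
  move=> cc'; rewrite -smulA (smulA (y c) (y c')) (le_trans (rnormM _ _))//.
  have h1 : rnorm (y c ** y c' ** y c') <= g * 2.
    rewrite (le_trans (rnormM _ _))// ler_pM ?rnorm_ge0// ?yy//.
    by rewrite (le_trans (y1 _))//; lra.
  rewrite (le_trans (ler_pM _ _ (_ : _ <= 2) h1)) ?rnorm_ge0//.
    by rewrite (le_trans (y1 _))//; lra.
  lra.
have f2 c : complex.Re `|(f c)^* * f c| <= 1.
  have := rnormM (A := R[i]^o) (f c)^* (f c); rewrite /rnorm => /le_trans; apply.
  have -> : complex.Re `|(f c)^* : R[i]^o| = complex.Re `|f c|.
    by congr (complex.Re _); exact: norm_conjC.
  by rewrite -[leRHS]mul1r ler_pM ?Re_norm_ge0.
have := h A C s (fun c => y c ** y c) us sN _ y2 yy2 (fun c => (f c)^* * f c) f2.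
have sy2 c : star (y c ** y c) = y c ** y c by rewrite starM sy.
move=> /(_ sy2); set P := \sum_(c <- s) _ => Pb.
have TP : rnorm (star T ** T - P) <= e ^+ 2 / 2.
  have ab c c' : c != c' -> rnorm (star (f c *: y c) ** (f c' *: y c')) <= g.
    move=> cc'; rewrite starZ sy smulZl smulZr !rnormZ.
    have := yy _ _ cc'; have := f1 c; have := f1 c'.
    have -> : complex.Re `|(f c)^*| = complex.Re `|f c|.
      by congr (complex.Re _); exact: norm_conjC.
    move=> a1 a2 a3; rewrite -[leRHS]mul1r ler_pM ?Re_norm_ge0 ?mulr_ge0 ?Re_norm_ge0 ?rnorm_ge0//.
    by rewrite -[leRHS]mul1r ler_pM ?Re_norm_ge0 ?rnorm_ge0.
  have := diag_mul us (ltW g0) ab; rewrite -star_sum -/T.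
  under eq_bigr do rewrite starZ sy smulZl smulZr scalerA.
  move=> /le_trans; apply; rewrite mulrA.
  have sN2 : (size s)%:R * (size s)%:R <= N%:R * N%:R :> R by rewrite -!natrM ler_nat leq_mul.
  rewrite (le_trans (ler_wpM2r (ltW g0) sN2))// mulrC -ler_pdivlMr//.
have TT : rnorm T ^+ 2 <= rk + e ^+ 2.
  rewrite -rnorm_star_smul -[star T ** T](subrK P) (le_trans (rnormD _ _))//.
  by rewrite (le_trans (lerD TP Pb))//; lra.
rewrite -(@ler_pXn2r _ 2) ?nnegrE ?rnorm_ge0 ?addr_ge0 ?sqrtr_ge0 ?(ltW e0)//.
rewrite (le_trans TT)// sqrrD sqr_sqrtr// -addrA lerD2l lerDr.
by rewrite mulrn_wge0// mulr_ge0 ?sqrtr_ge0 ?ltW.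
Qed.

(* Repeated use of the C*-identity: [|sum f y|^2 <= |sum |f|^2 y^2| + small], so the trivial
   bound N improves to N^(1/2), N^(1/4), and so on. *)
Lemma almost_orthogonal_sum (N : nat) (e : R) : 0 < e ->
  exists2 g : R, 0 < g & forall (A : cstarAlgType R) (C : eqType) (s : seq C) (y : C -> A),
    uniq s -> (size s <= N)%N -> (forall c, star (y c) = y c) ->
    (forall c, rnorm (y c) <= 1 + g) ->
    (forall c c', c != c' -> rnorm (y c ** y c') <= g) ->
    forall f : C -> R[i], (forall c, complex.Re `|f c| <= 1) ->
    rnorm (\sum_(c <- s) f c *: y c) <= 1 + e.
Proof.
move=> e0; have e20 : 0 < e / 2 by rewrite divr_gt0.
have [k hk] : exists k, N%:R / (2 ^ k)%:R <= e / 2.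
  exists (Num.truncn (N%:R / (e / 2))).+1.
  rewrite ler_pdivrMr ?ltr0n ?expn_gt0// mulrC -ler_pdivrMr//.
  by rewrite (le_trans (ltW (truncnS_gt _)))// ler_nat ltnW// ltn_expl.
(* Using [N.+1] guarantees a positive number of terms, and the excess becomes exactly N / 2^k. *)
have [rk [_ rkN h]] := @orthogonal_sum_step N.+1 (ltn0Sn N) k.
have [g g0 hg] := h _ e20; exists g => // A C s y us sN sy y1 yy f f1.
rewrite (le_trans (hg A C s y us (leqW sN) sy y1 yy f f1))//.
have : (N.+1%:R - 1) / (2 ^ k)%:R = N%:R / (2 ^ k)%:R :> R by rewrite -natr1 addrK.
by move=> E; rewrite E in rkN; lra.
Qed.

End orthogonal_sums.

(** * Approximate units of *-subalgebras *)

Section approximate_unit.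
Variables (R : realType) (A : cstarAlgType R) (D : starSubalg A).
Implicit Types (T : unitz A) (x y : A).

(** The coset 1 + D. An approximate unit u is sought through 1 - u: contractions in 1 + D that
    nearly annihilate given elements can be multiplied together. *)
Definition unit_plus T : Prop := T.1 = 1 /\ sa_set D T.2.

Lemma unit_plusM S T : unit_plus S -> unit_plus T -> unit_plus (S * T).
Proof.
move=> [S1 DS] [T1 DT]; split; rewrite /= S1 T1 ?mulr1//.
by apply: saD; [apply: saD; apply: saZ|exact: saM].
Qed.

Lemma unit_plus1 : unit_plus 1.
Proof. by split=> //; exact: sa0. Qed.

Lemma unit_plus_act T x : unit_plus T -> sa_set D x -> sa_set D (uact T x).
Proof. by move=> [_ DT] Dx; apply: saD; [exact: saZ|exact: saM]. Qed.

Lemma unit_plus_star T : unit_plus T -> unit_plus (ustar T).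
Proof. by move=> [T1 DT]; split; rewrite /= ?T1 ?rmorph1//; exact: saS. Qed.

Lemma uactr T (r : R) x : uact T (r *r x) = r *r uact T x.
Proof. by rewrite /uact /rscal scalerDr smulZr !scalerA mulrC. Qed.

Lemma uact_uin T x : T * uin x = uin (uact T x).
Proof. by congr pair; rewrite /= ?mulr0// scale0r addr0. Qed.

Lemma saN x : sa_set D x -> sa_set D (- x).
Proof. by move=> Dx; rewrite -scaleN1r; exact: saZ. Qed.

(* The Cesaro means of the powers of [1 - x x^* ] asymptotically annihilate [x x^* ], as
   [(1 - u) (1 + u + ... + u^(N-1)) = 1 - u^N]. *)
Lemma unit_plus_kill x (e : R) : sa_set D x -> rnorm x <= 1 -> 0 < e ->
  exists T, [/\ unit_plus T, bd T 1 & rnorm (uact T x) <= e].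
Proof.
move=> Dx x1 e0; set h := x ** star x; set u := 1 - uin h.
have ub : bd u 1.
  have := @bd_sub_star_mul _ _ (uin (star x)); rewrite ustar_in starK -uinM.
  by apply; apply: bdW (bd_in _); rewrite rnorm_star.
have uD : unit_plus u.
  split; rewrite /= ?subr0// sub0r; apply/saN/saM => //; exact: saS.
have unD n : unit_plus (u ^+ n).
  by elim: n => [|n ih]; [exact: unit_plus1|rewrite exprS; exact: unit_plusM].
(* Below, |T x|^2 = |T h T^*| <= |T h| <= 2 / N, which has to be at most e^2. *)
pose N := (Num.truncn (2 / e ^+ 2)).+1.
have N0 : N%:R != 0 :> R by rewrite pnatr_eq0.
have iN0 : 0 <= N%:R^-1 :> R by rewrite invr_ge0.
pose S := \sum_(i < N) u ^+ i; pose T := N%:R^-1 *r S.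
have sum_bd n : bd (\sum_(i < n) u ^+ i) n%:R.
  elim: n => [|n ih].
    by rewrite big_ord0; exact: bd_0.
  by rewrite big_ord_recr -natr1; apply: bdD => //; exact: bdX.
have sumD n : (\sum_(i < n) u ^+ i).1 = n%:R /\ sa_set D (\sum_(i < n) u ^+ i).2.
  elim: n => [|n [ih1 ih2]]; first by rewrite big_ord0; split=> //; exact: sa0.
  have [u1 u2] := unD n; rewrite big_ord_recr /=; split; last exact: saD.
  by rewrite -natr1 -ih1 -u1.
have Tb : bd T 1 by apply: (bd_eq (bdr iN0 (sum_bd N))); rewrite ?mulVf.
have TD : unit_plus T.
  have [S1 S2] := sumD N; split; last by apply: saZ.
  rewrite /T /rscal /= S1 /GRing.scale/= -(rmorph_nat (real_complex R)) -rmorphM.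
  by rewrite mulVf.
exists T; split=> //.
have Su : S * (1 - u) = 1 - u ^+ N.
  have E : (1 - u) * S = 1 - u ^+ N by rewrite -opprB mulNr -subrX1 opprB.
  rewrite -E mulrBr mulrBl mulr1 mul1r; congr (_ - _).
  by rewrite /S mulr_suml mulr_sumr; apply: eq_bigr => i _; rewrite -exprS -exprSr.
have u1 : 1 - u = uin h by rewrite opprB addrC subrK.
have Th : bd (T * uin h) (2 / N%:R).
  rewrite /T -u1 rscalMl Su mulrC; apply: bdr => //.
  exact: bdB (@bd1 _ A) (bdX _ ub).
have Tx : bd (T * uin x * ustar (T * uin x)) (2 / N%:R).
  rewrite ustarM ustar_in mulrA -(mulrA T) -uinM -/h -[X in bd _ X]mulr1.
  by apply: bdM => //; exact: bd_star.
rewrite uact_uin ustar_in -uinM in Tx.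
have := rnorm_bd Tx; rewrite rnorm_smul_star => xe.
rewrite -(@ler_pXn2r _ 2) ?nnegrE ?rnorm_ge0 ?(ltW e0)//.
rewrite (le_trans xe)// ler_pdivrMr ?ltr0n// mulrC -ler_pdivrMr ?exprn_gt0//.
exact/ltW/truncnS_gt.
Qed.

(** The elements are treated one by one: a factor that nearly kills [uact T0 x] is put in front of
    T0, and being a contraction it preserves what T0 has achieved. Scaling by M meets the norm
    condition of [unit_plus_kill]. *)
Lemma unit_plus_kill_seq (s : seq A) (e : R) :
  (forall x, x \in s -> sa_set D x) -> 0 < e ->
  exists T, [/\ unit_plus T, bd T 1 & forall x, x \in s -> rnorm (uact T x) <= e].
Proof.
move=> sD e0; elim: s sD => [|x s ih] sD.
  by exists 1; split; [exact: unit_plus1|exact: bd1|].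
have [|T0 [T0D T0b T0s]] := ih; first by move=> y ys; apply: sD; rewrite inE ys orbT.
have Dx : sa_set D (uact T0 x) by apply: unit_plus_act => //; apply: sD; rewrite mem_head.
set y := uact T0 x in Dx; pose M := rnorm y + 1.
have M0 : 0 < M by rewrite ltr_wpDl ?rnorm_ge0.
have nM (z : A) : rnorm (M^-1 *r z) = M^-1 * rnorm z.
  by rewrite rnormZ Re_normC ger0_norm// invr_ge0 ltW.
have [|||T1 [T1D T1b T1y]] := @unit_plus_kill (M^-1 *r y) (M^-1 * e).
- exact: saZ.
- by rewrite nM mulrC ler_pdivrMr// mul1r lerDl.
- by rewrite mulr_gt0// invr_gt0.
exists (T1 * T0); split; first exact: unit_plusM.
  by rewrite -[X in bd _ X]mulr1; exact: bdM.
move=> z; rewrite inE uactM => /predU1P[->|zs]; last first.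
  by have [_ h] := T1b; rewrite (le_trans (h _))// mul1r T0s.
by move: T1y; rewrite uactr nM ler_pM2l// invr_gt0.
Qed.

Lemma approximate_unit (s : seq A) (e : R) :
  (forall x, x \in s -> sa_set D x) -> 0 < e ->
  exists u, [/\ sa_set D u, star u = u, rnorm u <= 1,
    forall x, x \in s -> rnorm (u ** x - x) <= e &
    forall x, x \in s -> rnorm (x ** u - x) <= e].
Proof.
(* With the adjoints included, the estimates for right multiplication follow from those for left
   multiplication. *)
move=> sD e0; pose s' := s ++ map (@star R A) s.
have s'D x : x \in s' -> sa_set D x.
  by rewrite mem_cat => /orP[/sD//|/mapP[y /sD Dy ->]]; exact: saS.
have [T [TD Tb Ts]] := unit_plus_kill_seq s'D e0.
pose t := ustar T * T.
have tD : unit_plus t by apply: unit_plusM => //; exact: unit_plus_star.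
have st : ustar t = t by rewrite ustarM ustarK.
have tb : bd t 1 by rewrite -[X in bd _ X]mulr1; apply: bdM => //; exact: bd_star.
have [tt1 tt2] := unit_plusM tD tD.
(* That is, u = 1 - t^2. Squaring the self-adjoint contraction t gives |u| <= 1 by [bd_sub_sqr], and
   u x - x = - t T^* (T x) is as small as T x. *)
pose u := - (t * t).2.
have uE : uin u = 1 - t * t.
  by congr pair; rewrite /= ?sub0r//; have := tt1; rewrite /= => ->; rewrite subrr.
have su : star u = u by apply: uin_inj; rewrite -ustar_in uE ustarB ustar1 ustarM st.
have ux x : x \in s' -> rnorm (u ** x - x) <= e.
  move=> xs; have -> : u ** x - x = - uact (t * t) x.
    by rewrite -uact_in uE uactDl uact1 uactNl addrAC subrr add0r.
  rewrite rnormN uactM /t (uactM _ T x).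
  have tc S y : bd S 1 -> rnorm (uact S y) <= rnorm y by move=> [_ /(_ y)]; rewrite mul1r.
  by rewrite (le_trans (tc _ _ tb))// (le_trans (tc _ _ (bd_star Tb)))// Ts.
exists u; split=> //.
- exact: saN.
- by apply: rnorm_bd; rewrite uE; exact: bd_sub_sqr.
- by move=> x xs; apply: ux; rewrite mem_cat xs.
- move=> x xs; rewrite -rnorm_star starD starN starM su; apply: ux.
  by rewrite mem_cat map_f ?orbT.
Qed.

End approximate_unit.

(** * Finite index subgroups and the profinite completion *)

Section finite_index_subgroups.
Variable G : groupType.
Implicit Types (H K : subgroup G) (g h t : G).

Lemma ltransM t g (C : set G) : ltrans t (ltrans g C) = ltrans (t * g)%g C.
Proof. by rewrite /ltrans image_comp; apply: eq_imagel => x _ /=; rewrite mulgA. Qed.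

Lemma ltrans1 (C : set G) : ltrans 1%g C = C.
Proof.
rewrite /ltrans; apply/seteqP; split=> x; first by move=> [y Cy <-]; rewrite mul1g.
by move=> Cx; exists x => //; rewrite mul1g.
Qed.

Lemma ltrans_inj t : injective (ltrans t).
Proof. by move=> C D /(congr1 (ltrans t^-1%g)); rewrite !ltransM !mulVg !ltrans1. Qed.

Lemma ltrans_eqP H g h : ltrans g H = ltrans h H <-> sg_set H (g^-1 * h)%g.
Proof.
split=> [gh|gh].
  have : ltrans h H h by exists 1%g; [exact: sg1|rewrite mulg1].
  by rewrite -gh => -[x Hx <-]; rewrite mulKg.
apply/seteqP; split=> _ [x Hx <-].
  exists ((g^-1 * h)^-1 * x)%g; first by apply: sgM => //; exact: sgV.
  by rewrite invgM invgK !mulgA mulgV mul1g.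
by exists ((g^-1 * h) * x)%g; [exact: sgM|rewrite !mulgA mulgV mul1g].
Qed.

Lemma ltrans_idP H g : ltrans g H = H <-> sg_set H g.
Proof.
rewrite -{2}[sg_set H]ltrans1 ltrans_eqP mulg1.
by split=> /sgV; rewrite ?invgK.
Qed.

Lemma finite_index_map (T : finType) H (F : G -> T) :
  (forall g h, F g = F h -> sg_set H (g^-1 * h)%g) -> finite_index H.
Proof.
move=> FH; pose j (x : T) := ltrans (xget 1%g [set g | F g = x]) H.
apply: (@sub_finite_set _ _ (j @` [set: T])); last first.
  by apply: finite_image; exact: finite_finset.
move=> _ [g _ <-]; exists (F g) => //; apply/ltrans_eqP/FH.
by apply: (@xgetPex _ 1%g [set h | F h = F g]); exists g.
Qed.

Lemma cosets_seq H : finite_index H -> exists s : seq (set G),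
  uniq s /\ forall C, cosets H C <-> C \in s.
Proof.
move=> /finite_seqP[s sE]; exists (undup s); split; first exact: undup_uniq.
by move=> C; rewrite mem_undup sE.
Qed.

(** G permutes the cosets of H; an element acting trivially fixes the coset H itself and so lies in
    H. Since [perm] products compose from left to right, the result is an anti-homomorphism. *)
Lemma finite_index_action H : finite_index H -> exists n (r : G -> 'S_n),
  (forall g h, r (g * h)%g = (r h * r g)%g) /\ (forall g, r g = 1%g -> sg_set H g).
Proof.
move=> /cosets_seq[s [us sP]]; exists (size s).
have lt_idx g (i : 'I_(size s)) : (index (ltrans g (nth set0 s i)) s < size s)%N.
  by rewrite index_mem; apply/sP/ltrans_coset/sP; exact: mem_nth.
pose a g (i : 'I_(size s)) : 'I_(size s) := Ordinal (lt_idx g i).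
have nth_a g i : nth set0 s (a g i) = ltrans g (nth set0 s i).
  by rewrite /= nth_index// -index_mem.
have a_inj g : injective (a g).
  move=> i j /(congr1 (fun k : 'I_(size s) => nth set0 s k)); rewrite !nth_a => /ltrans_inj e.
  by apply/val_inj/eqP; rewrite -(nth_uniq set0 (ltn_ord i) (ltn_ord j) us); exact/eqP.
exists (fun g => perm (@a_inj g)); split=> [g h|g g1].
  apply/permP => i; rewrite permM !permE; apply/val_inj/eqP.
  rewrite -(nth_uniq set0 (ltn_ord _) (ltn_ord _) us); apply/eqP.
  by rewrite !nth_a ltransM.
have Hs : (index (sg_set H) s < size s)%N.
  by rewrite index_mem; apply/sP; exists 1%g => //; rewrite ltrans1.
have := nth_a g (Ordinal Hs); rewrite -(permE (@a_inj g)) g1 perm1/=.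
rewrite nth_index -?index_mem// => e; exact/ltrans_idP.
Qed.

(* An action on an m-element set is an anti-homomorphism to ['S_m], where [s * t] applies [s]
   first. *)
Definition action_kernel_set (m : nat) : set G :=
  [set g | forall r : G -> 'S_m, (forall x y, r (x * y)%g = (r y * r x)%g) -> r g = 1%g].

Lemma anti1 m (r : G -> 'S_m) : (forall x y, r (x * y)%g = (r y * r x)%g) -> r 1%g = 1%g.
Proof. by move=> rM; apply: (mulgI (r 1%g)); rewrite -rM !mulg1. Qed.

Lemma antiV m (r : G -> 'S_m) : (forall x y, r (x * y)%g = (r y * r x)%g) ->
  forall x, r x^-1%g = (r x)^-1%g.
Proof. by move=> rM x; apply: (mulgI (r x)); rewrite -rM mulVg mulgV; exact: anti1. Qed.

Program Definition action_kernel (m : nat) : subgroup G :=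
  @Subgroup G (action_kernel_set m) _ _ _.
Next Obligation. by move=> m r rM; exact: anti1. Qed.
Next Obligation. by move=> m x y xK yK r rM; rewrite rM xK// yK// mulg1. Qed.
Next Obligation. by move=> m x xK r rM; rewrite (antiV rM) xK// invg1. Qed.

Lemma action_kernel_normal m : is_normal (action_kernel m).
Proof.
move=> g h hK r rM; rewrite !rM (antiV rM) hK//.
by rewrite mul1g mulVg.
Qed.

(** An anti-homomorphism to a finite symmetric group is determined by its values on the generators,
    so only finitely many occur, and their joint values at g determine the coset of g. *)
Lemma action_kernel_finite m : finitely_generated G -> finite_index (action_kernel m).
Proof.
move=> [s sP].
pose ext (v : {ffun 'I_(size s) -> 'S_m}) (r : G -> 'S_m) :=
  (forall x y, r (x * y)%g = (r y * r x)%g) /\ forall i : 'I_(size s), r (nth 1%g s i) = v i.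
(* [F g] tabulates, over all assignments v of permutations to the generators, the value at g of the
   extension of v; assignments that do not extend get the constant 1. *)
pose F (g : G) : {ffun {ffun 'I_(size s) -> 'S_m} -> 'S_m} :=
  [ffun v => xget (fun=> 1%g) [set r | ext v r] g].
apply: (@finite_index_map _ _ F) => g h gh r rM.
pose v : {ffun 'I_(size s) -> 'S_m} := [ffun i => r (nth 1%g s (val i))].
have [rM' r'v] : ext v (xget (fun=> 1%g) [set r | ext v r]).
  apply: (@xgetPex _ (fun=> 1%g) [set r | ext v r]); exists r.
  by split=> // i; rewrite ffunE.
have /(congr1 (fun f : {ffun _ -> _} => f v)) := gh; rewrite !ffunE.
set r' := xget _ _ in rM' r'v *; move=> r'gh.
pose E : set G := [set x | r x = r' x].
have E1 : E 1%g by rewrite /E/= !anti1.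
have EM x y : E x -> E y -> E (x * y)%g by rewrite /E/= rM rM' => -> ->.
have EV x : E x -> E x^-1%g by rewrite /E/= (antiV rM) (antiV rM') => ->.
have Eall x : r x = r' x.
  apply: (sP (Subgroup E1 EM EV)) => y ys /=.
  have yi : (index y s < size s)%N by rewrite index_mem.
  by have := r'v (Ordinal yi); rewrite /E/= ffunE/= nth_index// => ->.
by rewrite rM (antiV rM) !Eall r'gh mulgV.
Qed.

Lemma subgroup_capP H K : exists L : subgroup G, sg_set L = sg_set H `&` sg_set K.
Proof.
have h1 : (sg_set H `&` sg_set K) 1%g by split; exact: sg1.
have hM x y : (sg_set H `&` sg_set K) x -> (sg_set H `&` sg_set K) y ->
    (sg_set H `&` sg_set K) (x * y)%g.
  by move=> [? ?] [? ?]; split; exact: sgM.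
have hV x : (sg_set H `&` sg_set K) x -> (sg_set H `&` sg_set K) x^-1%g.
  by move=> [? ?]; split; exact: sgV.
by exists (Subgroup h1 hM hV).
Qed.

Lemma finite_index_col H : finite_index H -> exists n (F : G -> 'I_n.+1),
  forall g h, F g = F h -> sg_set H (g^-1 * h)%g.
Proof.
move=> /cosets_seq[s [us sP]]; exists (size s).
exists (fun g => inord (index (ltrans g H) s)) => g h.
move=> /(congr1 val); rewrite /= !inordK ?ltnS ?index_size// => e.
have gs x : ltrans x H \in s by apply/sP; exists x.
by apply/ltrans_eqP; rewrite -(nth_index set0 (gs g)) e nth_index.
Qed.

Lemma nfi_cap (H K : nfi G) : exists L : nfi G, sg_set L = sg_set H `&` sg_set K.
Proof.
have [L LE] := subgroup_capP H K.
have Ln : is_normal L.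
  by move=> g h; rewrite LE => -[h1 h2]; split; exact: nfi_normal.
have Lf : finite_index L.
  have [n [F FH]] := finite_index_col (nfi_finite H).
  have [m [F' FK]] := finite_index_col (nfi_finite K).
  apply: (@finite_index_map _ L (fun g => (F g, F' g))) => g h [e1 e2].
  by rewrite LE; split; [exact: FH|exact: FK].
by exists (Nfi Ln Lf).
Qed.

(** The n-th term is the intersection of the action kernels of degree 0 to n. A subgroup of index n
    contains the kernel of its own coset action, hence this term. *)
Lemma nfi_chain : finitely_generated G -> exists c : nat -> nfi G,
  (forall n m, (n <= m)%N -> sg_set (c m) `<=` sg_set (c n)) /\
  (forall H : subgroup G, finite_index H -> exists n, sg_set (c n) `<=` sg_set H).
Proof.
move=> fg.
pose K m := Nfi (@action_kernel_normal m) (action_kernel_finite m fg).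
pose cap (H1 H2 : nfi G) := proj1_sig (cid (nfi_cap H1 H2)).
have capE (H1 H2 : nfi G) : sg_set (cap H1 H2) = sg_set H1 `&` sg_set H2 by rewrite /cap; case: cid.
pose c := fix c n := if n is n'.+1 then cap (c n') (K n) else K 0%N.
exists c; split.
  move=> n m /subnK <-; elim: (m - n)%N => [//|k ih].
  by rewrite addSn /= capE => x [/ih].
move=> H /finite_index_action[n [r [rM rH]]]; exists n => x xc; apply: rH.
have : sg_set (K n) x by case: (n) xc => [//|k] /=; rewrite capE => -[].
by apply.
Qed.

End finite_index_subgroups.

(** * Points and cylinder sets of the profinite completion *)

Section profinite_points.
Variable G : groupType.

Definition coset (H : subgroup G) (g : G) : coset_space H :=
  exist _ (ltrans g H) (mem_set (ex_intro2 _ _ g I erefl)).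

Lemma cosetP (H : subgroup G) (x : coset_space H) : exists g, x = coset H g.
Proof. by have [g _ gx] := set_valP x; exists g; apply: val_inj; rewrite /= gx. Qed.

Lemma coset_ltransE (H : subgroup G) t g :
  coset_ltrans t (coset H g) = coset H (t * g)%g.
Proof. by apply: val_inj; rewrite /= ltransM. Qed.

Lemma coset_ltransM (H : subgroup G) t u (x : coset_space H) :
  coset_ltrans t (coset_ltrans u x) = coset_ltrans (t * u)%g x.
Proof. by apply: val_inj; rewrite /= ltransM. Qed.

Lemma coset_ltransK (H : subgroup G) t :
  cancel (@coset_ltrans G t H) (@coset_ltrans G t^-1%g H).
Proof. by move=> x; rewrite coset_ltransM mulVg; apply: val_inj; rewrite /= ltrans1. Qed.

Lemma coset_ltransVK (H : subgroup G) t :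
  cancel (@coset_ltrans G t^-1%g H) (@coset_ltrans G t H).
Proof. by move=> x; rewrite coset_ltransM mulgV; apply: val_inj; rewrite /= ltrans1. Qed.

Lemma coset_eqP (H : subgroup G) g h : coset H g = coset H h <-> sg_set H (g^-1 * h)%g.
Proof. by rewrite -ltrans_eqP; split=> [[]//|e]; apply: val_inj. Qed.

Definition component (H : nfi G) (x : profinite G) : coset_space H := set_val x H.

Lemma component_sub (K H : nfi G) (x : profinite G) g : sg_set K `<=` sg_set H ->
  component K x = coset K g -> component H x = coset H g.
Proof.
move=> KH xK; have [h xH] := cosetP (component H x).
rewrite xH; apply: val_inj => /=; apply/esym.
apply: (set_valP x K H KH g h); first exact: (congr1 set_val xK).
exact: (congr1 set_val xH).
Qed.

Lemma component_sub_eq (K H : nfi G) (x y : profinite G) : sg_set K `<=` sg_set H ->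
  component K x = component K y -> component H x = component H y.
Proof.
move=> KH; have [g xK] := cosetP (component K x); rewrite xK => /esym yK.
by rewrite (component_sub KH xK) (component_sub KH yK).
Qed.

Fact prof_point_in g : @profinite_set G (fun H => coset H g).
Proof.
move=> K H KH g' h /= gg' gh; rewrite -gh; apply/ltrans_eqP.
by move/esym/ltrans_eqP: gg' => /KH /sgV; rewrite invgM invgK => ?; apply/ltrans_eqP/esym/ltrans_eqP.
Qed.

Definition prof_point g : profinite G := exist _ (fun H : nfi G => coset H g) (mem_set (@prof_point_in g)).

Lemma component_point (H : nfi G) g : component H (prof_point g) = coset H g.
Proof. by []. Qed.

Lemma component_ltrans (H : nfi G) t (x : profinite G) :
  component H (prof_ltrans t x) = coset_ltrans t (component H x).
Proof. by []. Qed.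

Lemma component_continuous (H : nfi G) : continuous (component H).
Proof.
move=> x; apply: (@continuous_comp (profinite G)
  (prod_topology (fun H : nfi G => coset_space H)) (coset_space H) set_val
  (@proj (nfi G) (@coset_space G) H)); last exact: proj_continuous.
exact: initial_continuous.
Qed.

Variable c : nat -> nfi G.
Hypothesis c_decr : forall n m, (n <= m)%N -> sg_set (c m) `<=` sg_set (c n).
Hypothesis c_cofinal : forall H : subgroup G, finite_index H ->
  exists n, sg_set (c n) `<=` sg_set H.

(** Otherwise pick a point outside V in each cylinder around x. By cofinality every component of
    this sequence is eventually that of x, so it converges to x, which is absurd. *)
Lemma cylinder_nbhs (x : profinite G) (V : set (profinite G)) : nbhs x V ->
  exists n, [set y | component (c n) y = component (c n) x] `<=` V.
Proof.
move=> xV; apply: contrapT => /forallNP h.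
have /choice[y yP] n : exists y, component (c n) y = component (c n) x /\ ~ V y.
  by have /existsNP[y /not_implyP yP] := h n; exists y.
pose s := (set_val x : prod_topology (fun H : nfi G => coset_space H)).
have yx : (set_val (y n) : prod_topology (fun H : nfi G => coset_space H))
    @[n --> \oo] --> s.
  apply: (@prod_cvg (nfi G) (@coset_space G) nat \oo _ (fun n => set_val (y n)) s) => H.
  have [n nH] := c_cofinal (nfi_finite H).
  move=> W /nbhs_singleton Wx; exists n => // m /= nm.
  have [ym _] := yP m.
  have -> : set_val (y m) H = s H; last exact: Wx.
  by apply: (component_sub_eq _ ym); exact: subset_trans (c_decr nm) nH.
have {}yx : y n @[n --> \oo] --> x.
  exact: (@initial_cvg _ _ set_val nat \oo _ y x yx).
have [n _ /(_ n (leqnn n))] := yx _ xV.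
by have [_] := yP n.
Qed.

(** Compactness: first members of bad pairs cluster at some x, and f varies by less than e / 2
    around x on a cylinder, which then contains both members of some bad pair. *)
Lemma uniform_on_cylinders (R : realType) (f : contfun R (profinite G)) (e : R) : 0 < e ->
  exists n, forall m x y, (n <= m)%N -> component (c m) x = component (c m) y ->
    complex.Re `|subalg_val f x - subalg_val f y| <= e.
Proof.
move=> e0; apply: contrapT => /forallNP h.
have /choice[p pP] n : exists p : profinite G * profinite G,
    component (c n) p.1 = component (c n) p.2 /\
    ~ (complex.Re `|subalg_val f p.1 - subalg_val f p.2| <= e).
  (* A pair that is bad at some level m >= n also agrees at level n, which is all that is
     retained. *)
  have /existsNP[m /existsNP[x /existsNP[y /not_implyP[nm /not_implyP[xy fxy]]]]] := h n.
  by exists (x, y); split=> //; exact: component_sub_eq (c_decr nm) xy.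
have [x [_ clx]] := @profinite_compact G ((fun n => (p n).1) @ \oo) _ filterT.
have e20 : 0 < e / 2 by rewrite divr_gt0.
have ec0 : 0 < (((e / 2)%:C)%C : R[i]) by rewrite ltcR.
pose V := [set y | complex.Re `|subalg_val f x - subalg_val f y| < e / 2].
have Vx : nbhs x V.
  have /cvgrPdist_lt/(_ _ ec0) := subalgP f x.
  apply: filterS => y; rewrite /V/= => fy.
  have := rnormE (subalg_val f x - subalg_val f y : R[i]^o) => E.
  by move: fy; rewrite E ltcR.
have [n0 nV] := cylinder_nbhs Vx.
pose W := [set y | component (c n0) y = component (c n0) x].
have Wx : nbhs x W.
  exact: (@component_continuous (c n0) x [set component (c n0) x] (discrete_set1 _)).
have PW : ((fun n => (p n).1) @ \oo) [set y | exists2 n, (n0 <= n)%N & y = (p n).1].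
  by exists n0 => // n /= n0n; exists n.
have [_ [[n n0n ->] Wn]] := clx _ _ PW Wx.
have [pn fn] := pP n; apply: fn.
have V1 : V (p n).1 by apply: nV.
have V2 : V (p n).2.
  by apply: nV; rewrite /= -(component_sub_eq (c_decr n0n) pn).
have -> : subalg_val f (p n).1 - subalg_val f (p n).2 =
    (subalg_val f x - subalg_val f (p n).2) - (subalg_val f x - subalg_val f (p n).1) :> R[i].
  by rewrite opprB [RHS]addrC addrA subrK.
have := rnormD (V := R[i]^o) (subalg_val f x - subalg_val f (p n).2)
  (- (subalg_val f x - subalg_val f (p n).1)).
rewrite rnormN => /le_trans; apply.
rewrite [e]splitr; apply: lerD; exact: ltW.
Qed.

End profinite_points.

(** * Elements of A modelled on the minimal projections of C(G/H) *)

Section rokhlin_elements.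
Variables (R : realType) (G : groupType).

Section delta.
Variable H : subgroup G.
Implicit Types (x y : coset_space H).

Definition delta_fun y : coset_space H -> R[i]^o := fun x => (x == y)%:R.

Fact delta_bounded y : delta_fun y \in @bounded_family R (coset_space H) R[i]^o.
Proof.
apply/bounded_familyP; exists (rnorm (1 : R[i]^o)) => x; rewrite /delta_fun.
by case: eqP => // _; rewrite rnorm0 rnorm_ge0.
Qed.

Fact delta_cont y : contfun_set (Linf (delta_bounded y)).
Proof.
move=> x U /nbhs_singleton Ux.
by apply: (filterS _ (discrete_set1 x)) => _ ->.
Qed.

Definition delta y : contfun R (coset_space H) :=
  @mk_subalg _ _ (contfun_subalg R (coset_space H)) _ (@delta_cont y).

Lemma contfunP (X : topologicalType) (f g : contfun R X) :
  (forall u, subalg_val f u = subalg_val g u) -> f = g.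
Proof. by move=> fg; apply/val_inj/val_inj/funext. Qed.

Lemma contfun_linear (X : topologicalType) (a : R[i]) (f g : contfun R X) u :
  subalg_val (a *: f + g) u = a * subalg_val f u + subalg_val g u.
Proof.
have -> : subalg_val (a *: f + g) = a *: subalg_val f + subalg_val g by [].
have linfD (h k : linf X R[i]^o) : (h + k : linf X R[i]^o) u = h u + k u by [].
have linfZ (h : linf X R[i]^o) : (a *: h : linf X R[i]^o) u = a * h u by [].
by rewrite linfD linfZ.
Qed.

Lemma deltaE y x : subalg_val (delta y) x = (x == y)%:R. Proof. by []. Qed.

Lemma delta_mul y y' : delta y ** delta y' = if y == y' then delta y else 0.
Proof.
apply: contfunP => x; have -> : subalg_val (delta y ** delta y') x =
  (x == y)%:R * (x == y')%:R by [].
have [<-|yy'] := eqVneq y y'; first by rewrite deltaE -natrM mulnb andbb.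
have [->|_] := eqVneq x y; last by rewrite mul0r.
by rewrite (negPf yy') mulr0.
Qed.

Lemma delta_star y : star (delta y) = delta y.
Proof.
apply: contfunP => x; have -> : subalg_val (star (delta y)) x = ((x == y)%:R : R[i])^* by [].
by rewrite conjC_nat.
Qed.

Lemma delta_norm y : rnorm (delta y) <= 1.
Proof.
apply: (@linf_norm_le R _ _ (subalg_val (delta y))) => // x; rewrite deltaE.
have -> : rnorm ((x == y)%:R : R[i]^o) = complex.Re `|(x == y)%:R : R[i]| by [].
by rewrite normr_nat; case: eqP.
Qed.

Lemma delta_sum (s : seq (coset_space H)) : uniq s -> (forall x, x \in s) ->
  contfun1 R (coset_space H) = \sum_(y <- s) delta y.
Proof.
move=> us sP; apply: contfunP => x.
have ev (r : seq (coset_space H)) :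
    subalg_val (\sum_(y <- r) delta y) x = \sum_(y <- r) ((x == y)%:R : R[i]).
  elim: r => [|y r ih]; first by rewrite !big_nil.
  by rewrite !big_cons -ih.
rewrite ev (bigD1_seq x)//= eqxx big1 ?addr0// => y yx.
by rewrite eq_sym (negPf yx).
Qed.

Lemma sigma_delta t y : sigma_coset t (delta y) = delta (coset_ltrans t y).
Proof.
apply: contfunP => x.
have -> : subalg_val (sigma_coset t (delta y)) x = (coset_ltrans t^-1%g x == y)%:R by [].
rewrite deltaE; congr (_%:R); congr nat_of_bool; apply/eqP/eqP => [<-|->].
  by rewrite coset_ltransVK.
by rewrite coset_ltransK.
Qed.

End delta.

Variables (A : cstarAlgType R) (alpha : cstar_action G A).

(** The infimum runs over naturals: if no value up to d occurred, d + 1 would be a lower bound. *)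
Lemma dimRokH_exists (H : subgroup G) (d : nat) : (dimRokH alpha H <= (d%:R)%:E)%E ->
  exists2 d' : nat, (d' <= d)%N & forall D : sepInvSubalg alpha,
    exists phi : 'I_d'.+1 -> {linear contfun R (coset_space H) -> Fcs D},
      (forall l, equivariant_ccp_order_zero (@sigma_coset R G H) (phi l)) /\
      is_identity (\sum_l phi l (contfun1 R (coset_space H))).
Proof.
move=> h; apply: contrapT => nh.
have : ((d.+1%:R)%:E <= dimRokH alpha H)%E.
  apply: le_ereal_inf_tmp => _ [d' /= d'P <-]; rewrite lee_fin ler_nat ltnNge.
  by apply/negP => d'd; apply: nh; exists d'.
by move=> /le_trans/(_ h); rewrite lee_fin ler_nat ltnn.
Qed.

Lemma rokhlin_elements (K : subgroup G) (d : nat) (s : seq (coset_space K)) :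
  uniq s -> (forall x, x \in s) -> (dimRokH alpha K <= (d%:R)%:E)%E ->
  forall D : sepInvSubalg alpha, exists b : 'I_d.+1 -> coset_space K -> Fcs D,
  [/\ forall l x, exists z, b l x = star z ** z,
      forall l x y, x != y -> b l x ** b l y = 0,
      forall l t x, Fcs_act (@sis_invariant _ _ _ alpha D) t (b l x) = b l (coset_ltrans t x),
      forall l x, rnorm (b l x) <= 1 &
      is_identity (\sum_l \sum_(x <- s) b l x)].
Proof.
move=> us sP /dimRokH_exists[d' d'd h] D; have [phi [phiP phi1]] := h D.
(* The number of maps provided may be smaller than d + 1; the missing families are filled up with
   0. *)
pose b (l : 'I_d.+1) x : Fcs D := if (l < d'.+1)%N then phi (inord l) (delta x) else 0.
have act0 t : Fcs_act (@sis_invariant _ _ _ alpha D) t 0 = 0.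
  have [_ _ _ e] := phiP ord0; rewrite -[X in Fcs_act _ _ X](linear0 (phi ord0)) -e.
  rewrite (_ : sigma_coset t 0 = 0) ?linear0//.
  by apply: contfunP => x.
exists b; split.
- move=> l x; rewrite /b; case: ifP => _; last by exists 0; rewrite smulr0.
  have [cp _ _ _] := phiP (inord l).
  (* Complete positivity is used for 1 x 1 matrices only, on the projection [delta x], which is its
     own factor. *)
  have [|Y YE] := cp 1%N (const_mx (delta x)).
    exists (const_mx (delta x)); apply/matrixP => i j; rewrite !mxE big_ord1 !mxE.
    by rewrite delta_star delta_mul eqxx.
  exists (Y 0 0); have /matrixP/(_ 0 0) := YE.
  by rewrite !mxE big_ord1.
- move=> l x y xy; rewrite /b; case: ifP => _; last by rewrite smulr0.
  have [_ _ oz _] := phiP (inord l).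
  have [] // := oz (delta x) (delta y).
  by split; rewrite ?delta_star delta_mul ?(negPf xy)// eq_sym (negPf xy).
- move=> l t x; rewrite /b; case: ifP => _; last exact: act0.
  by have [_ _ _ e] := phiP (inord l); rewrite -e sigma_delta.
- move=> l x; rewrite /b; case: ifP => _; last by rewrite rnorm0.
  have [_ co _ _] := phiP (inord l); apply: le_trans (delta_norm x).
  by have := co (delta x); rewrite !rnormE lecR.
- have -> : \sum_l \sum_(x <- s) b l x = \sum_l phi l (contfun1 R (coset_space K)).
    rewrite (delta_sum us sP).
    transitivity (\sum_(l < d.+1 | (l < d'.+1)%N) phi (inord l) (\sum_(x <- s) delta x)).
      rewrite [RHS]big_mkcond; apply: eq_bigr => l _; rewrite /b; case: ifP => _.
        by rewrite linear_sum.
      by rewrite big1.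
    rewrite -(big_ord_widen _ (fun l => phi (inord l) (\sum_(x <- s) delta x)))//.
    by apply: eq_bigr => l _; rewrite inord_val.
  exact: phi1.
Qed.

End rokhlin_elements.

(** * Comparing norms in A, A_oo and F(D, A) *)

Section central_sequence_norms.
Variables (R : realType) (A : cstarAlgType R).

Lemma Ainf_lift (q : Ainf A) : exists x : linf nat A, q = qpi (c0_ideal A) x.
Proof. by exists (qrepr q); rewrite qreprK. Qed.

Lemma const_Ainf_hom : alg_hom (@const_Ainf R A).
Proof.
split=> [x y|a x|x y]; rewrite /const_Ainf.
- by rewrite -qpiD; congr qpi; exact/val_inj.
- by rewrite -qpiZ; congr qpi; exact/val_inj.
- by rewrite -qpiM; congr qpi; exact/val_inj.
Qed.

Lemma rnorm_const (a : A) : rnorm (const_Ainf a) <= rnorm a.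
Proof.
rewrite (le_trans (rnorm_qpi _ _))// rnorm_linf; apply: linf_norm_le => //.
exact: rnorm_ge0.
Qed.

(** Some lift y has norm below e, and x differs from it by a null sequence. *)
Lemma Ainf_lt_eventually (x : linf nat A) (e : R) : rnorm (qpi (c0_ideal A) x) < e ->
  \forall n \near \oo, rnorm (x n) < e.
Proof.
move=> /quot_lift_lt[y /qpiP yx ye].
have {}yx : c0_set (y - x) by [].
have d0 : 0 < e - rnorm y by rewrite subr_gt0.
move: yx => /cvg_rnorm/cvgrPdist_lt/(_ _ d0); apply: filterS => n.
rewrite sub0r normrN subr0 ger0_norm ?rnorm_ge0// => h.
have -> : x n = y n - (y - x) n by rewrite /= opprB addrC subrK.
rewrite (le_lt_trans (rnormD _ _))// rnormN addrC -ltrBrDr.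
apply: lt_le_trans h _; rewrite lerB//; exact: linf_norm_ub.
Qed.

Lemma Ainf_le_eventually (x : linf nat A) (e : R) : 0 <= e ->
  (\forall n \near \oo, rnorm (x n) <= e) -> rnorm (qpi (c0_ideal A) x) <= e.
Proof.
move=> e0 [N _ xN].
pose y' n := if (N <= n)%N then x n else 0.
have y'b : y' \in @bounded_family R nat A.
  apply/bounded_familyP; exists e => n; rewrite /y'; case: ifP => [/xN//|_].
  by rewrite rnorm0.
have -> : qpi (c0_ideal A) x = qpi (c0_ideal A) (Linf y'b).
  apply/qpiP; have : (x - Linf y'b : linf nat A) n @[n --> \oo] --> (0 : A).
    apply: cvg_near_cst; exists N => // n /= Nn.
    by rewrite [LHS](_ : _ = x n - y' n)// /y' Nn subrr.
  by [].
rewrite (le_trans (rnorm_qpi _ _))// rnorm_linf; apply: linf_norm_le => // n /=.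
by rewrite /y'; case: ifP => [/xN//|_]; rewrite rnorm0.
Qed.

Variable D : starSubalg A.
Local Notation cst := (@const_Ainf R A).

Lemma commutantP (x : subalg (commutant D)) a : sa_set D a ->
  subalg_val x ** cst a = cst a ** subalg_val x.
Proof. exact: (subalgP x). Qed.

(** Annihilation on one side suffices, since elements of the commutant commute with D. *)
Lemma Fcs_eqP (x y : subalg (commutant D)) :
  (forall a, sa_set D a -> (subalg_val x - subalg_val y) ** cst a = 0) <->
  qpi (Ann D) x = qpi (Ann D) y.
Proof.
split=> [h|/qpiP h a Da]; last by have [] := h a Da.
apply/qpiP => a Da; have := commutantP (x - y) Da; rewrite /= => <-.
by rewrite h.
Qed.

(** Against an element of D, x may be replaced by any representative of its class, in particular by
    one of nearly minimal norm. This is how norm bounds in F(D, A) reach A_oo. *)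
Lemma rnorm_mul_const (x : subalg (commutant D)) a : sa_set D a ->
  rnorm (subalg_val x ** cst a) <= rnorm (qpi (Ann D) x) * rnorm a.
Proof.
move=> Da; apply/ler_addgt0Pr => e e0; pose M := rnorm a + 1.
have M0 : 0 < M by rewrite ltr_wpDl ?rnorm_ge0.
have : rnorm (qpi (Ann D) x) < rnorm (qpi (Ann D) x) + e / M by rewrite ltrDl divr_gt0.
move=> /quot_lift_lt[y /esym/Fcs_eqP/(_ _ Da) xy ye].
have -> : subalg_val x ** cst a = subalg_val y ** cst a.
  by apply/eqP; rewrite -subr_eq0 -smulBl xy.
rewrite (le_trans (rnormM _ _))// (le_trans (ler_pM _ _ (ltW ye) (rnorm_const a))) ?rnorm_ge0//.
rewrite mulrDl lerD2l -mulrA ler_piMr ?(ltW e0)// ler_pdivrMl// mulr1.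
by rewrite lerDl.
Qed.

Lemma Fcs_lift (q : Fcs D) : exists x, qpi (Ann D) x = q.
Proof. by exists (qrepr q); exact: qreprK. Qed.

Lemma rnorm_Fcs_le (x : subalg (commutant D)) :
  rnorm (qpi (Ann D) x) <= rnorm (subalg_val x).
Proof. exact: rnorm_qpi. Qed.

End central_sequence_norms.

Section action_hom.
Variables (R : realType) (G : groupType) (A : cstarAlgType R) (alpha : cstar_action G A).

Lemma Ainf_act_hom t : alg_hom (Ainf_act alpha t).
Proof.
split=> [x y|a x|]; last exact: Ainf_actM.
  have [[x' ->] [y' ->]] := (Ainf_lift x, Ainf_lift y).
  rewrite -qpiD !Ainf_actE -qpiD; congr qpi; apply/val_inj/funext => n /=.
  exact: linearD.
have [x' ->] := Ainf_lift x; rewrite -qpiZ !Ainf_actE -qpiZ; congr qpi.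
by apply/val_inj/funext => n /=; exact: linearZ.
Qed.

Variables (D : starSubalg A) (Dinv : act_invariant alpha D).

Lemma Fcs_act_hom t : alg_hom (Fcs_act Dinv t).
Proof.
have [aD aZ aM] := Ainf_act_hom t.
split=> [x y|a x|x y].
- have [[x' <-] [y' <-]] := (Fcs_lift x, Fcs_lift y).
  by rewrite -qpiD !Fcs_actE -qpiD; congr qpi; apply: val_inj; exact: aD.
- have [x' <-] := Fcs_lift x.
  by rewrite -qpiZ !Fcs_actE -qpiZ; congr qpi; apply: val_inj; exact: aZ.
- have [[x' <-] [y' <-]] := (Fcs_lift x, Fcs_lift y).
  by rewrite -qpiM !Fcs_actE -qpiM; congr qpi; apply: val_inj; exact: aM.
Qed.

End action_hom.

Section square_roots.
Variables (R : realType) (G : groupType) (A : cstarAlgType R) (alpha : cstar_action G A).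

Lemma rnormr (V : normedModType R[i]) (r : R) (x : V) : 0 <= r -> rnorm (r *r x) = r * rnorm x.
Proof. by move=> r0; rewrite rnormZ Re_normC ger0_norm. Qed.

Lemma tau_small (C e : R) : 0 <= C -> 0 < e -> exists k, C * (1 - tau R k) <= e.
Proof.
move=> C0 e0; have C1 : 0 < C + 1 by rewrite ltr_wpDl.
have /cvgrPdist_lt/(_ _ (divr_gt0 e0 C1))[k _ /(_ k (leqnn k))] := @tau_cvg R.
rewrite sub0r normrN => /(le_lt_trans (ler_norm _))/ltW; rewrite ler_pdivlMr// => h.
exists k; apply: le_trans h; rewrite mulrC ler_wpM2l ?lerDl//.
by rewrite subr_ge0; case/andP: (tau_bounds R k).
Qed.

(** Without the C*-identity in F(D, A), |z^* z| <= 1 does not bound |z|. Hence all factors are first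
    scaled by a common M exceeding their norms, and k is chosen afterwards, depending on M.
    Orthogonality and equivariance remain exact because the roots are polynomials without constant
    term. *)
Lemma rokhlin_roots (K : subgroup G) (d : nat) (s : seq (coset_space K)) (e : R) :
  uniq s -> (forall x, x \in s) -> (dimRokH alpha K <= (d%:R)%:E)%E -> 0 < e ->
  forall D : sepInvSubalg alpha, exists r : 'I_d.+1 -> coset_space K -> Fcs D,
  [/\ forall l x, star (r l x) = r l x,
      forall l x y, x != y -> r l x ** r l y = 0,
      forall l t x, Fcs_act (@sis_invariant _ _ _ alpha D) t (r l x) = r l (coset_ltrans t x),
      forall l x, rnorm (r l x ** r l x) <= 1 + e &
      exists2 i : Fcs D, is_identity i & rnorm (\sum_l \sum_(x <- s) r l x ** r l x - i) <= e].
Proof.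
move=> us sP hd e0 D.
have [b [bz bo bt b1 bi]] := rokhlin_elements us sP hd D.
have /choice[Z bZ] l : exists z : coset_space K -> Fcs D, forall x, b l x = star (z x) ** z x.
  by have /choice[z zP] := bz l; exists z.
pose M := 1 + \sum_l \sum_(x <- s) rnorm (Z l x).
have M1 : 1 <= M by rewrite lerDl; do 2! apply: sumr_ge0 => ? _; exact: rnorm_ge0.
have M0 : 0 < M by rewrite (lt_le_trans _ M1).
have ZM l x : rnorm (Z l x) < M.
  rewrite /M (bigD1 l)//= (bigD1_seq x)//= -!addrA.
  set S1 := \sum_(_ <- s | _) _; set S2 := \sum_(_ | _) _.
  have S10 : 0 <= S1 by apply: sumr_ge0 => ? _; exact: rnorm_ge0.
  have S20 : 0 <= S2 by do 2! apply: sumr_ge0 => ? _; exact: rnorm_ge0.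
  lra.
(* Bounds the number of terms in the double sum; the successor of the size keeps it at least 1 when
   s is empty. *)
pose C : R := (d.+1 * (size s).+1)%:R.
have C1 : 1 <= C by rewrite ler1n muln_gt0.
have [k hk] := @tau_small (C * (M ^+ 2 * 6)) e (mulr_ge0 (le_trans ler01 C1) (mulr_ge0 (sqr_ge0 M) (ler0n _ 6))) e0.
pose x' l x := M^-1 ^+ 2 *r b l x.
pose r l x := M *r sqit (x' l x) k.
have i0 : 0 <= M^-1 by rewrite invr_ge0 ltW.
have sr l x : star (r l x) = r l x.
  rewrite /r /rscal starZ conjC_real sqit_star// /x' /rscal starZ conjC_real.
  by rewrite bZ starM starK.
have rb l x : rnorm (r l x ** r l x - b l x) <= M ^+ 2 * 6 * (1 - tau R k).
  pose z := M^-1 *r Z l x.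
  have z1 : rnorm z < 1 by rewrite rnormr// mulrC ltr_pdivrMr// mul1r.
  have zz : star z ** z = x' l x.
    rewrite /z /x' /rscal starZ conjC_real smulZl smulZr scalerA -bZ.
    by rewrite -rmorphM -expr2.
  have := Fcs_sqrt_approx k z1; rewrite zz => h.
  have -> : r l x ** r l x - b l x =
      M ^+ 2 *r (sqit (x' l x) k ** sqit (x' l x) k - x' l x).
    rewrite rscalBr /x' rscalA -exprMn mulfV ?gt_eqF// expr1n rscal1; congr (_ - _).
    by rewrite /r /rscal smulZl smulZr scalerA -rmorphM -expr2.
  by rewrite rnormr ?sqr_ge0// -mulrA ler_wpM2l ?sqr_ge0.
have small : M ^+ 2 * 6 * (1 - tau R k) <= e.
  apply: le_trans hk; rewrite -!mulrA ler_peMl// !mulr_ge0 ?(ltW M0)//.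
  by rewrite subr_ge0; case/andP: (tau_bounds R k).
exists r; split=> //.
- move=> l x y xy; rewrite /r /rscal smulZl smulZr sqit_orthl ?scaler0//.
  by apply: sqit_orthr; rewrite /x' /rscal smulZl smulZr bo// !scaler0.
- move=> l t x; have h := Fcs_act_hom (@sis_invariant _ _ _ alpha D) t.
  have [_ hZ _] := h.
  by rewrite /r /rscal hZ (alg_hom_sqit _ _ h) /x' /rscal hZ bt.
- move=> l x; rewrite -[r l x ** _](subrK (b l x)) addrC (le_trans (rnormD _ _))//.
  by rewrite lerD// (le_trans (rb l x)).
- exists (\sum_l \sum_(x <- s) b l x) => //; rewrite -sumrB.
  under eq_bigr do rewrite -sumrB.
  have t0 : 0 <= M ^+ 2 * 6 * (1 - tau R k).
    rewrite !mulr_ge0 ?(ltW M0)//.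
    by rewrite subr_ge0; case/andP: (tau_bounds R k).
  apply: le_trans hk; rewrite -mulrA /C natrM -!mulrA.
  rewrite -[d.+1 in leRHS]card_ord cardE (le_trans (rnorm_sum _ (M := (size s)%:R * (M ^+ 2 * 6 * (1 - tau R k))) _ _))//.
  + by rewrite mulr_ge0.
  + by move=> l _; apply: rnorm_sum => // x _; exact: rb.
  rewrite -!mulrA /index_enum -enumT ler_wpM2l// ler_wpM2r ?ler_nat//.
  by rewrite !mulrA.
Qed.

End square_roots.

(** * Separability of D and local units *)

Section local_units.
Variables (R : realType) (G : groupType) (A : cstarAlgType R) (alpha : cstar_action G A).
Variable D : sepInvSubalg alpha.
Local Notation cst := (@const_Ainf R A).

Lemma dense_sequence : exists f : nat -> A, (forall n, sa_set D (f n)) /\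
  forall a e, sa_set D a -> 0 < e -> exists n, rnorm (a - f n) <= e.
Proof.
have [E /countable_injP[i i_inj] [ED DE]] := sis_separable D.
(* Decodes the injection i of E into the naturals; indices that are not hit give 0, which lies in
   D. *)
pose f n := xget 0 [set x | E x /\ i x = n].
exists f; split=> [n|a e Da e0].
  by rewrite /f; case: xgetP => [x _ [/ED Dx _]//|_]; exact: sa0.
have ec0 : 0 < ((e%:C)%C : R[i]) by rewrite ltcR.
have [y [Ey]] := DE _ Da _ (nbhsx_ballx a _ ec0).
rewrite -ball_normE/= rnormE ltcR => /ltW ay; exists (i y).
rewrite (_ : f (i y) = y)//.
have [Ez iz] : [set x | E x /\ i x = i y] (f (i y)) by apply: (@xgetPex _ 0); exists y.
by apply: i_inj; rewrite ?inE.
Qed.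

Lemma Ainf_eq0 (x : linf nat A) :
  (forall e, 0 < e -> \forall n \near \oo, rnorm (x n) <= e) -> qpi (c0_ideal A) x = 0.
Proof.
move=> h; apply: rnorm0_eq0; apply/eqP; rewrite eq_le rnorm_ge0 andbT.
apply/ler_addgt0Pr => e e0; rewrite add0r; apply: Ainf_le_eventually; first exact: ltW.
exact: h.
Qed.

Lemma mul_sub_le (u a b : A) (e : R) : rnorm u <= 1 -> rnorm (a - b) <= e ->
  rnorm (u ** a - a) <= e + e + rnorm (u ** b - b).
Proof.
move=> u1 ab; have -> : u ** a - a = u ** (a - b) - (a - b) + (u ** b - b).
  by rewrite smulBr opprB !addrA [RHS](ACl (1*4*(2*5)*(3*6)))/= addNr subrr !addr0.
rewrite (le_trans (rnormD _ _))// lerD2r (le_trans (rnormD _ _))// rnormN lerD//.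
rewrite (le_trans (rnormM _ _))// -[leRHS]mul1r ler_pM ?rnorm_ge0//.
Qed.

(** The n-th term of p is an approximate unit for the first n elements of a dense sequence, with
    error 1 / (n + 1); density and |u_n| <= 1 extend the convergence to all of D. *)
Lemma local_unit : exists2 p : Ainf A, sa_set (commutant D) p &
  forall a, sa_set D a -> p ** cst a = cst a.
Proof.
have [f [fD f_dense]] := dense_sequence.
have /choice[u uP] n : exists u, [/\ sa_set D u, star u = u, rnorm u <= 1,
    forall x, x \in [seq f k | k <- iota 0 n] -> rnorm (u ** x - x) <= n.+1%:R^-1 &
    forall x, x \in [seq f k | k <- iota 0 n] -> rnorm (x ** u - x) <= n.+1%:R^-1].
  apply: approximate_unit; last by rewrite invr_gt0.
  by move=> _ /mapP[k _ ->].
have ub : u \in @bounded_family R nat A.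
  by apply/bounded_familyP; exists 1 => n; have [] := uP n.
have left a : sa_set D a -> forall e, 0 < e -> \forall n \near \oo, rnorm (u n ** a - a) <= e.
  move=> Da e e0; have e40 : 0 < e / 4 by rewrite divr_gt0.
  have [k ak] := f_dense a _ Da e40.
  exists (maxn k.+1 (Num.truncn (2 / e)).+1) => // n /=; rewrite geq_max => /andP[kn en].
  have [_ _ u1 ul _] := uP n.
  have := ul (f k); rewrite map_f ?mem_iota//= => /(_ isT) h.
  apply: le_trans (mul_sub_le u1 ak) _.
  have h2 : n.+1%:R^-1 <= e / 2.
    rewrite -[e / 2]invrK lef_pV2 ?posrE ?invr_gt0 ?divr_gt0// invf_div.
    by rewrite (le_trans (ltW (truncnS_gt _)))// ler_nat leqW.
  by apply: le_trans (lerD (lexx _) (le_trans h h2)) _; lra.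
have right a : sa_set D a -> forall e, 0 < e -> \forall n \near \oo, rnorm (a ** u n - a) <= e.
  move=> Da e e0; apply: filterS (left _ (saS Da) e e0) => n.
  have [_ su _ _ _] := uP n.
  by rewrite -rnorm_star starD starN starM starK su.
pose p : Ainf A := qpi (c0_ideal A) (Linf ub).
have pl a : sa_set D a -> p ** cst a = cst a.
  move=> Da; apply/eqP; rewrite -subr_eq0 /p /const_Ainf -qpiM -qpiB; apply/eqP.
  by apply: Ainf_eq0; exact: left.
have pr a : sa_set D a -> cst a ** p = cst a.
  move=> Da; apply/eqP; rewrite -subr_eq0 /p /const_Ainf -qpiM -qpiB; apply/eqP.
  by apply: Ainf_eq0; exact: right.
by exists p => // a Da; rewrite pl// pr.
Qed.

(* F(D, A) being unital does not by itself say that representatives of its unit act as the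
   identity on D; this uses that D has an approximate unit. *)
Lemma identity_acts (w : subalg (commutant D)) : is_identity (qpi (Ann D) w) ->
  forall a, sa_set D a -> subalg_val w ** cst a = cst a.
Proof.
have [p pD pa] := local_unit; move=> w1 a Da.
have [/esym e _] := w1 (qpi (Ann D) (mk_subalg pD)).
rewrite -qpiM in e; have /Fcs_eqP/(_ _ Da)/= := e.
rewrite smulBl -smulA pa// => /eqP; rewrite subr_eq0 => /eqP; exact: esym.
Qed.

End local_units.

(** * From F(D, A) back to A *)

Section stage.
Variables (R : realType) (G : groupType) (A : cstarAlgType R) (alpha : cstar_action G A).
Local Notation cst := (@const_Ainf R A).

Lemma sqr_unit_le (u a : A) (e : R) : rnorm u <= 1 -> rnorm (u ** a - a) <= e ->
  rnorm (u ** u ** a - a) <= e + e.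
Proof.
move=> u1 h; have -> : u ** u ** a - a = u ** (u ** a - a) + (u ** a - a).
  by rewrite smulBr smulA addrA subrK.
rewrite (le_trans (rnormD _ _))// lerD// (le_trans (rnormM _ _))//.
by rewrite -[leRHS]mul1r ler_pM ?rnorm_ge0.
Qed.

(** Relations of F(D, A) hold in A_oo only against elements of D. Multiplying the representatives v
    by some u in D therefore makes self-adjointness and orthogonality exact, and bounds the norms of
    the squares by those in F(D, A). The representatives are chosen before u, so its error can be
    divided by the bound B on their norms. *)
Lemma rokhlin_stage_Ainf (K : subgroup G) (d : nat) (s : seq (coset_space K))
    (E : seq A) (ts : seq G) (e : R) :
  uniq s -> (forall x, x \in s) -> (dimRokH alpha K <= (d%:R)%:E)%E -> 0 < e ->
  forall D : sepInvSubalg alpha, (forall a, a \in E -> sa_set D a) ->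
  exists r : 'I_d.+1 -> coset_space K -> Ainf A,
  [/\ [/\ forall l x, star (r l x) = r l x,
      forall l x, rnorm (r l x ** r l x) <= 1 + e &
      forall l x y, x != y -> r l x ** r l y = 0],
      forall l x a, a \in E -> rnorm (r l x ** cst a - cst a ** r l x) <= e,
      forall l t x a, t \in ts -> a \in E ->
        rnorm ((Ainf_act alpha t (r l x ** r l x)
          - r l (coset_ltrans t x) ** r l (coset_ltrans t x)) ** cst a) <= e &
      forall a, a \in E ->
        rnorm ((\sum_l \sum_(x <- s) r l x ** r l x) ** cst a - cst a) <= e].
Proof.
move=> us sP hd e0 D ED.
pose BE := 1 + \sum_(a <- E) rnorm a.
have BE1 : 1 <= BE by rewrite lerDl; apply: sumr_ge0 => ? _; exact: rnorm_ge0.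
have BE0 : 0 < BE by rewrite (lt_le_trans _ BE1).
have BEa a : a \in E -> rnorm a <= BE.
  move=> aE; rewrite /BE (big_rem a)//= addrCA lerDl addr_ge0//.
  by apply: sumr_ge0 => ? _; exact: rnorm_ge0.
pose e1 := e / 2 / BE.
have e10 : 0 < e1 by rewrite !divr_gt0.
have e1e : e1 <= e.
  by rewrite /e1 ler_pdivrMr//; nra.
have [r [sr ro rt r1 [i i1 ri]]] := rokhlin_roots us sP hd e10 D.
pose sg l x : subalg (commutant D) := qrepr (r l x).
have sgE l x : qpi (Ann D) (sg l x) = r l x by exact: qreprK.
pose v l x := subalg_val (sg l x).
pose B := 1 + \sum_l \sum_(x <- s) (rnorm (v l x) + rnorm (v l x ** v l x)).
have B1 : 1 <= B.
  by rewrite lerDl; do 2! apply: sumr_ge0 => ? _; rewrite addr_ge0 ?rnorm_ge0.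
have B0 : 0 < B by rewrite (lt_le_trans _ B1).
have vB l x : rnorm (v l x) <= B /\ rnorm (v l x ** v l x) <= B.
  rewrite /B (bigD1 l)//= (bigD1_seq x)//= -!addrA.
  set S1 := \sum_(_ <- s | _) _; set S2 := \sum_(_ | _) _.
  have S10 : 0 <= S1 by apply: sumr_ge0 => ? _; rewrite addr_ge0 ?rnorm_ge0.
  have S20 : 0 <= S2 by do 2! apply: sumr_ge0 => ? _; rewrite addr_ge0 ?rnorm_ge0.
  have := rnorm_ge0 (v l x); have := rnorm_ge0 (v l x ** v l x); lra.
(* The translates serve equivariance: alpha_t(u^2) a - a is the image under alpha_t of u^2 a' - a',
   where a' is the translate of a by t^-1. *)
pose E' := E ++ [seq alpha t^-1%g a | t <- ts, a <- E].
have E'D a : a \in E' -> sa_set D a.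
  rewrite mem_cat => /orP[/ED//|/allpairsP[[t b] [_ /= bE ->]]].
  exact/sis_invariant/ED.
(* The largest error to come is B * (4 * dl) = e / 2, in the equivariance estimate. *)
pose dl := e / 8 / B.
have dl0 : 0 < dl by rewrite !divr_gt0.
have Bdl : B * dl = e / 8 by rewrite /dl mulrC divfK ?gt_eqF.
have dle : dl <= e / 8 by rewrite -Bdl ler_peMl// ltW.
have [u [Du su u1 ul ur]] := approximate_unit E'D dl0.
have [_ _ cM] := const_Ainf_hom A.
have cB := alg_homB (const_Ainf_hom A).
have vc l x a : sa_set D a -> v l x ** cst a = cst a ** v l x by move=> Da; exact: commutantP.
have Duu : sa_set D (u ** u) by exact: saM.
have uu1 : rnorm (u ** u) <= 1.
  by rewrite (le_trans (rnormM _ _))// -[leRHS]mul1r ler_pM ?rnorm_ge0.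
pose q l x := v l x ** cst u.
have qq l x y : q l x ** q l y = v l x ** v l y ** cst (u ** u).
  by rewrite /q -smulA (smulA (cst u)) -(vc l y u Du) cM !smulA.
have vo l x y a : x != y -> sa_set D a -> v l x ** v l y ** cst a = 0.
  move=> xy Da; have h : qpi (Ann D) (sg l x ** sg l y) = qpi (Ann D) 0.
    by rewrite qpiM !sgE ro//; exact/esym/(alg_hom0 (qpi_hom (Ann D))).
  by have /Fcs_eqP/(_ _ Da) := h; rewrite /= subr0.
exists q; split; first split.
- move=> l x; rewrite /q starM -const_Ainf_star su.
  have h : qpi (Ann D) (star (sg l x)) = qpi (Ann D) (sg l x) by rewrite qpiS !sgE sr.
  rewrite -(commutantP (star (sg l x)) Du) /=.
  by have /Fcs_eqP/(_ _ Du)/= := h; rewrite smulBl => /eqP; rewrite subr_eq0 => /eqP.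
- move=> l x; rewrite qq.
  apply: le_trans (rnorm_mul_const (sg l x ** sg l x) Duu) _.
  rewrite qpiM !sgE -[leRHS]mulr1 ler_pM ?rnorm_ge0//.
  by rewrite (le_trans (r1 l x))// lerD2l.
- by move=> l x y xy; rewrite qq vo.
- move=> l x a aE; have Da := ED _ aE.
  have -> : q l x ** cst a - cst a ** q l x = v l x ** cst (u ** a - a - (a ** u - a)).
    rewrite /q smulA -(vc _ _ _ Da) -!smulA -smulBr -!cM -cB; congr (_ ** cst _).
    by rewrite opprB addrA subrK.
  rewrite (le_trans (rnormM _ _))// (le_trans (ler_pM _ _ (proj1 (vB l x)) (rnorm_const _))) ?rnorm_ge0//.
  have h1 : rnorm (u ** a - a) <= dl by apply: ul; rewrite mem_cat aE.
  have h2 : rnorm (a ** u - a) <= dl by apply: ur; rewrite mem_cat aE.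
  rewrite (le_trans (ler_wpM2l (ltW B0) (rnormD _ _)))// rnormN.
  rewrite (le_trans (ler_wpM2l (ltW B0) (lerD h1 h2)))// mulrDr Bdl; lra.
- move=> l t x a tt aE; have Da := ED _ aE.
  rewrite !qq; set y := coset_ltrans t x.
  have [_ _ aM] := Ainf_act_hom alpha t.
  rewrite aM Ainf_act_const.
  pose b := alpha t (u ** u) ** a.
  have Db : sa_set D b by apply: saM => //; exact: sis_invariant.
  have -> : (Ainf_act alpha t (v l x ** v l x) ** cst (alpha t (u ** u))
      - v l y ** v l y ** cst (u ** u)) ** cst a = v l y ** v l y ** cst (b - u ** u ** a).
    have h : qpi (Ann D) (Defs.sub_map (@Ainf_act_commutant _ _ _ alpha D (@sis_invariant _ _ _ alpha D) t)
        (sg l x ** sg l x)) = qpi (Ann D) (sg l y ** sg l y).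
      rewrite -Fcs_actE !qpiM !sgE.
      have [_ _ fM] := Fcs_act_hom (@sis_invariant _ _ _ alpha D) t.
      by rewrite fM rt.
    have /Fcs_eqP/(_ _ Db)/= := h; rewrite smulBl => /eqP; rewrite subr_eq0 => /eqP hb.
    by rewrite cB smulBr -hb smulBl /b !cM !smulA.
  rewrite (le_trans (rnormM _ _))// (le_trans (ler_pM _ _ (proj2 (vB l y)) (rnorm_const _))) ?rnorm_ge0//.
  have h1 : rnorm (u ** u ** a - a) <= dl + dl.
    by apply: sqr_unit_le => //; apply: ul; rewrite mem_cat aE.
  have h2 : rnorm (b - a) <= dl + dl.
    pose a' := alpha t^-1%g a.
    have aE' : a = alpha t a' by rewrite /a' -cactMg mulgV cact1.
    have -> : b - a = alpha t (u ** u ** a' - a') by rewrite linearB cactM -aE'.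
    apply: le_trans (star_hom_rnorm (cactM alpha t) (cactS alpha t) _) _.
    apply: sqr_unit_le => //; apply: ul; rewrite mem_cat; apply/orP; right.
    by apply/allpairsP; exists (t, a).
  have h3 : rnorm (b - u ** u ** a) <= 4 * dl.
    have -> : b - u ** u ** a = (b - a) - (u ** u ** a - a) by rewrite opprB addrA subrK.
    by rewrite (le_trans (rnormD _ _))// rnormN; lra.
  rewrite (le_trans (ler_wpM2l (ltW B0) h3))// mulrCA Bdl; lra.
- move=> a aE; have Da := ED _ aE.
  have [w wi] := Fcs_lift i; rewrite -wi in i1 ri.
  have wa := identity_acts i1.
  pose W : subalg (commutant D) := \sum_l \sum_(x <- s) sg l x ** sg l x.
  have WE : \sum_l \sum_(x <- s) q l x ** q l x = subalg_val W ** cst (u ** u).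
    have vs I (t : seq I) (F : I -> subalg (commutant D)) :
        subalg_val (\sum_(z <- t) F z) = \sum_(z <- t) subalg_val (F z).
      exact: (big_morph (@subalg_val _ _ (commutant D))).
    rewrite /W vs smul_suml; apply: eq_bigr => l _.
    by rewrite vs smul_suml; apply: eq_bigr => x _; rewrite qq.
  have Wi : rnorm (qpi (Ann D) (W - w)) <= e1.
    have qs I (t : seq I) (F : I -> subalg (commutant D)) :
        qpi (Ann D) (\sum_(z <- t) F z) = \sum_(z <- t) qpi (Ann D) (F z).
      by apply: (big_morph (qpi (Ann D))); [exact: qpiD|exact: alg_hom0 (qpi_hom _)].
    rewrite qpiB /W qs; under eq_bigr do rewrite qs.
    by under eq_bigr do under eq_bigr do rewrite qpiM sgE.
  have Duua : sa_set D (u ** u ** a) by exact: saM.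
  have -> : (\sum_l \sum_(x <- s) q l x ** q l x) ** cst a - cst a =
      subalg_val (W - w) ** cst (u ** u ** a) + cst (u ** u ** a - a).
    by rewrite WE /= smulBl wa// cB -smulA -cM addrA subrK.
  rewrite (le_trans (rnormD _ _))// [e]splitr lerD//.
    rewrite (le_trans (rnorm_mul_const _ Duua))//.
    rewrite (le_trans (ler_pM _ _ Wi (_ : _ <= BE))) ?rnorm_ge0//.
      rewrite (le_trans (rnormM _ _))// -[leRHS]mul1r ler_pM ?rnorm_ge0// BEa//.
    by rewrite /e1 divfK// gt_eqF.
  rewrite (le_trans (rnorm_const _))//.
  have h1 : rnorm (u ** u ** a - a) <= dl + dl.
    by apply: sqr_unit_le => //; apply: ul; rewrite mem_cat aE.
  lra.
Qed.

End stage.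

Section stage_in_A.
Variables (R : realType) (G : groupType) (A : cstarAlgType R) (alpha : cstar_action G A).

Lemma near_seq (I : eqType) (s : seq I) (P : I -> nat -> Prop) :
  (forall i, i \in s -> \forall n \near \oo, P i n) ->
  \forall n \near \oo, forall i, i \in s -> P i n.
Proof.
elim: s => [|i s ih] h; first exact: nearW.
have h1 := h i (mem_head _ _).
have h2 : \forall n \near \oo, forall i, i \in s -> P i n.
  by apply: ih => j js; apply: h; rewrite inE js orbT.
apply: filterS2 h1 h2 => n p1 p2 j; rewrite inE => /predU1P[->//|]; exact: p2.
Qed.

Lemma linf_sum_val (I : Type) (s : seq I) (F : I -> linf nat A) n :
  (\sum_(i <- s) F i : linf nat A) n = \sum_(i <- s) F i n.
Proof. exact: (big_morph (fun f : linf nat A => f n)). Qed.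

Lemma qpi_sum (B : normedStarAlgType R) (J : starIdeal B) (I : Type) (s : seq I) (F : I -> B) :
  qpi J (\sum_(i <- s) F i) = \sum_(i <- s) qpi J (F i).
Proof. by apply: (big_morph (qpi J)); [exact: qpiD|exact: alg_hom0 (qpi_hom _)]. Qed.

(** Averaging any lift with its adjoint keeps the class and makes every term self-adjoint. *)
Lemma Ainf_star_lift (q : Ainf A) : star q = q ->
  exists2 x : linf nat A, qpi (c0_ideal A) x = q & forall n, star (x n) = x n.
Proof.
have [y ->] := Ainf_lift q; rewrite -qpiS => sy.
exists (2^-1 *r (y + star y)) => [|n].
  by rewrite /rscal qpiZ qpiD sy; exact: half_double.
have -> : (2^-1 *r (y + star y) : linf nat A) n = 2^-1 *r (y n + star (y n)) by [].
by rewrite /rscal starZ conjC_real starD starK addrC.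
Qed.

(** Only finitely many estimates are involved. Each holds eventually along lifted sequences with e /
    2 to spare, so one late index serves them all. *)
Lemma rokhlin_stage (K : subgroup G) (d : nat) (s : seq (coset_space K))
    (E : seq A) (ts : seq G) (e : R) :
  uniq s -> (forall x, x \in s) -> (dimRokH alpha K <= (d%:R)%:E)%E -> 0 < e ->
  forall D : sepInvSubalg alpha, (forall a, a \in E -> sa_set D a) ->
  exists r : 'I_d.+1 -> coset_space K -> A,
  [/\ [/\ forall l x, star (r l x) = r l x,
      forall l x, rnorm (r l x ** r l x) <= 1 + e &
      forall l x y, x != y -> rnorm (r l x ** r l y) <= e],
      forall l x a, a \in E -> rnorm (r l x ** a - a ** r l x) <= e,
      forall l t x a, t \in ts -> a \in E ->
        rnorm ((alpha t (r l x ** r l x)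
          - r l (coset_ltrans t x) ** r l (coset_ltrans t x)) ** a) <= e &
      forall a, a \in E -> rnorm ((\sum_l \sum_(x <- s) r l x ** r l x) ** a - a) <= e].
Proof.
move=> us sP hd e0 D ED; have e20 : 0 < e / 2 by rewrite divr_gt0.
have [q [[sq q1 qo] qc qt qi]] := rokhlin_stage_Ainf ts us sP hd e20 ED.
have /choice[X XP] l : exists X : coset_space K -> linf nat A, forall x,
    qpi (c0_ideal A) (X x) = q l x /\ forall n, star (X x n) = X x n.
  have /choice[X XP] x : exists X : linf nat A, qpi (c0_ideal A) X = q l x /\
      forall n, star (X n) = X n.
    by have [X ? ?] := Ainf_star_lift (sq l x); exists X.
  by exists X.
have Xq l x : qpi (c0_ideal A) (X l x) = q l x by have [] := XP l x.
have lt_ev (w : linf nat A) c : rnorm (qpi (c0_ideal A) w) <= c ->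
    \forall n \near \oo, rnorm (w n) <= c + e / 2.
  move=> wc; have : rnorm (qpi (c0_ideal A) w) < c + e / 2.
    by rewrite (le_lt_trans wc)// ltrDl.
  by move=> /Ainf_lt_eventually; apply: filterS => n /ltW.
have all_l (P : 'I_d.+1 -> nat -> Prop) : (forall l, \forall n \near \oo, P l n) ->
    \forall n \near \oo, forall l, P l n.
  move=> h; have := @near_seq _ (enum 'I_d.+1) P (fun l _ => h l).
  by apply: filterS => n hn l; apply: hn; rewrite mem_enum.
have all_x (P : coset_space K -> nat -> Prop) : (forall x, \forall n \near \oo, P x n) ->
    \forall n \near \oo, forall x, P x n.
  by move=> h; have := @near_seq _ s P (fun x _ => h x); apply: filterS => n hn x; exact: hn.
have e2 : e / 2 + e / 2 = e by rewrite -splitr.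
have n1 : \forall n \near \oo, forall l x, rnorm (X l x n ** X l x n) <= 1 + e.
  apply: (all_l) => l; apply: (all_x) => x; rewrite -e2 addrA.
  by apply: (lt_ev (X l x ** X l x)) => //; rewrite qpiM Xq.
have n2 : \forall n \near \oo, forall l x y, x != y -> rnorm (X l x n ** X l y n) <= e.
  apply: (all_l) => l; apply: (all_x) => x; apply: (all_x) => y.
  have [->|xy] := eqVneq x y; first exact: nearW.
  have : rnorm (qpi (c0_ideal A) (X l x ** X l y)) <= e / 2.
    by rewrite qpiM !Xq qo// rnorm0 ltW.
  by move=> /lt_ev; apply: filterS => n; rewrite e2.
have n3 : \forall n \near \oo, forall l x a, a \in E ->
    rnorm (X l x n ** a - a ** X l x n) <= e.
  apply: (all_l) => l; apply: (all_x) => x; apply: near_seq => a aE.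
  have := qc l x a aE; rewrite -Xq /const_Ainf -!qpiM -qpiB => /lt_ev.
  by apply: filterS => n; rewrite e2.
have n4 : \forall n \near \oo, forall l t x a, t \in ts -> a \in E ->
    rnorm ((alpha t (X l x n ** X l x n)
          - X l (coset_ltrans t x) n ** X l (coset_ltrans t x) n) ** a) <= e.
  have : \forall n \near \oo, forall l x t, t \in ts -> forall a, a \in E ->
    rnorm ((alpha t (X l x n ** X l x n)
          - X l (coset_ltrans t x) n ** X l (coset_ltrans t x) n) ** a) <= e.
    apply: (all_l) => l; apply: (all_x) => x; apply: near_seq => t tt.
    apply: near_seq => a aE.
    have := qt l t x a tt aE.
    rewrite -!Xq /const_Ainf -!qpiM Ainf_actE -qpiB -qpiM => /lt_ev.
    by apply: filterS => n; rewrite e2.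
  by apply: filterS => n hn l t x a tt; exact: hn.
have n5 : \forall n \near \oo, forall a, a \in E ->
    rnorm ((\sum_l \sum_(x <- s) X l x n ** X l x n) ** a - a) <= e.
  apply: near_seq => a aE; have := qi a aE.
  have -> : \sum_l \sum_(x <- s) q l x ** q l x =
      qpi (c0_ideal A) (\sum_l \sum_(x <- s) X l x ** X l x).
    rewrite qpi_sum; apply: eq_bigr => l _; rewrite qpi_sum; apply: eq_bigr => x _.
    by rewrite qpiM Xq.
  rewrite /const_Ainf -qpiM -qpiB => /lt_ev; apply: filterS => n; rewrite e2.
  have -> : (\sum_l \sum_(x <- s) X l x n ** X l x n) =
      (\sum_l \sum_(x <- s) X l x ** X l x : linf nat A) n.
    by rewrite linf_sum_val; apply: eq_bigr => l _; rewrite linf_sum_val.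
  by [].
have [N _ hN] := filterI n1 (filterI n2 (filterI n3 (filterI n4 n5))).
have [h1 [h2 [h3 [h4 h5]]]] := hN N (leqnn N).
exists (fun l x => X l x N); split=> //; split=> // l x.
by have [_] := XP l x; apply.
Qed.

End stage_in_A.

Section stage_sums.
Variables (R : realType) (G : groupType) (A : cstarAlgType R) (alpha : cstar_action G A).
Local Notation nm a := (complex.Re `|a|).

Lemma rnormZ_le (V : normedModType R[i]) (a : R[i]) (v : V) (M c : R) :
  nm a <= M -> rnorm v <= c -> rnorm (a *: v) <= M * c.
Proof. by move=> aM vc; rewrite rnormZ ler_pM ?Re_norm_ge0 ?rnorm_ge0. Qed.

Lemma nmM_le (a b : R[i]) (M N : R) : nm a <= M -> nm b <= N -> nm (a * b) <= M * N.
Proof. exact: (@rnormZ_le R[i]^o). Qed.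

Lemma almost_orthogonal_sum_scaled (N : nat) (e : R) : 0 < e ->
  exists2 g : R, 0 < g & forall (C : eqType) (s : seq C) (y : C -> A),
    uniq s -> (size s <= N)%N -> (forall c, star (y c) = y c) ->
    (forall c, rnorm (y c) <= 1 + g) ->
    (forall c c', c != c' -> rnorm (y c ** y c') <= g) ->
    forall (f : C -> R[i]) M, 0 < M -> (forall c, nm (f c) <= M) ->
    rnorm (\sum_(c <- s) f c *: y c) <= M * (1 + e).
Proof.
move=> /(almost_orthogonal_sum N)[g g0 h]; exists g => // C s y us sN sy y1 yy f M M0 fM.
have := h A C s y us sN sy y1 yy (fun c => ((M^-1)%:C)%C * f c).
have -> : \sum_(c <- s) (((M^-1)%:C)%C * f c) *: y c = M^-1 *r \sum_(c <- s) f c *: y c.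
  by rewrite /rscal scaler_sumr; apply: eq_bigr => c _; rewrite scalerA.
rewrite rnormr ?invr_ge0 ?(ltW M0)// mulrC ler_pdivrMr// [leRHS]mulrC; apply => c.
rewrite (le_trans (nmM_le (lexx _) (fM c)))// Re_normC ger0_norm ?invr_ge0 ?(ltW M0)//.
by rewrite mulVf// gt_eqF.
Qed.

(** The elements of a stage are fixed before any function on the profinite completion is given, so
    the estimates must hold for all coefficients at once, scaling with their bounds only. *)
Lemma rokhlin_stage_sums (K : subgroup G) (d : nat) (s : seq (coset_space K))
    (E : seq A) (ts : seq G) (e : R) :
  uniq s -> (forall x, x \in s) -> (dimRokH alpha K <= (d%:R)%:E)%E -> 0 < e ->
  forall D : sepInvSubalg alpha, (forall a, a \in E -> sa_set D a) ->
  exists r : 'I_d.+1 -> coset_space K -> A,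
  [/\ forall l x, star (r l x) = r l x,
      forall l f M, 0 < M -> (forall x, nm (f x) <= M) ->
        rnorm (\sum_(x <- s) f x *: r l x) <= M * (1 + e) /\
        rnorm (\sum_(x <- s) f x *: (r l x ** r l x)) <= M * (1 + e),
      forall l f g M N, 0 < M -> 0 < N -> (forall x, nm (f x) <= M) ->
        (forall x, nm (g x) <= N) ->
        rnorm ((\sum_(x <- s) f x *: r l x) ** (\sum_(x <- s) g x *: r l x) -
               \sum_(x <- s) (f x * g x) *: (r l x ** r l x)) <= M * N * e /\
        rnorm ((\sum_(x <- s) f x *: (r l x ** r l x)) **
               (\sum_(x <- s) g x *: (r l x ** r l x)) -
               \sum_(x <- s) (f x * g x) *: (r l x ** r l x ** (r l x ** r l x))) <= M * N * e,
      forall l f M a, 0 < M -> (forall x, nm (f x) <= M) -> a \in E ->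
        rnorm ((\sum_(x <- s) f x *: r l x) ** a - a ** (\sum_(x <- s) f x *: r l x)) <= M * e &
      (forall l t f M a, t \in ts -> 0 < M -> (forall x, nm (f x) <= M) -> a \in E ->
        rnorm ((alpha t (\sum_(x <- s) f x *: (r l x ** r l x)) -
          \sum_(x <- s) f x *: (r l (coset_ltrans t x) ** r l (coset_ltrans t x))) ** a)
          <= M * e) /\
      (forall a, a \in E -> rnorm ((\sum_l \sum_(x <- s) r l x ** r l x) ** a - a) <= e)].
Proof.
move=> us sP hd e0 D ED; pose N : R := (size s).+1%:R.
have [g g0 hg] := almost_orthogonal_sum_scaled (size s) e0.
have N1 : 1 <= N by rewrite ler1n.
have N0 : 0 < N by rewrite (lt_le_trans _ N1).
have sN : (size s)%:R <= N by rewrite ler_nat.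
(* From e' <= 1 follows |r| <= 2, so products of distinct squares are at most 4 e' <= g. The last
   term absorbs the N^2 off-diagonal terms, each at most 4 e' up to the coefficients. *)
pose e' := Num.min 1 (Num.min (g / 4) (e / 4 / (N * N))).
have e'0 : 0 < e' by rewrite !lt_min ltr01 !divr_gt0// mulr_gt0.
have e'1 : e' <= 1 by rewrite ge_min lexx.
have e'g : e' <= g / 4 by rewrite !ge_min lexx orbT.
have NNe : N * (N * e') <= e / 4.
  by rewrite mulrA mulrC -ler_pdivlMr ?mulr_gt0// !ge_min lexx !orbT.
have Ne : N * e' <= e / 4 by apply: le_trans NNe; rewrite ler_peMl// mulr_ge0// ltW.
have e'e : e' <= e / 4 by apply: le_trans Ne; rewrite ler_peMl// ltW.
have [r [[sr r1 ro] rc rt ri]] := rokhlin_stage ts us sP hd e'0 ED.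
have rn l x : rnorm (r l x) <= 1 + g.
  rewrite -(@ler_pXn2r _ 2) ?nnegrE ?rnorm_ge0 ?addr_ge0 ?(ltW g0)//.
  by rewrite -rnorm_star_smul sr (le_trans (r1 l x))//; nra.
have rn2 l x : rnorm (r l x) <= 2.
  rewrite -(@ler_pXn2r _ 2) ?nnegrE ?rnorm_ge0//.
  by rewrite -rnorm_star_smul sr (le_trans (r1 l x))//; lra.
have srr l x : star (r l x ** r l x) = r l x ** r l x by rewrite starM sr.
have roo l x y : x != y -> rnorm (r l x ** r l x ** (r l y ** r l y)) <= 4 * e'.
  move=> xy; rewrite -smulA (smulA (r l x) (r l y)) (le_trans (rnormM _ _))//.
  rewrite (_ : 4 * e' = 2 * (e' * 2)); last by ring.
  apply: ler_pM; rewrite ?rnorm_ge0 ?rn2//; apply: le_trans (rnormM _ _) _.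
  by apply: ler_pM; rewrite ?rnorm_ge0 ?rn2// ro.
have sum_le (V : normedModType R[i]) (F : coset_space K -> V) (c : R) : 0 <= c ->
    (forall x, rnorm (F x) <= c) -> rnorm (\sum_(x <- s) F x) <= N * c.
  move=> c0 Fc; rewrite (le_trans (rnorm_sum s c0 (fun x _ => Fc x)))//.
  by rewrite ler_wpM2r.
have e'0' := ltW e'0.
have diag (F H : coset_space K -> R[i]) (y : coset_space K -> A) (M M' : R) :
    0 < M -> 0 < M' -> (forall x, nm (F x) <= M) -> (forall x, nm (H x) <= M') ->
    (forall x x', x != x' -> rnorm (y x ** y x') <= 4 * e') ->
    rnorm ((\sum_(x <- s) F x *: y x) ** (\sum_(x <- s) H x *: y x) -
      \sum_(x <- s) (F x * H x) *: (y x ** y x)) <= M * M' * e.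
  move=> M0 M'0 FM HM yy.
  have MM0 : 0 <= M * M' by rewrite mulr_ge0// ltW.
  have c0 : 0 <= M * M' * (4 * e') by rewrite !mulr_ge0// ltW.
  have ab x x' : x != x' -> rnorm ((F x *: y x) ** (H x' *: y x')) <= M * M' * (4 * e').
    move=> xx'; rewrite smulZl smulZr scalerA; apply: rnormZ_le (yy _ _ xx').
    exact: nmM_le.
  have := diag_mul us c0 ab.
  under [X in rnorm (_ - X)]eq_bigr do rewrite smulZl smulZr scalerA.
  move=> /le_trans; apply.
  apply: le_trans (_ : N * (N * (M * M' * (4 * e'))) <= _).
    by apply: ler_pM; rewrite ?mulr_ge0 ?(ltW M0) ?(ltW M'0)// ler_wpM2r.
  have -> : N * (N * (M * M' * (4 * e'))) = M * M' * (4 * (N * (N * e'))) by ring.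
  by rewrite ler_wpM2l//; lra.
exists r; split=> //.
- move=> l f M M0 fM; split; apply: (hg _ s) => //.
  + by move=> x y /(ro l)/le_trans; apply; lra.
  + by move=> x; rewrite (le_trans (r1 l x))//; lra.
  + by move=> x y /(roo l)/le_trans; apply; lra.
- move=> l f h M M' M0 M'0 fM hM; split; apply: diag => //.
    by move=> x x' /(ro l)/le_trans; apply; lra.
  exact: roo.
- move=> l f M a M0 fM aE; rewrite smul_suml smul_sumr -sumrB.
  have Me0 : 0 <= M * e' by rewrite mulr_ge0// ltW.
  apply: le_trans (sum_le _ _ (M * e') Me0 _) _.
    by move=> x; rewrite smulZl smulZr -scalerBr; apply: rnormZ_le => //; exact: rc.
  by rewrite mulrCA ler_wpM2l ?(ltW M0)//; lra.
- split=> [l t f M a tt M0 fM aE|a aE]; last by apply: le_trans (ri a aE) _; lra.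
  rewrite linear_sum -sumrB smul_suml.
  have Me0 : 0 <= M * e' by rewrite mulr_ge0// ltW.
  apply: le_trans (sum_le _ _ (M * e') Me0 _) _.
    by move=> x; rewrite linearZ -scalerBr smulZl; apply: rnormZ_le => //; exact: rt.
  by rewrite mulrCA ler_wpM2l ?(ltW M0)//; lra.
Qed.

End stage_sums.

(** * Maps on the profinite completion *)

Section assembly.
Variables (R : realType) (G : groupType) (A : cstarAlgType R) (alpha : cstar_action G A).
Variables (D : sepInvSubalg alpha) (d : nat).
Local Notation nm a := (complex.Re `|a|).
Local Notation cst := (@const_Ainf R A).
Local Notation eps n := ((n.+1%:R)^-1 : R).

Lemma eps_small (C e : R) : 0 < e -> \forall n \near \oo, C * eps n <= e.
Proof.
move=> e0; exists (Num.truncn (`|C| / e)) => // n /= Cn.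
rewrite ler_pdivrMr// mulrC -ler_pdivrMr//.
have h : C / e <= `|C| / e by rewrite ler_pM2r ?invr_gt0// ler_norm.
rewrite (le_trans h)// (le_trans (ltW (truncnS_gt _)))// ler_nat ltnS.
exact: Cn.
Qed.

Lemma eps_le1 n : eps n <= 1.
Proof. by rewrite invf_le1// ler1n. Qed.

Variable fs : nat -> A.
Hypothesis fs_dense : forall a e, sa_set D a -> 0 < e -> exists n, rnorm (a - fs n) <= e.

(** Uniformly bounded additive maps that tend to 0 on a dense sequence tend to 0 on all of D; the
    estimates of a stage concern finitely many [fs k] only. *)
Lemma dense_small (L : nat -> A -> A) (B : R) :
  (forall n a b, L n (a - b) = L n a - L n b) ->
  (forall n a, rnorm (L n a) <= B * rnorm a) ->
  (forall k e, 0 < e -> \forall n \near \oo, rnorm (L n (fs k)) <= e) ->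
  forall a e, sa_set D a -> 0 < e -> \forall n \near \oo, rnorm (L n a) <= e.
Proof.
move=> LB Lb Lk a e Da e0; pose B' := `|B| + 1.
have B'0 : 0 < B' by rewrite ltr_wpDl.
have e20 : 0 < e / 2 by rewrite divr_gt0.
have [k ak] := fs_dense Da (divr_gt0 e20 B'0).
apply: filterS (Lk k _ e20) => n h.
have -> : L n a = L n (a - fs k) + L n (fs k) by rewrite LB subrK.
rewrite (le_trans (rnormD _ _))// [e]splitr lerD// (le_trans (Lb _ _))//.
rewrite (le_trans (ler_wpM2r (rnorm_ge0 _) (_ : B <= B')))//.
  by rewrite (le_trans (ler_norm _))// lerDl.
by rewrite mulrC -ler_pdivlMr.
Qed.

Variables (c : nat -> nfi G) (ts : seq G).
Hypothesis c_decr : forall n m, (n <= m)%N -> sg_set (c m) `<=` sg_set (c n).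
Hypothesis c_cofinal : forall H : subgroup G, finite_index H ->
  exists n, sg_set (c n) `<=` sg_set H.
Variable s : forall n, seq (coset_space (c n)).
Hypothesis us : forall n, uniq (s n).
Hypothesis sP : forall n y, y \in s n.
Variable r : forall n, 'I_d.+1 -> coset_space (c n) -> A.
Hypothesis r_star : forall n l y, star (r l y : A) = @r n l y.
Hypothesis r_sum : forall n l f M, 0 < M -> (forall y, nm (f y) <= M) ->
  rnorm (\sum_(y <- s n) f y *: r l y) <= M * (1 + eps n) /\
  rnorm (\sum_(y <- s n) f y *: (r l y ** r l y)) <= M * (1 + eps n).
Hypothesis r_mul : forall n l f g M N, 0 < M -> 0 < N -> (forall y, nm (f y) <= M) ->
  (forall y, nm (g y) <= N) ->
  rnorm ((\sum_(y <- s n) f y *: r l y) ** (\sum_(y <- s n) g y *: r l y) -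
         \sum_(y <- s n) (f y * g y) *: (r l y ** r l y)) <= M * N * eps n /\
  rnorm ((\sum_(y <- s n) f y *: (r l y ** r l y)) **
         (\sum_(y <- s n) g y *: (r l y ** r l y)) -
         \sum_(y <- s n) (f y * g y) *: (r l y ** r l y ** (r l y ** r l y))) <= M * N * eps n.
Hypothesis r_comm : forall n k l f M, (k < n)%N -> 0 < M -> (forall y, nm (f y) <= M) ->
  rnorm ((\sum_(y <- s n) f y *: r l y) ** fs k - fs k ** (\sum_(y <- s n) f y *: r l y))
    <= M * eps n.
Hypothesis r_act : forall n k l t f M, (k < n)%N -> t \in ts -> 0 < M ->
  (forall y, nm (f y) <= M) ->
  rnorm ((alpha t (\sum_(y <- s n) f y *: (r l y ** r l y)) -
    \sum_(y <- s n) f y *: (r l (coset_ltrans t y) ** r l (coset_ltrans t y))) ** fs k)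
    <= M * eps n.
Hypothesis r_one : forall n k, (k < n)%N ->
  rnorm ((\sum_l \sum_(y <- s n) r l y ** r l y) ** fs k - fs k) <= eps n.

Definition rep (H : subgroup G) (y : coset_space H) : G := proj1_sig (cid (cosetP y)).
Lemma repE (H : subgroup G) (y : coset_space H) : coset H (rep y) = y.
Proof. by rewrite /rep; case: cid. Qed.

Definition ev (f : contfun R (profinite G)) n (y : coset_space (c n)) : R[i] :=
  subalg_val f (prof_point (rep y)).

(** One is added because the estimates of a stage require a positive bound, even for the zero
    function. *)
Let MF (f : contfun R (profinite G)) : R := rnorm f + 1.

Lemma MF_gt0 f : 0 < MF f. Proof. by rewrite ltr_wpDl ?rnorm_ge0. Qed.
Lemma ev_rnorm f n (y : coset_space (c n)) : nm (ev f y) <= rnorm f.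
Proof. exact: (linf_norm_ub (subalg_val f) (prof_point (rep y))). Qed.
Lemma ev_le f n (y : coset_space (c n)) : nm (ev f y) <= MF f.
Proof. by rewrite (le_trans (ev_rnorm _ _))// lerDl. Qed.

Lemma ev_linear (a : R[i]) f g n (y : coset_space (c n)) :
  ev (a *: f + g) y = a * ev f y + ev g y.
Proof. exact: contfun_linear. Qed.
Lemma ev_mul f g n (y : coset_space (c n)) : ev (f ** g) y = ev f y * ev g y.
Proof. by rewrite /ev. Qed.
Lemma ev_star f n (y : coset_space (c n)) : ev (star f) y = (ev f y)^*.
Proof. by rewrite /ev. Qed.
Lemma ev0 n (y : coset_space (c n)) : ev 0 y = 0.
Proof. by rewrite /ev. Qed.

Definition psi_fun l f : nat -> A := fun n => \sum_(y <- s n) ev f y *: r l y.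
Definition phi_fun l f : nat -> A := fun n => \sum_(y <- s n) ev f y *: (r l y ** r l y).

Lemma MF_bound f n : MF f * (1 + eps n) <= MF f * 2.
Proof. by rewrite ler_pM2l ?MF_gt0// -[2]/(1 + 1) lerD2l eps_le1. Qed.

Fact psi_bounded l f : psi_fun l f \in @bounded_family R nat A.
Proof.
apply/bounded_familyP; exists (MF f * 2) => n.
exact: le_trans (proj1 (r_sum l (MF_gt0 f) (@ev_le f n))) (MF_bound f n).
Qed.
Fact phi_bounded l f : phi_fun l f \in @bounded_family R nat A.
Proof.
apply/bounded_familyP; exists (MF f * 2) => n.
exact: le_trans (proj2 (r_sum l (MF_gt0 f) (@ev_le f n))) (MF_bound f n).
Qed.

Definition psi_inf l f : Ainf A := qpi (c0_ideal A) (Linf (psi_bounded l f)).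
Definition phi_inf l f : Ainf A := qpi (c0_ideal A) (Linf (phi_bounded l f)).

Lemma Ainf_eqP (x y : linf nat A) :
  (forall e, 0 < e -> \forall n \near \oo, rnorm (x n - y n) <= e) ->
  qpi (c0_ideal A) x = qpi (c0_ideal A) y.
Proof.
move=> h; apply/eqP; rewrite -subr_eq0 -qpiB; apply/eqP; exact: Ainf_eq0.
Qed.

Lemma psi_inf_linear l (a : R[i]) f g : psi_inf l (a *: f + g) = a *: psi_inf l f + psi_inf l g.
Proof.
rewrite /psi_inf -qpiZ -qpiD; congr qpi; apply/val_inj/funext => n /=.
transitivity (a *: psi_fun l f n + psi_fun l g n); last by [].
rewrite /psi_fun scaler_sumr -big_split; apply: eq_bigr => y _ /=.
by rewrite ev_linear scalerDl scalerA.
Qed.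

Lemma psi_inf_star l f : star (psi_inf l f) = psi_inf l (star f).
Proof.
rewrite /psi_inf -qpiS; congr qpi; apply/val_inj/funext => n /=.
rewrite /psi_fun star_sum; apply: eq_bigr => y _.
by rewrite starZ r_star ev_star.
Qed.

Lemma psi_inf_mul l f g : psi_inf l f ** psi_inf l g = phi_inf l (f ** g).
Proof.
rewrite /psi_inf /phi_inf -qpiM; apply: Ainf_eqP => e e0.
apply: filterS (@eps_small (MF f * MF g) e e0) => n; apply: le_trans.
exact: (proj1 (r_mul l (MF_gt0 f) (MF_gt0 g) (@ev_le f n) (@ev_le g n))).
Qed.

(** Sampling is multiplicative, so the diagonal coefficients f_y g_y vanish and only the small
    off-diagonal part remains. *)
Lemma phi_inf_mul0 l f g : f ** g = 0 -> phi_inf l f ** phi_inf l g = 0.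
Proof.
move=> fg; rewrite /phi_inf -qpiM; apply: Ainf_eq0 => e e0.
apply: filterS (@eps_small (MF f * MF g) e e0) => n; apply: le_trans.
have := proj2 (r_mul l (MF_gt0 f) (MF_gt0 g) (@ev_le f n) (@ev_le g n)).
rewrite [X in rnorm (_ - X)]big1 ?subr0// => y _.
by rewrite -ev_mul fg ev0 scale0r.
Qed.

Lemma psi_inf_comm l f : sa_set (commutant D) (psi_inf l f).
Proof.
move=> a Da; apply/eqP; rewrite -subr_eq0 /psi_inf /const_Ainf -!qpiM -qpiB; apply/eqP.
apply: Ainf_eq0 => e e0.
pose L n (a : A) := psi_fun l f n ** a - a ** psi_fun l f n.
apply: (@dense_small L (2 * (MF f * 2))) => //.
- move=> n a' b; rewrite /L smulBr smulBl !opprB !addrA.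
  by rewrite [LHS](ACl (1*4*3*2)).
- move=> n b; have h := le_trans (proj1 (r_sum l (MF_gt0 f) (@ev_le f n))) (MF_bound f n).
  rewrite (le_trans (rnormD _ _))// rnormN mulrDl mul1r mulrDl.
  apply: lerD; apply: le_trans (rnormM _ _) _; first by rewrite ler_wpM2r ?rnorm_ge0.
  by rewrite mulrC ler_wpM2r ?rnorm_ge0.
- move=> k e1 e10; have h := @eps_small (MF f) e1 e10.
  have h2 : \forall n \near \oo, (k < n)%N by exists k.+1.
  apply: filterS2 h h2 => n h3 kn; apply: le_trans h3.
  exact: (r_comm l kn (MF_gt0 f) (@ev_le f n)).
Qed.

Definition psiS l f : subalg (commutant D) := mk_subalg (psi_inf_comm l f).
Definition psiF l f : Fcs D := qpi (Ann D) (psiS l f).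
Let one := contfun1 R (profinite G).
(** The class of [phi_inf l f], by [psiS_val]. As a product it lies in the commutant automatically,
    so centrality has to be proved for psi only. *)
Definition phiF l f : Fcs D := psiF l f ** psiF l one.

Lemma contfun_mulr1 (f : contfun R (profinite G)) : f ** one = f.
Proof.
apply: contfunP => u; have -> : subalg_val (f ** one) u = subalg_val f u * 1 by [].
exact: mulr1.
Qed.
Lemma contfun_mul1r (f : contfun R (profinite G)) : one ** f = f.
Proof.
apply: contfunP => u; have -> : subalg_val (one ** f) u = 1 * subalg_val f u by [].
exact: mul1r.
Qed.

Lemma psiF_linear l (a : R[i]) f g : psiF l (a *: f + g) = a *: psiF l f + psiF l g.
Proof.
rewrite /psiF -qpiZ -qpiD; congr qpi; apply: val_inj => /=; exact: psi_inf_linear.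
Qed.

Lemma phiF_linear l : linear (phiF l).
Proof. by move=> a f g; rewrite /phiF psiF_linear smulDl smulZl. Qed.

Definition phiL l : {linear contfun R (profinite G) -> Fcs D} :=
  HB.pack (phiF l) (GRing.isLinear.Build R[i] _ _ _ (phiF l) (phiF_linear l)).

Lemma psiF_mul l f g : psiF l f ** psiF l g = phiF l (f ** g).
Proof.
rewrite /phiF /psiF -!qpiM; congr qpi; apply: val_inj => /=.
by rewrite !psi_inf_mul contfun_mulr1.
Qed.

Lemma psiF_star l f : star (psiF l f) = psiF l (star f).
Proof. by rewrite /psiF -qpiS; congr qpi; apply: val_inj => /=; exact: psi_inf_star. Qed.

Lemma one_star : star one = one.
Proof.
apply: contfunP => u; have -> : subalg_val (star one) u = (1 : R[i])^* by [].
exact: rmorph1.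
Qed.

Lemma phiF_star l f : star (phiF l f) = phiF l (star f).
Proof. by rewrite /phiF starM !psiF_star one_star psiF_mul contfun_mul1r. Qed.

Lemma phiF_val l f : phiF l f = qpi (Ann D) (psiS l f ** psiS l one).
Proof. by rewrite qpiM. Qed.

Lemma psiS_val l f : subalg_val (psiS l f ** psiS l one) = phi_inf l f.
Proof. by rewrite /= psi_inf_mul contfun_mulr1. Qed.

Lemma phiF_cp l : completely_positive (phiF l).
Proof.
move=> n _ [Y ->]; exists (map_mx (psiF l) Y); apply/matrixP => i j; rewrite !mxE.
rewrite [LHS](linear_sum (phiL l)); apply: eq_bigr => k _ /=.
by rewrite !mxE psiF_star psiF_mul.
Qed.

Lemma phiF_contractive l : contractive (phiF l).
Proof.
move=> f; rewrite !rnormE lecR phiF_val (le_trans (rnorm_Fcs_le _))// psiS_val.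
apply/ler_addgt0Pr => e e0; apply: Ainf_le_eventually.
  by rewrite addr_ge0 ?rnorm_ge0// ltW.
have e20 : 0 < e / 2 by rewrite divr_gt0.
(* The bound has to be positive, but [MF f] would be too large for contractivity. *)
pose M := rnorm f + e / 2.
have M0 : 0 < M by rewrite ltr_wpDl ?rnorm_ge0.
apply: filterS (@eps_small M _ e20) => n h.
have fM (y : coset_space (c n)) : nm (ev f y) <= M.
  by rewrite (le_trans (ev_rnorm _ _))// lerDl ltW.
apply: le_trans (proj2 (r_sum l M0 fM)) _.
by rewrite mulrDr mulr1 [e in leRHS]splitr addrA lerD.
Qed.

Lemma phiF_mul0 l f g : f ** g = 0 -> phiF l f ** phiF l g = 0.
Proof.
move=> fg; rewrite !phiF_val -qpiM -(alg_hom0 (qpi_hom (Ann D))); congr qpi.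
apply: val_inj; change (subalg_val (psiS l f ** psiS l one) **
  subalg_val (psiS l g ** psiS l one) = 0).
by rewrite !psiS_val phi_inf_mul0.
Qed.

Lemma phiF_order_zero l : order_zero (phiF l).
Proof.
move=> f g [fg gf sfg sgf]; split; rewrite ?phiF_star; exact: phiF_mul0.
Qed.

(** Restricted to the finite list [ts], which is all that the stages control. *)
Lemma phiF_equivariant_gen l t f : t \in ts ->
  phiF l (sigma_prof t f) = Fcs_act (@sis_invariant _ _ _ alpha D) t (phiF l f).
Proof.
move=> tt; rewrite !phiF_val Fcs_actE; apply/Fcs_eqP => a Da.
change ((subalg_val (psiS l (sigma_prof t f) ** psiS l one) -
  Ainf_act alpha t (subalg_val (psiS l f ** psiS l one))) ** cst a = 0).
rewrite !psiS_val /phi_inf Ainf_actE -qpiB /const_Ainf -qpiM.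
apply: Ainf_eq0 => e e0.
pose L n (a : A) := (phi_fun l (sigma_prof t f) n - alpha t (phi_fun l f n)) ** a.
have pb g n : rnorm (phi_fun l g n) <= MF g * 2.
  exact: le_trans (proj2 (r_sum l (MF_gt0 g) (@ev_le g n))) (MF_bound g n).
apply: (@dense_small L (MF (sigma_prof t f) * 2 + MF f * 2)) => //.
- by move=> n a' b; rewrite /L smulBr.
- move=> n b; rewrite (le_trans (rnormM _ _))// ler_wpM2r ?rnorm_ge0//.
  rewrite (le_trans (rnormD _ _))// rnormN; apply: lerD; first exact: pb.
  apply: le_trans (pb f n).
  exact: star_hom_rnorm (cactM alpha t) (cactS alpha t) _.
move=> k e1 e10; have e120 : 0 < e1 / 2 by rewrite divr_gt0.
have h1 := @eps_small (MF f) _ e120.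
have h2 : \forall n \near \oo, (k < n)%N by exists k.+1.
pose q := rnorm (fs k) + 1.
have q0 : 0 < q by rewrite ltr_wpDl ?rnorm_ge0.
pose dl := e1 / 4 / q; have dl0 : 0 < dl by rewrite !divr_gt0.
have [n0 unif] := uniform_on_cylinders c_decr c_cofinal f dl0.
have h3 : \forall n \near \oo, (n0 <= n)%N by exists n0.
apply: filterS3 h1 h2 h3 => n h1 kn n0n.
(* X is the intermediate term: [r_act] compares it with the translate of phi(f). After reindexing,
   its coefficients differ from those of the translated function only in that f is sampled at the
   representative of t^-1 y instead of t^-1 times that of y; both lie in the same cylinder. *)
pose X := \sum_(y <- s n) ev f y *: (r l (coset_ltrans t y) ** r l (coset_ltrans t y)).
have -> : L n (fs k) = (phi_fun l (sigma_prof t f) n - X) ** fs k -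
    (alpha t (phi_fun l f n) - X) ** fs k.
  by rewrite -smulBl opprB addrA subrK.
have XE : X = \sum_(y <- s n) ev f (coset_ltrans t^-1%g y) *: (r l y ** r l y).
  have pe : perm_eq [seq coset_ltrans t y | y <- s n] (s n).
    apply: uniq_perm => [||y]; [|exact: us|].
      by rewrite map_inj_uniq ?us//; exact: can_inj (@coset_ltransK _ _ t).
    rewrite sP; apply/mapP; exists (coset_ltrans t^-1%g y) => //.
    by rewrite coset_ltransVK.
  rewrite -(perm_big _ pe) big_map; apply: eq_bigr => y _.
  by rewrite coset_ltransK.
rewrite (le_trans (rnormD _ _))// rnormN [e1]splitr lerD//; last first.
  exact: le_trans (r_act l kn tt (MF_gt0 f) (@ev_le f n)) h1.
rewrite (le_trans (rnormM _ _))//.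
have D1 : rnorm (phi_fun l (sigma_prof t f) n - X) <= dl * 2.
  rewrite XE /phi_fun -sumrB.
  under eq_bigr do rewrite -scalerBl.
  have fy (y : coset_space (c n)) :
      nm (ev (sigma_prof t f) y - ev f (coset_ltrans t^-1%g y)) <= dl.
    have -> : ev (sigma_prof t f) y = subalg_val f (prof_ltrans t^-1%g (prof_point (rep y))).
      by [].
    apply: (unif n) => //; rewrite component_ltrans !component_point.
    by rewrite !repE.
  apply: le_trans (proj2 (r_sum l dl0 fy)) _.
  by rewrite ler_pM2l// -[2]/(1 + 1) lerD2l eps_le1.
have qk : rnorm (fs k) <= q by rewrite lerDl.
apply: le_trans (ler_pM (rnorm_ge0 _) (rnorm_ge0 _) D1 qk) _.
have -> : dl * 2 * q = e1 / 2 by rewrite /dl; field; rewrite gt_eqF.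
exact: lexx.
Qed.

(** It suffices that W fixes D under multiplication: elements of the commutant can be moved past D,
    so W w and w W agree with w against every element of D. *)
Lemma phiF_identity : is_identity (\sum_l phiF l one).
Proof.
pose W : subalg (commutant D) := \sum_l psiS l one ** psiS l one.
have -> : \sum_l phiF l one = qpi (Ann D) W.
  by rewrite qpi_sum; apply: eq_bigr => l _; rewrite phiF_val.
have WE : subalg_val W = \sum_l phi_inf l one.
  rewrite (big_morph (@subalg_val _ _ (commutant D)) (id1 := 0) (op1 := +%R))//.
  by apply: eq_bigr => l _; rewrite psiS_val.
have Wa a : sa_set D a -> subalg_val W ** cst a = cst a.
  move=> Da; rewrite WE /phi_inf -qpi_sum /const_Ainf -qpiM; apply: Ainf_eqP => e e0.
  pose S n := \sum_l \sum_(y <- s n) r l y ** r l y.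
  have SE n : (\sum_l Linf (phi_bounded l one) : linf nat A) n = S n.
    rewrite linf_sum_val; apply: eq_bigr => l _; apply: eq_bigr => y _.
    by rewrite /ev /= scale1r.
  pose W' : linf nat A := \sum_l Linf (phi_bounded l one).
  pose L n (a : A) := W' n ** a - a.
  apply: (@dense_small L (linf_norm W' + 1)) => //.
  - by move=> n a' b; rewrite /L smulBr !opprD !addrA [LHS](ACl (1*3*2*4)).
  - move=> n b; rewrite (le_trans (rnormD _ _))// rnormN mulrDl mul1r lerD//.
    by rewrite (le_trans (rnormM _ _))// ler_wpM2r ?rnorm_ge0// linf_norm_ub.
  - move=> k e1 e10; have h1 := @eps_small 1 _ e10.
    have h2 : \forall n \near \oo, (k < n)%N by exists k.+1.
    apply: filterS2 h1 h2 => n h1 kn.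
    by rewrite /L SE (le_trans (r_one kn))//; rewrite mul1r in h1.
move=> q; have [w <-] := Fcs_lift q; rewrite -!qpiM; split; apply/Fcs_eqP => a Da.
  rewrite [subalg_val (W ** w)](_ : _ = subalg_val W ** subalg_val w)// smulBl -smulA.
  by rewrite (commutantP w Da) smulA Wa// -(commutantP w Da) subrr.
rewrite [subalg_val (w ** W)](_ : _ = subalg_val w ** subalg_val W)// smulBl -smulA.
by rewrite Wa// subrr.
Qed.

End assembly.

(** * Pulling maps back along quotients; the two implications *)

Section pullbacks.
Variables (R : realType) (X Y : topologicalType) (h : Y -> X) (h_cont : continuous h).

Lemma pullback_linear (a : R[i]) (f g : contfun R X) :
  pullback h_cont (a *: f + g) = a *: pullback h_cont f + pullback h_cont g.
Proof.
apply: contfunP => u.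
have E := contfun_linear a (pullback h_cont f) (pullback h_cont g) u.
have E' := contfun_linear a f g (h u).
refine (eq_trans _ (esym E)).
exact: E'.
Qed.

Lemma pullback_mul (f g : contfun R X) :
  pullback h_cont (f ** g) = pullback h_cont f ** pullback h_cont g.
Proof. by apply: contfunP. Qed.

Lemma pullback_star (f : contfun R X) : pullback h_cont (star f) = star (pullback h_cont f).
Proof. by apply: contfunP. Qed.

Lemma pullback1 : pullback h_cont (contfun1 R X) = contfun1 R Y.
Proof. by apply: contfunP. Qed.

Lemma pullback_norm (f : contfun R X) : rnorm (pullback h_cont f) <= rnorm f.
Proof.
apply: (@linf_norm_le R _ _ (subalg_val (pullback h_cont f))) => [|y].
  exact: rnorm_ge0.
exact: (linf_norm_ub (subalg_val f) (h y)).
Qed.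

HB.instance Definition _ := GRing.isLinear.Build R[i] (contfun R X) (contfun R Y) _
  (@pullback R X Y h h_cont) pullback_linear.

Lemma pullback0 : pullback h_cont (0 : contfun R X) = 0.
Proof. exact: linear0. Qed.

Variables (B : normedStarAlgType R) (phi : {linear contfun R Y -> B}).

Lemma pullback_cp : completely_positive phi -> completely_positive (phi \o pullback h_cont).
Proof.
move=> cp n F [Z FZ]; have [|W WE] := cp n (map_mx (pullback h_cont) F).
  exists (map_mx (pullback h_cont) Z); apply/matrixP => i j; rewrite FZ !mxE linear_sum.
  by apply: eq_bigr => k _; rewrite !mxE /= pullback_mul pullback_star.
by exists W; rewrite -WE; apply/matrixP => i j; rewrite !mxE.
Qed.

Lemma pullback_contractive : contractive phi -> contractive (phi \o pullback h_cont).
Proof.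
move=> co f /=; apply: le_trans (co _) _.
by rewrite !rnormE lecR; exact: pullback_norm.
Qed.

Lemma pullback_order_zero : order_zero phi -> order_zero (phi \o pullback h_cont).
Proof.
move=> oz f g [fg gf sfg sgf]; apply: oz.
by split; rewrite -?pullback_star -pullback_mul ?fg ?gf ?sfg ?sgf pullback0.
Qed.

End pullbacks.

Section quotient_map.
Variables (G : groupType) (K : nfi G) (H : subgroup G).
Hypothesis KH : sg_set K `<=` sg_set H.

Definition to_coset (x : profinite G) : coset_space H := coset H (rep (component K x)).

Lemma to_coset_continuous : continuous to_coset.
Proof.
move=> x U /nbhs_singleton Ux.
have h : nbhs x (component K @^-1` [set component K x]).
  exact: (@component_continuous G K x _ (discrete_set1 _)).
apply: (filterS _ h) => y /= yx.
by rewrite [to_coset y](_ : _ = to_coset x)// /to_coset yx.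
Qed.

(** The representative of a translated K-coset and the translate of the representative may differ,
    but they share a K-coset and hence an H-coset. *)
Lemma to_coset_ltrans t (x : profinite G) :
  to_coset (prof_ltrans t x) = coset_ltrans t (to_coset x).
Proof.
rewrite /to_coset component_ltrans coset_ltransE; apply/coset_eqP/KH/coset_eqP.
by rewrite repE -coset_ltransE repE.
Qed.
End quotient_map.

Section directions.
Variables (R : realType) (G : groupType) (A : cstarAlgType R) (alpha : cstar_action G A).
Hypothesis fg : finitely_generated G.

Lemma dimRok_le (d : nat) :
  (forall D : sepInvSubalg alpha,
     exists phi : 'I_d.+1 -> {linear contfun R (profinite G) -> Fcs D},
       (forall l, equivariant_ccp_order_zero (@sigma_prof R G) (phi l)) /\
       is_identity (\sum_l phi l (contfun1 R (profinite G)))) ->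
  (dimRok alpha <= (d%:R)%:E)%E.
Proof.
move=> h; apply: ge_ereal_sup => _ [H /= Hf <-]; apply: ge_ereal_inf.
exists (d%:R)%:E => //; exists d => //= D; have [phi [phiP phi1]] := h D.
have [c [_ c_cof]] := nfi_chain fg.
have [n cH] := c_cof H Hf.
pose q := pullback (R := R) (@to_coset_continuous G (c n) H).
have q_sigma t f : q (sigma_coset t f) = sigma_prof t (q f).
  apply: contfunP => x.
  change (subalg_val f (coset_ltrans t^-1%g (to_coset (c n) H x)) =
    subalg_val f (to_coset (c n) H (prof_ltrans t^-1%g x))).
  by rewrite to_coset_ltrans.
exists (fun l => (phi l \o q)%FUN : {linear _ -> _}); split=> [l|].
  have [cp co oz eq] := phiP l; split.
  - exact: pullback_cp.
  - exact: pullback_contractive.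
  - exact: pullback_order_zero.
  - move=> t b; rewrite -eq -q_sigma; exact: erefl.
by under eq_bigr do rewrite /= /q pullback1.
Qed.

Lemma coset_enum (H : subgroup G) : finite_index H ->
  exists s : seq (coset_space H), uniq s /\ forall y, y \in s.
Proof.
move=> Hf; have : finite_set [set: coset_space H].
  apply: (@sub_finite_set _ _ (@set_val _ (cosets H) @^-1` cosets H)).
    by move=> c _; exact: set_valP.
  by apply: finite_preimage => // x y _ _; exact: val_inj.
move=> /finite_seqP[s sE]; exists (undup s); split; first exact: undup_uniq.
move=> y; rewrite mem_undup.
have : [set: coset_space H] y by [].
by rewrite sE.
Qed.

Lemma Fcs_act_comp (D : sepInvSubalg alpha) t u (q : Fcs D) :
  Fcs_act (@sis_invariant _ _ _ alpha D) (t * u)%g q =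
  Fcs_act (@sis_invariant _ _ _ alpha D) t (Fcs_act (@sis_invariant _ _ _ alpha D) u q).
Proof.
have [w <-] := Fcs_lift q; rewrite !Fcs_actE; congr qpi; apply: val_inj => /=.
have [x ->] := Ainf_lift (subalg_val w); rewrite !Ainf_actE; congr qpi.
by apply/val_inj/funext => n /=; rewrite cactMg.
Qed.

Lemma Fcs_act1 (D : sepInvSubalg alpha) (q : Fcs D) :
  Fcs_act (@sis_invariant _ _ _ alpha D) 1%g q = q.
Proof.
have [w <-] := Fcs_lift q; rewrite !Fcs_actE; congr qpi; apply: val_inj => /=.
have [x ->] := Ainf_lift (subalg_val w); rewrite !Ainf_actE; congr qpi.
by apply/val_inj/funext => n /=; rewrite cact1.
Qed.

Lemma sigma_prof_comp t u (f : contfun R (profinite G)) :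
  sigma_prof (t * u)%g f = sigma_prof t (sigma_prof u f).
Proof.
apply: contfunP => x; rewrite /sigma_prof /=; congr (subalg_val f _).
by apply: val_inj; apply: functional_extensionality_dep => H /=; rewrite coset_ltransM invgM.
Qed.

Lemma sigma_prof1 (f : contfun R (profinite G)) : sigma_prof 1%g f = f.
Proof.
apply: contfunP => x; rewrite /sigma_prof /=; congr (subalg_val f _).
apply: val_inj; apply: functional_extensionality_dep => H /=; rewrite invg1.
by apply: val_inj; rewrite /= ltrans1.
Qed.

Lemma dimRok_le_prof (d : nat) : (dimRok alpha <= (d%:R)%:E)%E ->
  forall D : sepInvSubalg alpha,
     exists phi : 'I_d.+1 -> {linear contfun R (profinite G) -> Fcs D},
       (forall l, equivariant_ccp_order_zero (@sigma_prof R G) (phi l)) /\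
       is_identity (\sum_l phi l (contfun1 R (profinite G))).
Proof.
move=> hd D.
have hdH (H : nfi G) : (dimRokH alpha H <= (d%:R)%:E)%E.
  apply: le_trans hd; apply: ereal_sup_ubound; exists (nfi_sub H) => //.
  exact: nfi_finite.
have [c [c_decr c_cof]] := nfi_chain fg.
have [ts tsP] := fg.
have [f [fD f_dense]] := dense_sequence D.
pose s n := proj1_sig (cid (coset_enum (nfi_finite (c n)))).
have sP n : uniq (s n) /\ forall y, y \in s n by rewrite /s; case: cid.
have e0 n : 0 < (n.+1%:R)^-1 :> R by rewrite invr_gt0.
have fE n a : a \in [seq f k | k <- iota 0 n] -> sa_set D a.
  by move=> /mapP[k _ ->].
(* Stage n handles the first n elements of the dense sequence with tolerance 1 / (n + 1). *)
pose st n := rokhlin_stage_sums ts (proj1 (sP n)) (proj2 (sP n)) (hdH (c n)) (e0 n) (@fE n).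
pose r n := proj1_sig (cid (st n)).
have rP n := proj2_sig (cid (st n)).
have fn k n : (k < n)%N -> f k \in [seq f k | k <- iota 0 n].
  by move=> kn; rewrite map_f// mem_iota.
have us n : uniq (s n) by case: (sP n).
have sa n y : y \in s n by case: (sP n).
have h1 n l y : star (r n l y) = r n l y by have [h _ _ _ _] := rP n; exact: h.
have h2 := fun n => let: And5 _ h _ _ _ := rP n in h.
have h3 := fun n => let: And5 _ _ h _ _ := rP n in h.
have h4 n k l g M (kn : (k < n)%N) M0 gM :=
  (let: And5 _ _ _ h _ := rP n in h) l g M (f k) M0 gM (fn k n kn).
have h5 n k l t g M (kn : (k < n)%N) tt M0 gM :=
  (let: And5 _ _ _ _ h := rP n in proj1 h) l t g M (f k) tt M0 gM (fn k n kn).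
have h6 n k (kn : (k < n)%N) := (let: And5 _ _ _ _ h := rP n in proj2 h) (f k) (fn k n kn).
exists (phiL f_dense h2 h4); split=> [l|].
  split.
  - by apply: phiF_cp.
  - exact: phiF_contractive.
  - by apply: phiF_order_zero.
  pose P := phiF f_dense h2 h4 l.
  (* Equivariance holds for t in a subgroup of G, and this subgroup contains the generators. *)
  pose E : set G := [set t | forall b, P (sigma_prof t b) =
    Fcs_act (@sis_invariant _ _ _ alpha D) t (P b)].
  have E1 : E 1%g by move=> b'; rewrite sigma_prof1 Fcs_act1.
  have EM x y : E x -> E y -> E (x * y)%g.
    by move=> Ex Ey b'; rewrite sigma_prof_comp Ex Ey Fcs_act_comp.
  have EV x : E x -> E x^-1%g.
    move=> Ex b'; rewrite -[LHS]Fcs_act1 -(mulVg x) Fcs_act_comp -Ex.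
    by rewrite -sigma_prof_comp mulgV sigma_prof1.
  apply: (tsP (Subgroup E1 EM EV)) => u uts b'.
  by apply: phiF_equivariant_gen uts.
by apply: phiF_identity.
Qed.

End directions.

Theorem corollary2p6 (R : realType) (G : groupType) (A : cstarAlgType R)
    (alpha : cstar_action G A) (d : nat) :
  finitely_generated G -> residually_finite G ->
  ((dimRok alpha <= (d%:R)%:E)%E <->
   forall D : sepInvSubalg alpha,
     exists phi : 'I_d.+1 -> {linear contfun R (profinite G) -> Fcs D},
       (forall l, equivariant_ccp_order_zero (@sigma_prof R G) (phi l)) /\
       is_identity (\sum_l phi l (contfun1 R (profinite G)))).
Proof.
by move=> fg _; split; [exact: dimRok_le_prof|exact: dimRok_le].
Qed.
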